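(* Let $M\ge1$ be an integer and let $f:\mathbb{R}^{n-1}\to\mathbb{R}$ be measurable with $$\int_{\mathbb{R}^{n-1}}|f(y')|\left(|y'|^{M-1}+1\right)dy'<\infty. \qquad ( * )$$ Then, as $|x|\to\infty$ in $\Pi_+$: (i) for $n\ge2$, $\displaystyle D[f](x)=\sum_{m=0}^{M-1}|x|^{-(m+n-1)}Y_{m+1}^{(0)}(\hat x)+o\left(|x|^{-(M+n-2)}\sec^{n-1}\theta\right)$; (ii) for $n\ge3$, $\displaystyle N[f](x)=\sum_{m=0}^{M-1}|x|^{-(m+n-2)}Y_{m}^{(1)}(\hat x)+o\left(|x|^{-(M+n-3)}\sec^{n-2}\theta\right)$. Here $$Y_{m+1}^{(0)}(\hat x)=\alpha_n\cos\theta\int_{\mathbb{R}^{n-1}}f(y')|y'|^mC_m^{n/2}(\Theta)\,dy'$$ is a spherical harmonic of degree $m+1$ that vanishes on $\partial\Pi_+$, and $$Y_m^{(1)}(\hat x)=\frac{\alpha_n}{n-2}\int_{\mathbb{R}^{n-1}}f(y')|y'|^mC_m^{(n-2)/2}(\Theta)\,dy'$$ is a spherical harmonic of degree $m$ whose normal derivative vanishes on $\partial\Pi_+$. Moreover, in each of (i) and (ii) the data $f$ can be chosen so that simultaneously the leading order term ($m=0$) does not vanish and the order relation is sharp: writing $\omega(x)$ for $|x|^{-(M+n-2)}\sec^{n-1}\theta$ in case (i) and for $|x|^{-(M+n-3)}\sec^{n-2}\theta$ in case (ii), for every $\psi:\Pi_+\to(0,\infty)$ with $\psi(x)=o(\omega(x))$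 ($x\in\Pi_+$, $|x|\to\infty$) and every sequence $\{x^{(i)}\}$ in $\Pi_+$ with $|x^{(i)}|\to\infty$, there is a continuous $f$ satisfying $( * )$ for which the $m=0$ term of the expansion does not vanish in $\Pi_+$ and for which the remainder $R(x)$ (the left side minus the sum over $0\le m\le M-1$) satisfies $R(x^{(i)})/\psi(x^{(i)})\not\to0$ as $i\to\infty$.
   Context: Half space: $\Pi_+=\{x\in\mathbb{R}^n: x_n>0\}$; $\hat x=x/|x|$. For $x\in\Pi_+$ let $y\in\mathbb{R}^{n-1}$ be the projection of $x$ onto $\partial\Pi_+$ (identified with $\mathbb{R}^{n-1}$), and let $\theta\in[0,\pi/2)$ be the angle between $x$ and the unit normal $\hat e_n$, so $x_n=|x|\cos\theta$, $|y|=|x|\sin\theta$. For $y'\in\mathbb{R}^{n-1}$, $\theta'\in[0,\pi]$ is the angle between $y$ and $y'$ (with $\theta'=\pi/2$ if $y=0$ or $y'=0$; when $n=2$, $\cos\theta'=\operatorname{sgn}(x_1y')$). Put $\Theta=\sin\theta\cos\theta'$, so that $y\cdot y'=|x||y'|\Theta$. $C_m^\lambda$ are the Gegenbauer polynomials: $(1-2tz+z^2)^{-\lambda}=\sum_{m\ge0}z^mC_m^\lambda(t)$. Poisson integrals: with $K(\lambda,x,y')=\left[|y'-y|^2+x_n^2\right]^{-\lambda}$, $\omega_n=\pi^{n/2}/\Gamma(1+n/2)$ (the volume of the unit $n$-ball) and $\alpha_n=2/(n\omega_n)$, $$D[f](x)=\alpha_nx_n\int_{\mathbb{R}^{n-1}}f(y')K\left(\tfrac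 n2,x,y'\right)dy'\ (n\ge2),\qquad N[f](x)=\frac{\alpha_n}{n-2}\int_{\mathbb{R}^{n-1}}f(y')K\left(\tfrac{n-2}2,x,y'\right)dy'\ (n\ge3).$$ A spherical harmonic of degree $m$ is the restriction to the unit sphere of a homogeneous harmonic polynomial of degree $m$ on $\mathbb{R}^n$. ''Vanishes on $\partial\Pi_+$'' and ''normal derivative vanishes on $\partial\Pi_+$'' mean that the homogeneous harmonic polynomial $h(x)=|x|^{k}Y(\hat x)$ ($k$ the degree) satisfies $h=0$, respectively $\partial h/\partial x_n=0$, where $x_n=0$. Order relations: $g(x)=o(\omega(x))$ ($x\in\Pi_+$, $|x|\to\infty$) means $\sup\{|g(x)|/\omega(x):x\in\Pi_+,|x|=r\}\to0$ as $r\to\infty$. *)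

(* Defs.v *)
From HB Require Import structures.
From mathcomp Require Import all_boot all_order all_algebra.
(* The notations of multinomials clash with those of MathComp-Analysis, and some
   of its names (measure, isMeasure) are shadowed by importing it first. *)
From mathcomp Require Import -(notations) mpoly.
From mathcomp Require Import all_classical all_reals all_analysis.

Set Implicit Arguments.
Unset Strict Implicit.
Unset Printing Implicit Defensive.

Import Order.TTheory GRing.Theory Num.Theory.
Import numFieldNormedType.Exports.

Local Open Scope classical_set_scope.
Local Open Scope ring_scope.

(* Lebesgue measure on R^d = 'rV[R]_d: the sigma-algebra generated by the
   coordinates, the product measure, and then its completion. *)
Section Measurable_rV.
Context {R : realType} (d : nat).

Let coord (i : 'I_d) (v : 'rV[R]_d) : measurableTypeR R := v ord0 i.

Let rV_set0 : g_sigma_preimage coord set0.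
Proof. exact: sigma_algebra0. Qed.

Let rV_setC A : g_sigma_preimage coord A -> g_sigma_preimage coord (~` A).
Proof. exact: sigma_algebraC. Qed.

Let rV_bigcup (F : (set 'rV[R]_d)^nat) : (forall i, g_sigma_preimage coord (F i)) ->
  g_sigma_preimage coord (\bigcup_i (F i)).
Proof. exact: sigma_algebra_bigcup. Qed.

HB.instance Definition _ := @isMeasurable.Build default_measure_display
  'rV[R]_d (g_sigma_preimage coord) rV_set0 rV_setC rV_bigcup.

Lemma measurable_coord (i : 'I_d) :
  measurable_fun [set: 'rV[R]_d] (fun v => v ord0 i : measurableTypeR R).
Proof.
move=> _ Y mY; rewrite setTI; apply: sub_sigma_algebra => /=.
rewrite -bigcup_seq/=; exists i => /=; first by rewrite mem_index_enum.
by exists Y => //; rewrite setTI.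
Qed.

Lemma measurable_fun_rVP d1 (T1 : measurableType d1) (f : T1 -> 'rV[R]_d) :
  measurable_fun [set: T1] f <->
  forall i, measurable_fun [set: T1] (fun x => f x ord0 i : measurableTypeR R).
Proof.
split=> [mf i|mf].
  exact: (measurableT_comp (measurable_coord i) mf).
move=> _ B mB; rewrite setTI.
have : g_sigma_preimage coord `<=` [set A | measurable (f @^-1` A)].
  apply: smallest_sub.
    split=> /=.
    - by rewrite preimage_set0.
    - by move=> A mA; rewrite setTD preimage_setC; exact: measurableC.
    - by move=> F mF; rewrite preimage_bigcup; exact: bigcup_measurable.
  rewrite -bigcup_seq => A [i _ [C mC <-]] /=.
  by rewrite setTI -comp_preimage -[X in measurable X]setTI; exact: mf.
by apply.
Qed.

End Measurable_rV.

Definition rV_cons {R : realType} d (p : measurableTypeR R * 'rV[R]_d) :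
  'rV[R]_d.+1 := \row_i if unlift ord0 i is Some j then p.2 ord0 j else p.1.

Section lebesgue_step.
Context {R : realType} (d : nat).
Variable mu : {sigma_finite_measure set 'rV[R]_d -> \bar R}.

Lemma measurable_rV_cons : measurable_fun setT (@rV_cons R d).
Proof.
apply/measurable_fun_rVP => i; rewrite /rV_cons.
under eq_fun do rewrite mxE.
case: unliftP => [j|] _; last exact: measurable_fst.
exact: (measurableT_comp (measurable_coord j) measurable_snd).
Qed.

Definition lebesgue_step : set 'rV[R]_d.+1 -> \bar R :=
  pushforward (lebesgue_measure \x mu)%E (@rV_cons R d).

Let step0 : lebesgue_step set0 = 0%E.
Proof. by rewrite /lebesgue_step /pushforward preimage_set0 measure0. Qed.

Let step_ge0 A : (0 <= lebesgue_step A)%E.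
Proof. exact: (measure_ge0 (lebesgue_measure \x mu)%E). Qed.

Let step_sigma_additive : semi_sigma_additive lebesgue_step.
Proof.
move=> F mF tF mUF; rewrite /lebesgue_step /pushforward preimage_bigcup.
have mpre A : measurable A -> measurable (@rV_cons R d @^-1` A).
  by move=> mA; rewrite -[X in measurable X]setTI; exact: measurable_rV_cons.
apply: measure_semi_sigma_additive.
- by move=> n; exact: mpre.
- apply/trivIsetP => /= i j _ _ ij; rewrite -preimage_setI.
  by move/trivIsetP : tF => /(_ _ _ _ _ ij) ->//; rewrite preimage_set0.
- by rewrite -preimage_bigcup; exact: mpre.
Qed.

HB.instance Definition _ := isMeasure.Build _ _ _ lebesgue_step
  step0 step_ge0 step_sigma_additive.

Let rV_uncons (v : 'rV[R]_d.+1) : measurableTypeR R * 'rV[R]_d :=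
  (v ord0 ord0, \row_j v ord0 (lift ord0 j)).

Let rV_consK : cancel (@rV_cons R d) rV_uncons.
Proof.
move=> [a v]; rewrite /rV_uncons /rV_cons mxE unlift_none /=; congr pair.
by apply/rowP => j; rewrite !mxE liftK.
Qed.

Let measurable_rV_uncons : measurable_fun setT rV_uncons.
Proof.
apply/measurable_fun_pairP; split; first exact: measurable_coord.
apply/measurable_fun_rVP => j; rewrite /comp /rV_uncons /=.
under eq_fun do rewrite mxE.
exact: measurable_coord.
Qed.

Let step_sigma_finite : sigma_finite setT lebesgue_step.
Proof.
have /sigma_finiteP[F [TF ndF Foo]] := sigma_finiteT (@lebesgue_measure R).
have /sigma_finiteP[G [TG ndG Goo]] := sigma_finiteT mu.
exists (fun k => rV_uncons @^-1` (F k `*` G k)).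
  rewrite -preimage_bigcup (_ : \bigcup_k _ = setT) ?preimage_setT//.
  apply/seteqP; split => // -[a v] _.
  have [i _ Fa] : (\bigcup_k F k) a by rewrite -TF.
  have [j _ Gv] : (\bigcup_k G k) v by rewrite -TG.
  exists (maxn i j) => //; split.
    by move: a Fa; exact/subsetPset/ndF/leq_maxl.
  by move: v Gv; exact/subsetPset/ndG/leq_maxr.
move=> k; have [mF Fk] := Foo k; have [mG Gk] := Goo k.
have mFG : measurable (F k `*` G k) by exact: measurableX.
split; first by rewrite -[X in measurable X]setTI; exact: measurable_rV_uncons.
rewrite /lebesgue_step /pushforward -comp_preimage.
rewrite (_ : rV_uncons \o _ = id); last by apply/funext => p /=; rewrite rV_consK.
by rewrite product_measure1E// lte_mul_pinfty// ge0_fin_numE.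
Qed.

HB.instance Definition _ := Measure_isSigmaFinite.Build _ _ _ lebesgue_step
  step_sigma_finite.

End lebesgue_step.

Fixpoint borel_lebesgue (R : realType) (d : nat) :
    {sigma_finite_measure set 'rV[R]_d -> \bar R} :=
  if d is d'.+1 then lebesgue_step (borel_lebesgue R d')
  else \d_(0 : 'rV[R]_0).

Lemma borel_lebesgue_box (R : realType) (d : nat)
    (A : 'I_d -> set (measurableTypeR R)) : (forall i, measurable (A i)) ->
  borel_lebesgue R d [set v | forall i, A i (v ord0 i)] =
  (\prod_(i < d) lebesgue_measure (A i))%E.
Proof.
elim: d A => [|d IH] A mA.
  rewrite big_ord0 /= diracE mem_set//.
  by move=> [].
have mB : measurable [set v : 'rV[R]_d | forall j, A (lift ord0 j) (v ord0 j)].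
  rewrite (_ : [set v | _] = \big[setI/setT]_(j < d)
      ((fun v : 'rV[R]_d => v ord0 j) @^-1` A (lift ord0 j))); last first.
    apply/seteqP; split=> v /=.
      by move=> Av; elim/big_ind : _ => [//|B C Bv Cv|j _]; [by split|exact: Av].
    by move=> Av j; move: Av; rewrite (bigD1 j)//= => -[].
  apply: bigsetI_measurable => j _; rewrite -[X in measurable X]setTI.
  exact: measurable_coord.
rewrite big_ord_recl -IH// -product_measure1E//= /lebesgue_step /pushforward.
congr (product_measure1 _ _ _); apply/seteqP; split=> -[a v] /=.
  move=> Av; split; first by have := Av ord0; rewrite mxE unlift_none.
  by move=> j; have := Av (lift ord0 j); rewrite mxE liftK.
move=> [Aa Av] i; rewrite mxE; case: unliftP => [j ->|->] //.
Qed.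

Definition lebesgue_space (R : realType) (d : nat) : measurableType _ :=
  caratheodory_type ((borel_lebesgue R d)^*)%mu.

Definition lebesgue (R : realType) (d : nat) :
    {measure set (lebesgue_space R d) -> \bar R} :=
  @completed_measure_extension _ _ _ (borel_lebesgue R d).

Section euclidean.
Context {R : realType} {d : nat}.
Implicit Types u v : 'rV[R]_d.

Definition dot u v : R := \sum_i u ord0 i * v ord0 i.

(* The norm `|v| of MathComp-Analysis on row vectors is the sup norm. *)
Definition enorm v : R := Num.sqrt (dot v v).

Definition hat v : 'rV[R]_d := (enorm v)^-1 *: v.

End euclidean.

(* Points of the ambient space R^n, n = d.+1, are x : 'rV[R]_d.+1; points of the
   boundary hyperplane R^(n-1) are y : 'rV[R]_d. *)
Section half_space.
Context {R : realType} {d : nat}.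
Implicit Types (x : 'rV[R]_d.+1) (y : 'rV[R]_d).

Definition height x : R := x ord0 ord_max.

Definition half_space : set 'rV[R]_d.+1 := [set x | 0 < height x].

Definition bproj x : 'rV[R]_d := \row_i x ord0 (widen_ord (leqnSn d) i).

Definition theta x : R := acos (height x / enorm x).

Definition theta' x y : R :=
  if (bproj x == 0) || (y == 0) then pi / 2
  else acos (dot (bproj x) y / (enorm (bproj x) * enorm y)).

Definition Theta x y : R := sin (theta x) * cos (theta' x y).

Definition sec (t : R) : R := (cos t)^-1.

(* g(x) = o(w(x)) as |x| -> oo in the half space; the supremum is taken in the
   extended reals so that an unbounded quotient is not given a default value. *)
Definition little_o (g w : 'rV[R]_d.+1 -> R) : Prop :=
  ereal_sup [set (`|g x| / w x)%:E | x in half_space `&` [set x | enorm x = r]]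
    @[r --> +oo] --> 0%E.

End half_space.

Section special_functions.
Context {R : realType}.

Definition Gamma (s : R) : R :=
  \int[lebesgue_measure]_(t in `]0, +oo[) (t `^ (s - 1) * expR (- t)).

(* c is the sequence of coefficients of z ^+ m in the expansion of
   (1 - 2 t z + z^2)^(-l) around z = 0. *)
Definition gegenbauer_expansion (l t : R) (c : R^nat) : Prop :=
  exists2 r : R, 0 < r & forall z : R, `|z| < r ->
    pseries c z @ \oo --> (1 - 2 * t * z + z ^+ 2) `^ (- l).

Definition gegenbauer (m : nat) (l t : R) : R :=
  get [set c | gegenbauer_expansion l t c] m.

Definition ball_volume (n : nat) : R :=
  pi `^ (n%:R / 2) / Gamma (1 + n%:R / 2).

Definition alpha (n : nat) : R := 2 / (n%:R * ball_volume n).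

End special_functions.

Section poisson.
Context {R : realType} {d : nat}.
Local Notation n := d.+1.
Implicit Types (x xi : 'rV[R]_n) (f : 'rV[R]_d -> R) (M m : nat).

Definition poisson_kernel (l : R) x (y : 'rV[R]_d) : R :=
  (enorm (y - bproj x) ^+ 2 + height x ^+ 2) `^ (- l).

Definition Dint f x : R :=
  alpha n * height x * \int[lebesgue R d]_y (f y * poisson_kernel (n%:R / 2) x y).

Definition Nint f x : R :=
  alpha n / (n%:R - 2) * \int[lebesgue R d]_y (f y * poisson_kernel ((n%:R - 2) / 2) x y).

Definition admissible M f : Prop :=
  measurable_fun [set: lebesgue_space R d] (f : lebesgue_space R d -> R) /\
  (\int[lebesgue R d]_y (`|f y| * (enorm y ^+ (M - 1) + 1))%:E < +oo)%E.

(* Y0 f m has degree m + 1 and Y1 f m degree m. Both are defined on the whole unit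
   sphere, with theta xi in [0, pi]. *)
Definition Y0 f m xi : R :=
  alpha n * cos (theta xi) *
  \int[lebesgue R d]_y (f y * enorm y ^+ m * gegenbauer m (n%:R / 2) (Theta xi y)).

Definition Y1 f m xi : R :=
  alpha n / (n%:R - 2) *
  \int[lebesgue R d]_y
    (f y * enorm y ^+ m * gegenbauer m ((n%:R - 2) / 2) (Theta xi y)).

Definition Dterm f m x : R := enorm x ^- (m + n - 1) * Y0 f m (hat x).

Definition Nterm f m x : R := enorm x ^- (m + n - 2) * Y1 f m (hat x).

Definition Drem M f x : R := Dint f x - \sum_(m < M) Dterm f m x.

Definition Nrem M f x : R := Nint f x - \sum_(m < M) Nterm f m x.

Definition Dgauge M x : R := enorm x ^- (M + n - 2) * sec (theta x) ^+ (n - 1).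

Definition Ngauge M x : R := enorm x ^- (M + n - 3) * sec (theta x) ^+ (n - 2).

End poisson.

Section harmonic.
Context {R : realType} {d : nat}.
Local Notation n := d.+1.
Implicit Types (h : mpoly n R) (Y : 'rV[R]_n -> R).

Definition peval h (x : 'rV[R]_n) : R := meval (fun i => x ord0 i) h.

(* ishomog1 k mdeg is the predicate written k.-homog in multinomials. *)
Definition harmonic_form (k : nat) h : Prop :=
  h \is ishomog1 k mdeg /\ \sum_(i < n) mderiv i (mderiv i h) = 0.

(* Y is a spherical harmonic of degree k, that is, the restriction to the unit
   sphere of a homogeneous harmonic polynomial h of degree k; moreover h
   (respectively its last partial derivative) vanishes on the boundary of the
   half space. *)
Definition spherical_harmonic_dirichlet (k : nat) Y : Prop :=
  exists h, [/\ harmonic_form k h,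
    forall x, enorm x = 1 -> Y x = peval h x &
    forall x, height x = 0 -> peval h x = 0].

Definition spherical_harmonic_neumann (k : nat) Y : Prop :=
  exists h, [/\ harmonic_form k h,
    forall x, enorm x = 1 -> Y x = peval h x &
    forall x, height x = 0 -> peval (mderiv ord_max h) x = 0].

End harmonic.

(* The error term of an expansion with gauge w is sharp: here rem f is the
   remainder and lead f the leading term of the expansion for the data f. *)
Definition sharp (R : realType) (d M : nat)
    (rem lead : ('rV[R]_d -> R) -> 'rV[R]_d.+1 -> R) (w : 'rV[R]_d.+1 -> R) : Prop :=
  forall psi : 'rV[R]_d.+1 -> R,
    (forall x, half_space x -> 0 < psi x) -> little_o psi w ->
  forall xs : nat -> 'rV[R]_d.+1,
    (forall i, half_space (xs i)) -> enorm (xs i) @[i --> \oo] --> +oo ->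
  exists f : 'rV[R]_d -> R,
    [/\ continuous f, admissible M f,
        forall x, half_space x -> lead f x != 0 &
        ~ (rem f (xs i) / psi (xs i) @[i --> \oo] --> (0 : R))].

(* Main.v *)
Require Import Defs.
From mathcomp Require Import all_boot all_order all_algebra.
From mathcomp Require Import -(notations) mpoly.
From mathcomp Require Import all_classical all_reals all_analysis.
From mathcomp Require Import measurable_realfun.
From mathcomp Require Import ring lra zify.

Set Implicit Arguments.
Unset Strict Implicit.
Unset Printing Implicit Defensive.

Import Order.TTheory GRing.Theory Num.Theory.
Import numFieldNormedType.Exports.

Local Open Scope classical_set_scope.
Local Open Scope ring_scope.

(** Put [r = |x|], [s = |y| / r] and let [t = Theta x y], so that the dot product
of [y] with the projection of [x] is [r |y| t]. Both Poisson kernels then are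
[r ^- e * (1 - 2 t s + s ^ 2) ^ (- e / 2)], with [e = n] for the Dirichlet
integral (after the factor [alpha n * height x]) and [e = n - 2] for the Neumann
integral, so both halves of the theorem are statements about one remainder
kernel [kernel_rem e M]: the Poisson kernel minus the first [M] terms of its
expansion in Gegenbauer polynomials.

Error term. For small [s] the remainder is [O(s ^ M)]
([gegenbauer_partial_approx]); for other [s] the base [1 - 2 t s + s ^ 2] is at
least [cos (theta x) ^ 2], which costs the factor [sec (theta x) ^ e], while the
polynomial part is [O(s ^ (M - 1))]. Together ([kernel_rem_le])
the remainder kernel is at most a constant times
[r ^- (M - 1 + e) * sec (theta x) ^ e * |y| ^ (M - 1) * min 1 (|y| / r)]. Against
an admissible [f] the last factor makes the integral tend to zero by dominated
convergence, uniformly in the direction of [x].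

Spherical harmonics. The function [r ^ m * |y| ^ m * C_m t] is a polynomial in
[x], a combination of [U ^ (m - 2 k) * |x| ^ (2 k)] where [U] is the
linear form [x |-> bproj x . y]. The ratio of consecutive coefficients of the
Gegenbauer polynomial is the one that makes the Laplacian telescope to zero in
dimension [2 l + 2]; multiplication by the height, on which [U] does not depend,
acts like two more dimensions and moves the condition to dimension [2 l]. This
is why the indices [(n - 2) / 2] and [n / 2] occur. Integrating against [f]
coefficient by coefficient keeps the polynomial homogeneous and harmonic.

Sharpness. For every [x] there is a [y] of size comparable to [|x|] at which the
remainder kernel is as large as the upper bound allows ([kernel_rem_ge]): near
the boundary the point below [x], and elsewhere one of [M] equally spaced points
on a ray, because the subtracted polynomial has degree less than [M] and equals
[1] at the origin. Hence the functionals [f |-> remainder(x_i) / psi(x_i)] have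
unbounded norms on the weighted L^1 space of continuous functions, and a gliding
hump ([gliding_hump]) produces one [f] on which they do not tend to zero. The
leading term is a nonzero multiple of the integral of [f], and adding a
fixed function of nonzero integral makes it nonvanishing when necessary. *)

(** * Gegenbauer polynomials *)

Section gegenbauer_polynomials.
Context {R : realType}.
Implicit Types (l t u rho : R) (m k : nat).

Definition rising l k : R := \prod_(i < k) (l + i%:R).

(** The coefficient of [t ^ (m - 2 k)] in the Gegenbauer polynomial of degree [m].
It is set to zero for [2 k > m], so that sums over [k] may run over
any larger range. *)
Definition gegenbauer_coef l m k : R :=
  if (k.*2 <= m)%N
  then (-1) ^+ k * rising l (m - k) * 2 ^+ (m - k.*2) / (k`! * (m - k.*2)`!)%:R
  else 0.

Lemma risingS l k : rising l k.+1 = rising l k * (l + k%:R).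
Proof. by rewrite /rising big_ord_recr. Qed.

Lemma gegenbauer_coefE l p k : gegenbauer_coef l (p + k.*2) k =
  (-1) ^+ k * rising l (p + k) * 2 ^+ p / (k`! * p`!)%:R.
Proof.
rewrite /gegenbauer_coef leq_addl addnK.
by congr (_ * rising _ _ * _ / _); lia.
Qed.

Lemma gegenbauer_coef_small l m k : (m < k.*2)%N -> gegenbauer_coef l m k = 0.
Proof. by rewrite /gegenbauer_coef ltnNge => /negbTE ->. Qed.

Lemma gegenbauer_coef_rec0 l m :
  m.+2%:R * gegenbauer_coef l m.+2 0 =
  2 * (m.+1%:R + l) * gegenbauer_coef l m.+1 0.
Proof.
have := gegenbauer_coefE l m.+2 0; have := gegenbauer_coefE l m.+1 0.
rewrite !addn0 => -> ->; rewrite risingS !exprS factS fact0 !mul1n natrM.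
by field; rewrite -!natrD !pnatr_eq0 -!lt0n !fact_gt0.
Qed.

Lemma gegenbauer_coef_recS l m k :
  m.+2%:R * gegenbauer_coef l m.+2 k.+1 =
  2 * (m.+1%:R + l) * gegenbauer_coef l m.+1 k.+1
  - (m%:R + 2 * l) * gegenbauer_coef l m k.
Proof.
have [mk|km] := ltnP m k.*2.
  by rewrite !gegenbauer_coef_small ?doubleS//; [ring|lia..].
rewrite -(subnK km); set q := (m - k.*2)%N; clearbody q; clear m km.
have -> : (q + k.*2).+2 = (q + (k.+1).*2)%N by rewrite doubleS !addnS.
rewrite !gegenbauer_coefE.
case: q => [|q].
  rewrite (_ : gegenbauer_coef _ _.+1 _ = 0); last first.
    by rewrite gegenbauer_coef_small// doubleS; lia.
  rewrite !add0n risingS !exprS factS fact0 !muln1 !natrM.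
  rewrite doubleS -addnn -!addnS !natrD.
  by field; rewrite -?natrD ?nat1r !pnatr_eq0 -?lt0n ?fact_gt0.
have -> : (q.+1 + k.*2).+1 = (q + (k.+1).*2)%N by rewrite doubleS !addnS addSn.
rewrite !gegenbauer_coefE !doubleS !addnS !addSn !risingS !exprS !factS !natrM.
rewrite -addnn. by field; rewrite -?natrD ?nat1r !pnatr_eq0 -?lt0n ?fact_gt0.
Qed.

(** The Gegenbauer polynomial made homogeneous by a second variable [rho] of
degree two: it is evaluated below at a dot product and a product of squared
norms, where it is a polynomial in the coordinates although the cosine is not. *)
Definition gegenbauer_form l m u rho : R :=
  \sum_(k < m.+1) gegenbauer_coef l m k * u ^+ (m - k.*2) * rho ^+ k.

Lemma gegenbauer_form_widen K l m u rho : (m < K)%N -> gegenbauer_form l m u rho =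
  \sum_(k < K) gegenbauer_coef l m k * u ^+ (m - k.*2) * rho ^+ k.
Proof.
move=> mK; rewrite /gegenbauer_form (big_ord_widen _ (fun k =>
  gegenbauer_coef l m k * u ^+ (m - k.*2) * rho ^+ k) mK) big_mkcond/=.
apply: eq_bigr => k _; case: ltnP => // mk.
by rewrite gegenbauer_coef_small ?mul0r//; lia.
Qed.

Lemma gegenbauer_form_rec l m u rho :
  m.+2%:R * gegenbauer_form l m.+2 u rho =
  2 * (m.+1%:R + l) * u * gegenbauer_form l m.+1 u rho
  - (m%:R + 2 * l) * rho * gegenbauer_form l m u rho.
Proof.
rewrite (gegenbauer_form_widen (K := m.+3))// (gegenbauer_form_widen (K := m.+3))//.
rewrite (gegenbauer_form_widen (K := m.+2))//.
rewrite !mulr_sumr [LHS]big_ord_recl [X in _ = X - _]big_ord_recl -addrA -sumrB /=.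
congr +%R.
  have := gegenbauer_coef_rec0 l m.
  move: (gegenbauer_coef l m.+2 0) (gegenbauer_coef l m.+1 0) => a b ab.
  by rewrite double0 !subn0 !expr0 !mulr1 mulrA ab [u ^+ _.+2]exprS; ring.
apply: eq_bigr => k _; rewrite /bump/= !add1n.
rewrite !mulrA gegenbauer_coef_recS doubleS !subSS.
have [mk|km] := ltnP m k.*2.
  rewrite (@gegenbauer_coef_small l m.+1) ?doubleS//; last by lia.
  by rewrite (@gegenbauer_coef_small l m)//; ring.
move: km; rewrite leq_eqVlt => /orP[/eqP km|km].
  rewrite (@gegenbauer_coef_small l m.+1) ?doubleS -?km//; last by lia.
  by rewrite exprS; ring.
have -> : (m - k.*2 = (m - k.*2.+1).+1)%N by lia.
by rewrite [rho ^+ _.+1]exprS [u ^+ _.+1]exprS; ring.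
Qed.

End gegenbauer_polynomials.

(** * The generating function of the Gegenbauer polynomials *)

Section generating_function.
Context {R : realType}.
Implicit Types (l t z : R) (m N : nat).

Definition gegenbauer_poly l m t : R := gegenbauer_form l m t 1.

Lemma gegenbauer_poly0 l t : gegenbauer_poly l 0 t = 1.
Proof.
rewrite /gegenbauer_poly /gegenbauer_form big_ord_recl big_ord0 addr0 !expr0.
rewrite (gegenbauer_coefE l 0 0) /rising big_ord0 !expr0 fact0 !muln1 divr1.
by rewrite !mulr1.
Qed.

Lemma gegenbauer_poly1 l t : gegenbauer_poly l 1 t = 2 * l * t.
Proof.
rewrite /gegenbauer_poly /gegenbauer_form !big_ord_recl big_ord0 addr0.
rewrite (gegenbauer_coefE l 1 0) (@gegenbauer_coef_small _ l 1 1)//.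
rewrite /rising big_ord_recl big_ord0 !expr0 !expr1 fact0 divr1.
by rewrite (_ : (ord0 : 'I_1)%:R = 0 :> R)//; ring.
Qed.

Lemma gegenbauer_poly_rec l m t :
  m.+2%:R * gegenbauer_poly l m.+2 t =
  2 * (m.+1%:R + l) * t * gegenbauer_poly l m.+1 t
  - (m%:R + 2 * l) * gegenbauer_poly l m t.
Proof. by rewrite gegenbauer_form_rec mulr1. Qed.

(** A crude geometric bound, by induction on the three-term recurrence, replaces
the sharp polynomial one: only a positive radius of convergence that is uniform
in [t] is needed. *)
Lemma gegenbauer_poly_le l m t : 0 < l -> `|t| <= 1 ->
  `|gegenbauer_poly l m t| <= (4 * (l + 1)) ^+ m.
Proof.
move=> l0 t1; set B := 4 * (l + 1).
have BE : B = 4 * (l + 1) by []; have B4 : 4 <= B by rewrite BE; lra.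
clearbody B.
suff : `|gegenbauer_poly l m t| <= B ^+ m /\
       `|gegenbauer_poly l m.+1 t| <= B ^+ m.+1 by case.
elim: m => [|m [IH1 IH2]].
  rewrite gegenbauer_poly0 gegenbauer_poly1 normr1 expr0 expr1; split => //.
  rewrite !normrM (ger0_norm (ltW l0)) ger0_norm//.
  by rewrite (le_trans (ler_piMr _ t1)) ?mulr_ge0 1?ltW// BE; lra.
split=> //.
have m2 : 0 < m.+2%:R :> R by rewrite ltr0n.
rewrite -(ler_pM2l m2) -[X in X * `|_|](gtr0_norm m2) -normrM gegenbauer_poly_rec.
rewrite (le_trans (ler_normB _ _))// !normrM.
have m0 : 0 <= m%:R :> R by rewrite ler0n.
rewrite (ger0_norm (_ : 0 <= 2))// (ger0_norm (_ : 0 <= m.+1%:R + l)); last first.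
  by rewrite addr_ge0// ltW.
rewrite (ger0_norm (_ : 0 <= m%:R + 2 * l)); last by rewrite addr_ge0// mulr_ge0// ltW.
have BM : 0 <= B ^+ m by rewrite exprn_ge0//; lra.
apply: (@le_trans _ _ (2 * (m.+1%:R + l) * B ^+ m.+1 + (m%:R + 2 * l) * B ^+ m)).
  apply: lerD; last by rewrite ler_wpM2l// addr_ge0// mulr_ge0// ltW.
  rewrite -mulrA ler_wpM2l ?mulr_ge0 ?addr_ge0 ?(ltW l0)//.
  by apply: (le_trans _ IH2); rewrite ler_piMl.
rewrite !exprS !mulrA -mulrDl ler_wpM2r//.
have -> : m.+1%:R = m%:R + 1 :> R by rewrite natr1.
have -> : m.+2%:R = m%:R + 2 :> R by rewrite -natrD addn2.
have -> : (m%:R + 2) * B * B = 4 * (m%:R + 2) * (l + 1) * B by rewrite {1}BE; ring.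
have ml : 0 <= m%:R * l by rewrite mulr_ge0// ltW.
have -> : 4 * (m%:R + 2) * (l + 1) * B = (2 * (m%:R * l) + 2 * m%:R + 4 * l + 4) * B
   + (2 * (m%:R * l) + 2 * m%:R + 4 * l + 4) * B by ring.
apply: lerD; first by rewrite ler_wpM2r//; lra.
rewrite (@le_trans _ _ ((2 * (m%:R * l) + 2 * m%:R + 4 * l + 4) * 1))//; first lra.
by rewrite ler_wpM2l//; lra.
Qed.

Definition gegenbauer_partial l t N : {poly R} :=
  \poly_(m < N.+1) gegenbauer_poly l m t.

Lemma gegenbauer_partialE l t N z : (gegenbauer_partial l t N).[z] =
  \sum_(m < N.+1) gegenbauer_poly l m t * z ^+ m.
Proof. by rewrite horner_poly. Qed.

Let gegenbauer_partialS l t N : gegenbauer_partial l t N.+1 =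
  gegenbauer_partial l t N + (gegenbauer_poly l N.+1 t)%:P * 'X^(N.+1).
Proof.
by rewrite /gegenbauer_partial !poly_def big_ord_recr/= mul_polyC.
Qed.

(** The recurrence says that the generating function [F] solves
[(1 - 2 t z + z ^ 2) F' = 2 l (t - z) F], so a partial sum solves it up to the
two terms that the truncation leaves uncancelled. *)
Lemma gegenbauer_partial_ode l t N z :
  (1 - 2 * t * z + z ^+ 2) * (gegenbauer_partial l t N)^`().[z]
  - 2 * l * (t - z) * (gegenbauer_partial l t N).[z] =
  - N.+1%:R * gegenbauer_poly l N.+1 t * z ^+ N
  + (N%:R + 2 * l) * gegenbauer_poly l N t * z ^+ N.+1.
Proof.
elim: N => [|N IH].
  rewrite /gegenbauer_partial poly_def big_ord1 expr0 derivZ derivC scaler0.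
  rewrite gegenbauer_poly0 gegenbauer_poly1 !hornerE /=; ring.
have -> : (gegenbauer_partial l t N.+1).[z] =
    (gegenbauer_partial l t N).[z] + gegenbauer_poly l N.+1 t * z ^+ N.+1.
  by rewrite gegenbauer_partialS hornerD hornerM hornerC hornerXn.
have -> : (gegenbauer_partial l t N.+1)^`().[z] =
    (gegenbauer_partial l t N)^`().[z] + N.+1%:R * gegenbauer_poly l N.+1 t * z ^+ N.
  rewrite gegenbauer_partialS derivD hornerD mul_polyC derivZ derivXn hornerZ.
  by rewrite hornerMn hornerXn -mulr_natl; ring.
move: IH; set a := _.[z]; set b := _.[z] => IH.
transitivity (((1 - 2 * t * z + z ^+ 2) * a - 2 * l * (t - z) * b) +
  ((1 - 2 * t * z + z ^+ 2) * N.+1%:R * gegenbauer_poly l N.+1 t * z ^+ N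
   - 2 * l * (t - z) * gegenbauer_poly l N.+1 t * z ^+ N.+1)); first ring.
rewrite IH !mulNr gegenbauer_poly_rec !exprS; ring.
Qed.

Lemma quad_bounds t z : `|t| <= 1 -> `|z| <= 4^-1 ->
  2^-1 <= 1 - 2 * t * z + z ^+ 2 <= 2.
Proof.
move=> t1 z1.
have tz : `|t * z| <= 4^-1.
  by rewrite normrM (le_trans _ z1)// ler_piMl.
have z2 : z ^+ 2 <= 4^-1 ^+ 2.
  by rewrite -[z ^+ 2]ger0_norm ?sqr_ge0// normrX lerXn2r ?nnegrE.
have z3 : 0 <= z ^+ 2 by rewrite sqr_ge0.
move: tz; rewrite ler_norml => /andP[h1 h2].
by apply/andP; split; [|]; rewrite -mulrA; lra.
Qed.

Lemma powR_le2 (q l : R) : 0 < l -> 2^-1 <= q -> q <= 2 ->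
  [/\ q `^ l <= 2 `^ l, q `^ (l - 1) <= 2 * 2 `^ l & q `^ (- l) <= 2 `^ l].
Proof.
move=> l0 q1 q2; have q0 : 0 < q by lra.
have h : q `^ l <= 2 `^ l by rewrite ge0_ler_powR ?nnegrE ?(ltW l0) ?(ltW q0).
split => //.
  rewrite powRB; last by rewrite (gt_eqF q0) implybT.
  rewrite powRr1 ?(ltW q0)// mulrC ler_pM ?invr_ge0 ?powR_ge0 ?(ltW q0)//.
  by rewrite -[X in _ <= X]invrK lef_pV2 ?posrE.
rewrite powRN -[2 `^ l]invrK lef_pV2 ?posrE ?invr_gt0 ?powR_gt0//.
rewrite -powRN -[X in 2 `^ X]mulN1r powRrM powR_inv1//.
by rewrite ge0_ler_powR ?nnegrE ?invr_ge0 ?(ltW l0) ?(ltW q0).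
Qed.

(** If [S] is a partial sum and [q z = 1 - 2 t z + z ^ 2], the derivative of
[S * q ^ l] is [q ^ (l - 1)] times the residual of the differential equation,
and [S * q ^ l] is [1] at the origin; the mean value theorem gives the bound.
Applied with [N] tending to infinity it yields the generating function, and with
[N] fixed the remainder estimate near the origin. *)
Lemma gegenbauer_partial_approx l t N z : 0 < l -> `|t| <= 1 ->
  `|z| <= (4 * (l + 1))^-1 ->
  `|(1 - 2 * t * z + z ^+ 2) `^ (- l) - (gegenbauer_partial l t N).[z]| <=
  2 * 2 `^ l * 2 `^ l * (2 * N%:R + 1 + 2 * l) * (4 * (l + 1) * `|z|) ^+ N.+1.
Proof.
move=> l0 t1 zB; set B := 4 * (l + 1) in zB *.
have BE : B = 4 * (l + 1) by []; have B4 : 4 <= B by rewrite BE; lra.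
clearbody B.
have z4 : `|z| <= 4^-1 by rewrite (le_trans zB)// lef_pV2 ?posrE//; lra.
set P := gegenbauer_partial l t N.
pose q (w : R) : R := 1 - 2 * t * w + w ^+ 2.
(* Restricting to the segment from 0 to z treats both signs of z at once. *)
pose phi (s : R) := P.[s * z] * q (s * z) `^ l.
pose rho (w : R) : R := - N.+1%:R * gegenbauer_poly l N.+1 t * w ^+ N
  + (N%:R + 2 * l) * gegenbauer_poly l N t * w ^+ N.+1.
pose dphi s := z * q (s * z) `^ (l - 1) * rho (s * z).
have small (s : R) : s \in `[0, 1] -> `|s * z| <= `|z|.
  by rewrite in_itv/= => /andP[s0 s1]; rewrite normrM ger0_norm// ler_piMl.
have qb (s : R) : s \in `[0, 1] -> 2^-1 <= q (s * z) <= 2.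
  by move=> s01; apply: quad_bounds => //; rewrite (le_trans (small _ s01)).
have qdrv (s : R) : is_derive s (1 : R) (fun s => q (s * z)) (z * (- 2 * t + 2 * (s * z))).
  rewrite /q; apply: is_derive_eq.
  by rewrite /GRing.scale/=; ring.
have Pdrv (s : R) : is_derive s (1 : R) (fun s => P.[s * z]) (z * P^`().[s * z]).
  have h : is_derive s (1 : R) (fun s => s * z) z.
    by apply: is_derive_eq; rewrite /GRing.scale/= mulr0 add0r mulr1.
  have := @is_derive1_comp R (horner P) (fun s => s * z) s _ _ (is_derive_poly P (s * z)) h.
  by rewrite mulrC.
have drv (s : R) : s \in `[0, 1] -> is_derive s (1 : R) phi (dphi s).
  move=> /[dup] s01 /qb /andP[q1 q2]; have q0 : 0 < q (s * z) by lra.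
  have := @is_derive1_comp R (fun w => w `^ l) (fun s => q (s * z)) s _ _ (is_derive1_powR l q0) (qdrv s) => h.
  have := @is_deriveM R R^o _ _ s 1 _ _ (Pdrv s) h; rewrite /GRing.scale/= => {}h.
  apply: is_derive_eq h _.
  rewrite /dphi /rho -gegenbauer_partial_ode -/P -/(q _) -(mulr_powRB1 (ltW q0) l0).
  by ring.
have cont : {within `[0, 1], continuous phi}.
  by apply: derivable_within_continuous => s s01; have := drv _ s01.
have drv' (s : R) : s \in `]0, 1[ -> is_derive s (1 : R) phi (dphi s).
  by move=> s01; apply: drv; apply: subset_itv_oo_cc s01.
have [s s01] := @MVT_segment R phi dphi 0 1 ler01 drv' cont.
clear cont drv drv' Pdrv qdrv.
rewrite /phi mul0r mul1r subr0 mulr1 /q !mulr0 expr0n/= subr0 addr0 powR1 mulr1.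
have -> : P.[0] = 1 by rewrite horner_coef0 coef_poly/= gegenbauer_poly0.
rewrite -/(q z) => E.
have /andP[q1 q2] : 2^-1 <= q z <= 2 by apply: quad_bounds.
have q0 : 0 < q z by lra.
have -> : q z `^ (- l) - P.[z] = - (q z `^ (- l) * dphi s).
  rewrite -E powRN; have := powR_gt0 l q0 => /lt0r_neq0 h; by field.
rewrite normrN normrM ger0_norm ?powR_ge0//.
have [_ _ hq] := powR_le2 l0 q1 q2.
have /andP[qs1 qs2] := qb s s01.
have [_ hqs _] := powR_le2 l0 qs1 qs2.
rewrite /dphi !normrM (ger0_norm (powR_ge0 _ _)).
have B0 : 0 <= B by lra.
have rhob : `|rho (s * z)| <= (2 * N%:R + 1 + 2 * l) * B ^+ N.+1 * `|z| ^+ N.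
  have sz := small _ s01.
  rewrite (le_trans (ler_normD _ _))// !normrM normrN !normrX.
  have D0 : 0 <= N%:R + 2 * l by rewrite addr_ge0// mulr_ge0// ltW.
  have -> : 2 * N%:R + 1 + 2 * l = N.+1%:R + (N%:R + 2 * l) by rewrite -natr1; ring.
  move: (N%:R + 2 * l) D0 => D D0; rewrite normr_nat (ger0_norm D0).
  have cN := gegenbauer_poly_le N l0 t1; have cN1 := gegenbauer_poly_le N.+1 l0 t1.
  rewrite -BE in cN cN1.
  rewrite -!mulrA mulrDl; apply: lerD.
    by rewrite ler_wpM2l// ler_pM ?exprn_ge0// lerXn2r ?nnegrE.
  rewrite ler_wpM2l// !exprS [B * _]mulrC -mulrA ler_pM ?mulr_ge0 ?exprn_ge0//.
  rewrite ler_pM ?exprn_ge0//; last by rewrite lerXn2r ?nnegrE.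
  by rewrite (le_trans sz)// (le_trans z4)//; lra.
rewrite exprMn [X in _ <= _ * (_ * X)]exprS.
have -> : 2 * 2 `^ l * 2 `^ l * (2 * N%:R + 1 + 2 * l) * (B ^+ N.+1 * (`|z| * `|z| ^+ N)) =
  2 `^ l * (`|z| * (2 * 2 `^ l) * ((2 * N%:R + 1 + 2 * l) * B ^+ N.+1 * `|z| ^+ N)) by ring.
by rewrite ler_pM ?mulr_ge0 ?powR_ge0// ler_pM ?mulr_ge0 ?powR_ge0// ler_wpM2l.
Qed.

End generating_function.

Section power_series_uniqueness.
Context {R : realType}.

(** The terms of the series are bounded at a point [p], so the tail after the first
possibly nonzero term [c m * z ^ m] is [O(z ^ (m + 1))]; dividing by [z ^ m] and letting
[z] tend to zero gives [c m = 0]. *)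
Lemma pseries_eq0 (c : R^nat) (r : R) : 0 < r ->
  (forall z, `|z| < r -> pseries c z @ \oo --> (0 : R)) -> forall m, c m = 0.
Proof.
move=> r0 c0 m; pose p := r / 2; have p0 : 0 < p by rewrite divr_gt0.
have pr : p < r by rewrite ltr_pdivrMr// mulrC ltr_pMl// ltr1n.
clearbody p; have [K Kbnd] : exists K : R, forall i, `|c i * p ^+ i| <= K.
  have /cvg_series_cvg_0 cv0 : cvgn (pseries c p).
    by apply/cvg_ex; exists 0; apply: c0; rewrite gtr0_norm.
  have /cvg_seq_bounded [K [_ hK]] : cvgn (fun i => c i * p ^+ i).
    by apply/cvg_ex; exists 0.
  exists (K + 1) => i; apply: (hK (K + 1)) => //; by rewrite ltrDl.
have K0 : 0 <= K := le_trans (normr_ge0 _) (Kbnd 0%N).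
elim/ltn_ind: m => m IH.
have main (z : R) : 0 < z -> z <= p / 2 -> `|c m| <= (2 * K / p ^+ m.+1) * z.
  move=> z0 zp2; have zp : z / p <= 2^-1 by rewrite ler_pdivrMr// mulrC.
  have zp0 : 0 <= z / p by rewrite divr_ge0 ?ltW.
  have bnd n : (m < n)%N -> `|c m * z ^+ m - pseries c z n| <= 2 * K * (z / p) ^+ m.+1
      * (1 - 2^-1 ^+ (n - m.+1)).
    elim: n => // n IHn; rewrite ltnS leq_eqVlt => /orP[/eqP <-|mn].
      rewrite subnn expr0 subrr mulr0 /pseries seriesEnat/= big_nat_recr//=.
      rewrite big_nat big1 ?add0r ?subrr ?normr0// => i /andP[_ im].
      by rewrite IH// mul0r.
    rewrite /pseries seriesEnat/= big_nat_recr//= opprD addrA.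
    rewrite (le_trans (ler_normB _ _))//.
    have {}IHn := IHn mn; rewrite /pseries seriesEnat/= in IHn.
    have -> : 1 - 2^-1 ^+ (n.+1 - m.+1) = (1 - 2^-1 ^+ (n - m.+1)) + 2^-1 ^+ (n - m) :> R.
      have -> : (n.+1 - m.+1 = (n - m.+1).+1)%N by lia.
      have -> : (n - m = (n - m.+1).+1)%N by lia.
      by rewrite exprS; lra.
    rewrite mulrDr lerD//.
    have -> : c n * z ^+ n = (c n * p ^+ n) * (z / p) ^+ n.
      by rewrite expr_div_n; field; rewrite gt_eqF// exprn_gt0.
    have nE : (n = m.+1 + (n - m.+1))%N by lia.
    rewrite normrM [`|(z / p) ^+ n|]ger0_norm ?exprn_ge0//.
    have -> : (z / p) ^+ n = (z / p) ^+ m.+1 * (z / p) ^+ (n - m.+1).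
      by rewrite -exprD -nE.
    rewrite mulrA.
    have -> : 2 * K * (z / p) ^+ m.+1 * 2^-1 ^+ (n - m) =
      K * (z / p) ^+ m.+1 * 2^-1 ^+ (n - m.+1).
      have -> : (n - m = (n - m.+1).+1)%N by lia.
      by rewrite [2^-1 ^+ _.+1]exprS; lra.
    apply: ler_pM; rewrite ?mulr_ge0 ?exprn_ge0//.
      by rewrite ler_wpM2r ?exprn_ge0.
    by rewrite lerXn2r ?nnegrE.
  have : `|c m * z ^+ m - 0| <= 2 * K * (z / p) ^+ m.+1.
    have zr : `|z| < r.
      rewrite gtr0_norm// (le_lt_trans zp2)// (lt_trans _ pr)//.
      by rewrite ltr_pdivrMr// ltr_pMr// ltr1n.
    have lim0 : `|c m * z ^+ m - pseries c z n| @[n --> \oo] --> `|c m * z ^+ m - 0|.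
      by apply: cvg_norm; apply: cvgB; [exact: cvg_cst|exact: c0].
    apply: (cvgr_to_le lim0).
    near=> n; rewrite (le_trans (bnd n _))//; first by near: n; exact: nbhs_infty_gt.
    apply: ler_piMr; first by rewrite !mulr_ge0 ?exprn_ge0.
    by rewrite lerBlDr lerDl exprn_ge0.
  rewrite subr0 normrM [`|z ^+ m|]gtr0_norm ?exprn_gt0//.
  rewrite expr_div_n [z ^+ m.+1]exprS => h.
  rewrite -(ler_pM2r (exprn_gt0 m z0)) (le_trans h)//.
  by rewrite le_eqVlt; apply/orP; left; apply/eqP; ring.
apply/eqP; rewrite -normr_le0; apply/ler_addgt0Pr => e e0; rewrite add0r.
set A := 2 * K / p ^+ m.+1 in main.
have A0 : 0 <= A by rewrite divr_ge0 ?mulr_ge0 ?exprn_ge0// ltW.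
have := main (Num.min (p / 2) (e / (A + 1))).
rewrite lt_min ge_min lexx !divr_gt0//; last by rewrite ltr_wpDl.
move=> /(_ isT isT) /le_trans; apply.
rewrite (@le_trans _ _ (A * (e / (A + 1))))//.
  by rewrite ler_wpM2l// ge_min lexx orbT.
rewrite mulrA ler_pdivrMr ?ltr_wpDl// mulrC ler_wpM2l ?(ltW e0)//.
by rewrite lerDl.
Unshelve. all: by end_near. Qed.

Lemma pseries_inj (a b : R^nat) (F : R -> R) (r s : R) : 0 < r -> 0 < s ->
  (forall z, `|z| < r -> pseries a z @ \oo --> F z) ->
  (forall z, `|z| < s -> pseries b z @ \oo --> F z) -> a = b.
Proof.
move=> r0 s0 ha hb; apply/funext => m; apply/eqP; rewrite -subr_eq0; apply/eqP.
apply: (@pseries_eq0 (a \- b) (Num.min r s)); first by rewrite lt_min r0.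
move=> z; rewrite lt_min => /andP[zr zs].
rewrite [X in X @ _](_ : _ = pseries a z \- pseries b z).
  by rewrite -[X in _ --> X](subrr (F z)); apply: cvgB; [exact: ha|exact: hb].
apply/funext => n; rewrite /pseries !seriesEnat/= -sumrB.
by apply: eq_bigr => i _; rewrite mulrBl.
Qed.

End power_series_uniqueness.

Section gegenbauer_value.
Context {R : realType}.
Implicit Types (l t : R).

Lemma gegenbauer_poly_expansion l t : 0 < l -> `|t| <= 1 ->
  gegenbauer_expansion l t (fun m => gegenbauer_poly l m t).
Proof.
move=> l0 t1; set B := 4 * (l + 1).
have BE : B = 4 * (l + 1) by []; clearbody B.
have B0 : 0 < B by rewrite BE; lra.
exists (4 * B)^-1; first by rewrite invr_gt0 mulr_gt0.
move=> z zB; rewrite -cvg_shiftS/=.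
have Bz : B * `|z| <= 4^-1.
  rewrite mulrC -ler_pdivlMr// -invfM; exact: ltW.
have -> : (fun n => pseries (fun m => gegenbauer_poly l m t) z n.+1) =
  (fun n => (gegenbauer_partial l t n).[z]).
  by apply/funext => n; rewrite gegenbauer_partialE /pseries seriesEord.
apply/cvgrPdist_le => /= e e0.
pose C := 2 * 2 `^ l * 2 `^ l * (2 + 2 * l).
have C0 : 0 <= C by rewrite !mulr_ge0 ?powR_ge0//; lra.
have : geometric C (2^-1 : R) @ \oo --> (0 : R).
  by apply: cvg_geometric; rewrite ger0_norm// invf_lt1 ?ltr1n.
move=> /cvgrPdist_le /(_ e e0) h.
near=> n.
have : `|0 - geometric C (2^-1 : R) n| <= e by near: n; exact: h.
have C1 : 0 <= C * 2^-1 ^+ n by rewrite mulr_ge0// exprn_ge0.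
rewrite sub0r normrN /geometric/= (ger0_norm C1) => hn.
apply: (le_trans (gegenbauer_partial_approx n l0 t1 _)).
  rewrite -BE (le_trans (ltW zB))// lef_pV2 ?posrE ?mulr_gt0//.
  by rewrite ler_pMl// ler1n.
apply: (le_trans _ hn); rewrite -BE /C -[leLHS]mulrA -[leRHS]mulrA.
rewrite ler_wpM2l ?mulr_ge0 ?powR_ge0//.
have n0 : 0 <= n%:R :> R by [].
have nl : 0 <= n%:R * l by rewrite mulr_ge0// ltW.
have n2 : n.+1%:R * 2^-1 ^+ n.+1 <= 1 :> R.
  by rewrite exprVn ler_pdivrMr ?exprn_gt0// mul1r -natrX ler_nat ltnW// ltn_expl.
have h4 : (B * `|z|) ^+ n.+1 <= 2^-1 ^+ n.+1 * 2^-1 ^+ n.+1.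
  rewrite -exprMn (_ : 2^-1 * 2^-1 = 4^-1); last by field.
  by rewrite lerXn2r ?nnegrE ?mulr_ge0// ltW.
have q0 : 0 <= 2^-1 ^+ n.+1 :> R by rewrite exprn_ge0.
apply: (@le_trans _ _ ((2 + 2 * l) * n.+1%:R * (2^-1 ^+ n.+1 * 2^-1 ^+ n.+1))).
  rewrite ler_pM ?exprn_ge0 ?mulr_ge0 ?(ltW B0)//; first lra.
  by rewrite -natr1; lra.
rewrite -!mulrA ler_wpM2l//; first lra.
rewrite mulrA (le_trans (ler_piMl q0 n2))// exprS ler_piMl ?exprn_ge0//.
by rewrite invf_le1// ler1n.
Unshelve. all: by end_near. Qed.

(** The choice operator in the definition of [gegenbauer] is harmless: a sequence
with the required generating function exists and power series determine their
coefficients. *)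
Lemma gegenbauerE m l t : 0 < l -> `|t| <= 1 ->
  gegenbauer m l t = gegenbauer_poly l m t.
Proof.
move=> l0 t1; rewrite /gegenbauer.
have h := gegenbauer_poly_expansion l0 t1.
have [r r0 hr] := h.
have [s s0 hs] := getPex (ex_intro [set c | gegenbauer_expansion l t c] _ h).
exact: (congr1 (fun c => c m) (pseries_inj s0 r0 hs hr)).
Qed.

End gegenbauer_value.

(** * Geometry of the half space *)

Section euclidean_geometry.
Context {R : realType} {d : nat}.
Implicit Types (u v : 'rV[R]_d).

Lemma dotC u v : dot u v = dot v u.
Proof. by apply: eq_bigr => i _; rewrite mulrC. Qed.

Lemma dotDl u1 u2 v : dot (u1 + u2) v = dot u1 v + dot u2 v.
Proof. by rewrite -big_split; apply: eq_bigr => i _; rewrite mxE mulrDl. Qed.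

Lemma dotZl (a : R) u v : dot (a *: u) v = a * dot u v.
Proof. by rewrite mulr_sumr; apply: eq_bigr => i _; rewrite mxE mulrA. Qed.

Lemma dot0l v : dot 0 v = 0.
Proof. by apply: big1 => i _; rewrite mxE mul0r. Qed.

Lemma dotvv_ge0 v : 0 <= dot v v.
Proof. by apply: sumr_ge0 => i _; rewrite -expr2 sqr_ge0. Qed.

Lemma enorm_ge0 v : 0 <= enorm v.
Proof. exact: sqrtr_ge0. Qed.

Lemma enorm_sqr v : enorm v ^+ 2 = dot v v.
Proof. by rewrite sqr_sqrtr// dotvv_ge0. Qed.

Lemma enorm_eq0 v : (enorm v == 0) = (v == 0).
Proof.
rewrite -(sqrf_eq0 (enorm v)) enorm_sqr psumr_eq0 => [|i _]; last first.
  by rewrite -expr2 sqr_ge0.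
apply/allP/eqP => [h|-> i _]; last by rewrite /= mxE mulr0 eqxx.
by apply/rowP => i; have := h i (mem_index_enum _); rewrite /= mulf_eq0 orbb mxE => /eqP.
Qed.

Lemma enormZ (a : R) v : enorm (a *: v) = `|a| * enorm v.
Proof.
by rewrite /enorm dotZl dotC dotZl mulrA -expr2 sqrtrM ?sqr_ge0// sqrtr_sqr.
Qed.

Lemma enormB_sqr u v : enorm (u - v) ^+ 2 = enorm u ^+ 2 - 2 * dot v u + enorm v ^+ 2.
Proof.
rewrite !enorm_sqr -[- v]scaleN1r dotDl dotZl dotC dotDl dotZl.
by rewrite [dot v (_ + _)]dotC dotDl dotZl (dotC u v); ring.
Qed.

Lemma dot_le u v : `|dot u v| <= enorm u * enorm v.
Proof.
have [->|u0] := eqVneq u 0.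
  by rewrite dot0l normr0 mulr_ge0 ?enorm_ge0.
have nu0 : 0 < enorm u by rewrite lt_def enorm_eq0 u0 enorm_ge0.
rewrite -(@ler_pXn2r _ 2)// ?nnegrE ?mulr_ge0 ?enorm_ge0//.
rewrite -normrX ger0_norm ?sqr_ge0// exprMn.
have := dotvv_ge0 (enorm u ^+ 2 *: v - dot u v *: u).
rewrite -enorm_sqr enormB_sqr !enormZ dotC !dotZl (dotC v (_ *: _)) dotZl.
rewrite !exprMn -!normrX !ger0_norm ?sqr_ge0//.
have -> : (enorm u ^+ 2) ^+ 2 * enorm v ^+ 2 - 2 * (enorm u ^+ 2 * (dot u v * dot u v)) +
   dot u v ^+ 2 * enorm u ^+ 2 = (enorm u ^+ 2 * enorm v ^+ 2 - dot u v ^+ 2) * enorm u ^+ 2.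
  by ring.
by rewrite pmulr_lge0 ?exprn_gt0// subr_ge0.
Qed.

Lemma coord_le_enorm v i : `|v ord0 i| <= enorm v.
Proof.
rewrite -(@ler_pXn2r _ 2)// ?nnegrE ?enorm_ge0// enorm_sqr -normrX ger0_norm ?sqr_ge0//.
rewrite /dot (bigD1 i)//= -expr2 lerDl.
by apply: sumr_ge0 => j _; rewrite -expr2 sqr_ge0.
Qed.

End euclidean_geometry.

Section half_space_geometry.
Context {R : realType} {d : nat}.
Implicit Types (x : 'rV[R]_d.+1) (y : 'rV[R]_d).

Lemma enorm_half_space_sqr x : enorm x ^+ 2 = enorm (bproj x) ^+ 2 + height x ^+ 2.
Proof.
rewrite !enorm_sqr /dot big_ord_recr/= -expr2; congr (_ + _).
by apply: eq_bigr => i _; rewrite !mxE; congr (x _ _ * x _ _); apply: val_inj.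
Qed.

Lemma enorm_gt0 x : x != 0 -> 0 < enorm x.
Proof. by move=> x0; rewrite lt_def enorm_eq0 x0 enorm_ge0. Qed.

Lemma half_space_neq0 x : half_space x -> x != 0.
Proof. by apply: contraPneq => ->; rewrite /half_space/= /height mxE ltxx. Qed.

Lemma enorm_bproj_le x : enorm (bproj x) <= enorm x.
Proof.
rewrite -(@ler_pXn2r _ 2)// ?nnegrE ?enorm_ge0// enorm_half_space_sqr.
by rewrite lerDl sqr_ge0.
Qed.

Lemma height_le_enorm x : `|height x| <= enorm x.
Proof. exact: coord_le_enorm. Qed.

Lemma height_itv x : x != 0 -> -1 <= height x / enorm x <= 1.
Proof.
move=> x0; rewrite -ler_norml normrM normfV (ger0_norm (enorm_ge0 x)).
by rewrite ler_pdivrMr ?enorm_gt0// mul1r height_le_enorm.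
Qed.

Lemma cos_theta x : x != 0 -> cos (theta x) = height x / enorm x.
Proof. by move=> x0; rewrite acosK// in_itv/= height_itv. Qed.

Lemma sin_theta x : x != 0 -> sin (theta x) = enorm (bproj x) / enorm x.
Proof.
move=> x0; have n0 := enorm_gt0 x0.
rewrite sin_acos ?height_itv//; apply/eqP; rewrite -(@eqrXn2 _ 2)//; last first.
  by rewrite divr_ge0 ?enorm_ge0.
rewrite sqr_sqrtr; last first.
  rewrite subr_ge0 -[leLHS]ger0_norm ?sqr_ge0// normrX exprn_ile1//.
  by rewrite ler_norml height_itv.
apply/eqP; rewrite !expr_div_n; have := enorm_half_space_sqr x => E.
have n2 : enorm x ^+ 2 != 0 by rewrite expf_neq0// gt_eqF.
by apply: (mulIf n2); rewrite mulrBl !divfK// mul1r E addrK.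
Qed.

(** One formula covers the conventional values of the angle at [bproj x = 0]
and [y = 0], since the dot product then vanishes and so does the quotient. *)
Lemma ThetaE x y : x != 0 -> Theta x y = dot (bproj x) y / (enorm x * enorm y).
Proof.
move=> x0; rewrite /Theta /theta'; case: ifPn => [/orP h|].
  rewrite cos_pihalf mulr0 (_ : dot _ _ = 0) ?mul0r//; case: h => /eqP ->.
    by rewrite dot0l.
  by rewrite dotC dot0l.
rewrite negb_or => /andP[b0 y0]; rewrite acosK; last first.
  have by0 : 0 < enorm (bproj x) * enorm y.
    by rewrite mulr_gt0// lt_def enorm_eq0 enorm_ge0 andbT.
  rewrite in_itv/= -ler_norml normrM normfV (gtr0_norm by0).
  by rewrite ler_pdivrMr// mul1r dot_le.
rewrite sin_theta//; have := x0; rewrite -enorm_eq0 => h.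
by rewrite -enorm_eq0 in b0; rewrite -enorm_eq0 in y0; field; rewrite h b0 y0.
Qed.

Lemma Theta_le1 x y : `|Theta x y| <= 1.
Proof.
by rewrite normrM mulr_ile1// ler_norml ?sin_geN1 ?sin_le1 ?cos_geN1 ?cos_le1.
Qed.

Lemma enorm_hat x : x != 0 -> enorm (hat x) = 1.
Proof.
move=> x0; rewrite enormZ normfV ger0_norm ?enorm_ge0// mulVf//.
by rewrite enorm_eq0.
Qed.

Lemma hat_neq0 x : x != 0 -> hat x != 0.
Proof. by move=> x0; rewrite -enorm_eq0 enorm_hat// oner_eq0. Qed.

Lemma bproj_hat x : bproj (hat x) = (enorm x)^-1 *: bproj x.
Proof. by apply/rowP => i; rewrite !mxE. Qed.

Lemma cos_theta_hat x : x != 0 -> cos (theta (hat x)) = height x / enorm x.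
Proof.
by move=> x0; rewrite cos_theta ?hat_neq0// enorm_hat// divr1 /height mxE mulrC.
Qed.

Lemma Theta_hat x y : x != 0 -> Theta (hat x) y = Theta x y.
Proof.
move=> x0; rewrite !ThetaE ?hat_neq0// enorm_hat// mul1r bproj_hat dotZl.
by rewrite invfM mulrA [_^-1 * _]mulrC.
Qed.

Lemma half_space_exists (r : R) : 0 < r ->
  exists2 x : 'rV[R]_d.+1, half_space x & enorm x = r.
Proof.
move=> r0; exists (r *: delta_mx ord0 ord_max).
  by rewrite /half_space/= /height !mxE !eqxx/= mulr1.
rewrite enormZ gtr0_norm// (_ : enorm _ = 1) ?mulr1//.
rewrite /enorm /dot (bigD1 ord_max)//= big1 ?addr0.
  by rewrite mxE !eqxx/= mulr1 sqrtr1.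
by move=> i /negbTE h; rewrite mxE h andbF mul0r.
Qed.

End half_space_geometry.

(** * The remainder kernel and its size *)

Section kernel_remainder.
Context {R : realType}.
Implicit Types (l t s c : R) (e m M N : nat).

Definition gegenbauer_rem l M t s : R :=
  (1 - 2 * t * s + s ^+ 2) `^ (- l) - \sum_(m < M) gegenbauer_poly l m t * s ^+ m.

Lemma powR_sqr_half c e : 0 < c -> (c ^+ 2) `^ (- (e%:R / 2)) = c ^- e.
Proof.
move=> c0; rewrite powRN -powR_mulrn ?(ltW c0)// -powRrM mulrC divfK//.
by rewrite powR_mulrn ?(ltW c0).
Qed.

Lemma powRN_half_le c q e : 0 < c -> c ^+ 2 <= q -> q `^ (- (e%:R / 2)) <= c ^- e.
Proof.
move=> c0 cq; rewrite -powR_sqr_half// !powRN.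
have q0 : 0 < q by rewrite (lt_le_trans _ cq)// exprn_gt0.
rewrite lef_pV2 ?posrE ?powR_gt0 ?exprn_gt0//.
by rewrite ge0_ler_powR ?nnegrE ?divr_ge0 ?sqr_ge0// ltW.
Qed.

(** Here [c] stands for the cosine of the polar angle. Let [B] be the growth rate
of the Gegenbauer polynomials. Below [1 / B] the generating function converges
and the remainder is [O(s ^ (N + 1))]; above it every quantity to be bounded,
including the constant [1], is at most a multiple of [s ^ N * min 1 s]. *)
Lemma gegenbauer_rem_le e N : (0 < e)%N -> exists2 C : R, 0 <= C &
  forall t s c, `|t| <= 1 -> 0 <= s -> 0 < c <= 1 -> c ^+ 2 <= 1 - 2 * t * s + s ^+ 2 ->
  `|gegenbauer_rem (e%:R / 2) N.+1 t s| <= C * (c ^- e * (s ^+ N * Num.min 1 s)).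
Proof.
move=> e0; set l := e%:R / 2; have l0 : 0 < l by rewrite divr_gt0 ?ltr0n.
pose B := 4 * (l + 1); have B0 : 0 < B by rewrite /B; lra.
have BE : B = 4 * (l + 1) by [].
clearbody B.
pose C1 := 2 * 2 `^ l * 2 `^ l * (2 * N%:R + 1 + 2 * l) * B ^+ N.+1.
have C10 : 0 <= C1 by rewrite !mulr_ge0 ?powR_ge0 ?exprn_ge0 ?addr_ge0 ?mulr_ge0 ?(ltW B0) ?(ltW l0).
exists (C1 + N.+2%:R * B ^+ N.+1).
  by rewrite addr_ge0// mulr_ge0// exprn_ge0// ltW.
move=> t s c t1 s0 /andP[c0 c1] cq.
have ce : 1 <= c ^- e by rewrite -exprVn exprn_ege1// invf_ge1.
have ce0 : 0 <= c ^- e by rewrite (le_trans ler01 ce).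
have N2 : 0 <= N.+2%:R * B ^+ N.+1 by rewrite mulr_ge0// exprn_ge0// ltW.
have mn0 : 0 <= Num.min 1 s by rewrite le_min ler01.
have [sB|Bs] := lerP s B^-1.
  have s1 : s <= 1.
    by rewrite (le_trans sB)// invf_le1// BE; lra.
  rewrite (min_r s1) -exprSr mulrDl.
  apply: (@le_trans _ _ (C1 * s ^+ N.+1)); last first.
    rewrite ler_wpDr ?(mulr_ge0 N2) ?mulr_ge0 ?exprn_ge0//.
    by rewrite ler_wpM2l// ler_peMl// exprn_ge0.
  rewrite /gegenbauer_rem -gegenbauer_partialE.
  have := @gegenbauer_partial_approx R l t N s l0 t1.
  rewrite (ger0_norm s0) -BE => /(_ sB) /le_trans; apply.
  by rewrite exprMn /C1 mulrA.
have Bs1 : 1 <= B * s by rewrite -ler_pdivrMl// mulr1 ltW.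
have B1 : 1 <= B by rewrite BE; lra.
have Bmin : 1 <= B * Num.min 1 s.
  by rewrite minr_pMr ?(ltW B0)// mulr1 le_min B1.
have key m : (m <= N)%N -> (B * s) ^+ m <= B ^+ N.+1 * (s ^+ N * Num.min 1 s).
  move=> mN; apply: (@le_trans _ _ ((B * s) ^+ N)); first exact: ler_weXn2l.
  rewrite exprMn exprSr mulrACA -mulrA -[leLHS]mulr1 -!mulrA.
  rewrite ler_wpM2l ?exprn_ge0 ?(ltW B0)// ler_wpM2l ?exprn_ge0//.
have S0 : 0 <= s ^+ N * Num.min 1 s by rewrite mulr_ge0 ?exprn_ge0.
rewrite /gegenbauer_rem (le_trans (ler_normB _ _))// [leRHS]mulrDl.
rewrite (ger0_norm (powR_ge0 _ _)).
rewrite ler_wpDl// ?(mulr_ge0 C10 (mulr_ge0 ce0 S0))//.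
rewrite (_ : N.+2%:R = N.+1%:R + 1); last by rewrite natr1.
rewrite [_ * B ^+ _]mulrDl mul1r [leRHS]mulrDl [leRHS]addrC; apply: lerD.
  apply: (le_trans (powRN_half_le e c0 cq)).
  rewrite mulrCA ler_peMr//.
  exact: (key 0%N).
apply: (le_trans (ler_norm_sum _ _ _)).
apply: (@le_trans _ _ (\sum_(m < N.+1) B ^+ N.+1 * (s ^+ N * Num.min 1 s))); last first.
  rewrite sumr_const card_ord -[leLHS]mulr_natl -[leRHS]mulrA ler_wpM2l//.
  rewrite ler_wpM2l ?exprn_ge0 ?(ltW B0)//.
  by rewrite ler_peMl.
apply: ler_sum => m _; rewrite normrM (ger0_norm (exprn_ge0 _ s0)).
apply: (le_trans _ (key m _)); last by rewrite -ltnS.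
by rewrite exprMn ler_wpM2r ?exprn_ge0// BE gegenbauer_poly_le.
Qed.

End kernel_remainder.

Section half_space_kernel.
Context {R : realType} {d : nat}.
Implicit Types (x : 'rV[R]_d.+1) (y : 'rV[R]_d) (e M m N : nat).

(** The part of the Poisson kernel of exponent [e / 2] that its first [M] moments
leave over. The Dirichlet integral uses it with [e = n], the Neumann integral
with [e = n - 2]. *)
Definition kernel_rem e M x y : R :=
  poisson_kernel (e%:R / 2) x y -
  \sum_(m < M) enorm x ^- (m + e) * (enorm y ^+ m * gegenbauer m (e%:R / 2) (Theta x y)).

Lemma poisson_kernel_baseE x y : x != 0 ->
  enorm (y - bproj x) ^+ 2 + height x ^+ 2 =
  enorm x ^+ 2 * (1 - 2 * Theta x y * (enorm y / enorm x) + (enorm y / enorm x) ^+ 2).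
Proof.
move=> x0; rewrite enormB_sqr -addrA -enorm_half_space_sqr ThetaE//.
have [->|y0] := eqVneq y 0.
  have -> : enorm (0 : 'rV[R]_d) = 0 by apply/eqP; rewrite enorm_eq0.
  by rewrite [dot _ 0]dotC dot0l; ring.
by rewrite expr_div_n; field; rewrite !enorm_eq0 y0 x0.
Qed.

Lemma poisson_kernelE e x y : half_space x ->
  poisson_kernel (e%:R / 2) x y = enorm x ^- e *
  (1 - 2 * Theta x y * (enorm y / enorm x) + (enorm y / enorm x) ^+ 2) `^ (- (e%:R / 2)).
Proof.
move=> hx; have x0 := half_space_neq0 hx; have nx := enorm_gt0 x0.
have E := poisson_kernel_baseE y x0.
rewrite /poisson_kernel E powRM ?sqr_ge0//; first by rewrite powR_sqr_half.
rewrite -(pmulr_rge0 _ (exprn_gt0 2 nx)) -E addr_ge0 ?sqr_ge0//.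
Qed.

Lemma kernel_remE e M x y : (0 < e)%N -> half_space x -> kernel_rem e M x y =
  enorm x ^- e * gegenbauer_rem (e%:R / 2) M (Theta x y) (enorm y / enorm x).
Proof.
move=> e0 hx; have x0 := half_space_neq0 hx; have nx := enorm_gt0 x0.
rewrite /kernel_rem poisson_kernelE// mulrBr; congr (_ - _).
rewrite mulr_sumr; apply: eq_bigr => m _.
rewrite gegenbauerE ?Theta_le1 ?divr_gt0 ?ltr0n//.
by rewrite expr_div_n exprD invfM; ring.
Qed.

(** Up to the factor [|x| ^ 2] this says that a boundary point is at distance at
least [height x] from [x]. *)
Lemma cos_theta_sqr_le x y : half_space x ->
  cos (theta x) ^+ 2 <= 1 - 2 * Theta x y * (enorm y / enorm x) + (enorm y / enorm x) ^+ 2.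
Proof.
move=> hx; have x0 := half_space_neq0 hx; have nx := enorm_gt0 x0.
rewrite -(ler_pM2l (exprn_gt0 2 nx)) -poisson_kernel_baseE//.
rewrite cos_theta// -exprMn mulrC divfK ?gt_eqF//.
by rewrite lerDr sqr_ge0.
Qed.

Lemma cos_theta_gt0 x : half_space x -> 0 < cos (theta x).
Proof.
by move=> hx; have x0 := half_space_neq0 hx; rewrite cos_theta// divr_gt0// enorm_gt0.
Qed.

(** The error gauge for the bare kernel: the Dirichlet gauge is [height] times
this one, the Neumann gauge is this one itself. *)
Definition kernel_gauge e M x : R := enorm x ^- (M + e - 1) * sec (theta x) ^+ e.

Lemma kernel_gauge_gt0 e M x : half_space x -> 0 < kernel_gauge e M x.
Proof.
move=> hx; rewrite mulr_gt0 ?invr_gt0 ?exprn_gt0 ?enorm_gt0 ?half_space_neq0//.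
by rewrite invr_gt0 cos_theta_gt0.
Qed.

Lemma kernel_rem_le e N : (0 < e)%N -> exists2 C : R, 0 <= C & forall x y, half_space x ->
  `|kernel_rem e N.+1 x y| <=
  C * kernel_gauge e N.+1 x * (enorm y ^+ N * Num.min 1 (enorm y / enorm x)).
Proof.
move=> e0; have [C C0 HC] := @gegenbauer_rem_le R e N e0; exists C => // x y hx.
have x0 := half_space_neq0 hx; have nx := enorm_gt0 x0.
rewrite kernel_remE// normrM ger0_norm ?invr_ge0 ?exprn_ge0 ?enorm_ge0//.
have s0 : 0 <= enorm y / enorm x by rewrite divr_ge0 ?enorm_ge0.
have c01 : 0 < cos (theta x) <= 1 by rewrite cos_theta_gt0 ?cos_le1.
have := HC _ _ _ (Theta_le1 x y) s0 c01 (cos_theta_sqr_le y hx).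
have xe : 0 <= enorm x ^- e by rewrite invr_ge0 exprn_ge0 ?enorm_ge0.
move=> /(ler_wpM2l xe) /le_trans; apply.
rewrite /kernel_gauge /sec addSn subn1/= exprD invfM expr_div_n exprVn.
by rewrite le_eqVlt; apply/orP; left; apply/eqP; ring.
Qed.

End half_space_kernel.

(** * Measurability and integrability on the boundary *)

Section lebesgue_measurability.
Context {R : realType} {d : nat}.
Implicit Types (f g phi : 'rV[R]_d -> R) (y b : 'rV[R]_d) (M : nat).

Definition lebesgue_measurable f : Prop :=
  measurable_fun [set: lebesgue_space R d] (f : lebesgue_space R d -> R).

Definition lebesgue_integrable f : Prop :=
  (lebesgue R d).-integrable [set: lebesgue_space R d]
    (EFin \o (f : lebesgue_space R d -> R)).

(** Lebesgue measurable sets form the completion of the product sigma-algebra, so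
measurability of coordinate expressions can be checked for the latter. *)
Lemma borel_lebesgue_measurable f :
  measurable_fun [set: 'rV[R]_d] (f : 'rV[R]_d -> measurableTypeR R) ->
  lebesgue_measurable f.
Proof.
move=> mf _ A mA; have := mf measurableT A mA; rewrite !setTI => h.
by apply: sub_caratheodory; apply: sub_sigma_algebra.
Qed.

Lemma lebesgue_measurable_coord (i : 'I_d) :
  lebesgue_measurable (fun y : 'rV[R]_d => y ord0 i).
Proof. by apply: borel_lebesgue_measurable; exact: measurable_coord. Qed.

Lemma lebesgue_measurable_dot b : lebesgue_measurable (dot b).
Proof.
apply: measurable_sum => i; apply: measurable_funM; first exact: measurable_cst.
exact: lebesgue_measurable_coord.
Qed.

Lemma lebesgue_measurable_enorm : lebesgue_measurable (@enorm R d).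
Proof.
rewrite /lebesgue_measurable /enorm.
apply: (@measurableT_comp _ _ _ _ _ _ (@Num.sqrt R)).
  by apply: continuous_measurable_fun; exact: sqrt_continuous.
apply: measurable_sum => i.
by apply: measurable_funM; exact: lebesgue_measurable_coord.
Qed.

Lemma lebesgue_measurable_enormX k : lebesgue_measurable (fun y => enorm y ^+ k).
Proof. by apply: measurable_funX; exact: lebesgue_measurable_enorm. Qed.

Definition weight M y : R := enorm y ^+ (M - 1) + 1.

Lemma weight_gt0 M y : 0 < weight M y.
Proof. by rewrite ltr_wpDl// exprn_ge0// enorm_ge0. Qed.

Lemma enormX_le_weight M m y : (m < M)%N -> enorm y ^+ m <= weight M y.
Proof.
move=> mM; rewrite /weight; have [y1|y1] := lerP 1 (enorm y).
  by rewrite ler_wpDr// ler_weXn2l//; lia.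
by rewrite ler_wpDl ?exprn_ge0 ?enorm_ge0// exprn_ile1 ?enorm_ge0// ltW.
Qed.

Lemma lebesgue_measurable_weight M : lebesgue_measurable (weight M).
Proof.
by apply: measurable_funD; [exact: lebesgue_measurable_enormX|exact: measurable_cst].
Qed.

Lemma admissible_weight M f :
  admissible M f -> lebesgue_integrable (fun y => f y * weight M y).
Proof.
move=> [mf fi]; apply/integrableP; split.
  apply/measurable_EFinP; apply: measurable_funM => //.
  exact: lebesgue_measurable_weight.
rewrite (_ : (fun x => _) = (fun y : lebesgue_space R d => (`|f y| * weight M y)%:E))//.
apply/funext => y /=.
by rewrite normrM (gtr0_norm (weight_gt0 M y)).
Qed.

Lemma lebesgue_integrable_le f g : lebesgue_measurable f ->
  (forall y, `|f y| <= `|g y|) -> lebesgue_integrable g -> lebesgue_integrable f.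
Proof.
move=> mf fg; apply: le_integrable => //; first exact/measurable_EFinP.
by move=> y _; rewrite /= lee_fin.
Qed.

Lemma lebesgue_integrable_measurable f : lebesgue_integrable f -> lebesgue_measurable f.
Proof. by move=> /measurable_int /measurable_EFinP. Qed.

Lemma lebesgue_integrableZ (c : R) f :
  lebesgue_integrable f -> lebesgue_integrable (fun y => c * f y).
Proof. exact: integrableZl. Qed.

Lemma lebesgue_integrableD f g : lebesgue_integrable f -> lebesgue_integrable g ->
  lebesgue_integrable (fun y => f y + g y).
Proof. exact: integrableD. Qed.

Lemma lebesgue_integrable_norm f :
  lebesgue_integrable f -> lebesgue_integrable (fun y => `|f y|).
Proof. exact: integrable_abse. Qed.

Lemma admissible_integrable M f phi (C : R) : admissible M f ->
  lebesgue_measurable phi -> (forall y, `|phi y| <= C * weight M y) ->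
  lebesgue_integrable (fun y => f y * phi y).
Proof.
move=> fM mphi bnd.
apply: (@lebesgue_integrable_le _ (fun y => C * (f y * weight M y))).
- by case: fM => mf _; apply: measurable_funM.
- move=> y; rewrite !normrM mulrCA ler_wpM2l// (le_trans (bnd y))//.
  by rewrite (le_trans (ler_norm _))// normrM.
- by apply: lebesgue_integrableZ; exact: admissible_weight.
Qed.

Lemma Rintegral_lebesgueZ (c : R) f : lebesgue_integrable f ->
  \int[lebesgue R d]_y (c * f y) = c * \int[lebesgue R d]_y f y.
Proof. by move=> fi; rewrite RintegralZl. Qed.

Lemma Rintegral_lebesgueD f g : lebesgue_integrable f -> lebesgue_integrable g ->
  \int[lebesgue R d]_y (f y + g y) = \int[lebesgue R d]_y f y + \int[lebesgue R d]_y g y.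
Proof. by move=> fi gi; rewrite RintegralD. Qed.

Lemma Rintegral_lebesgueB f g : lebesgue_integrable f -> lebesgue_integrable g ->
  \int[lebesgue R d]_y (f y - g y) = \int[lebesgue R d]_y f y - \int[lebesgue R d]_y g y.
Proof. by move=> fi gi; rewrite RintegralB. Qed.

Lemma lebesgue_integrable_sum I (s : seq I) (F : I -> 'rV[R]_d -> R) :
  (forall i, lebesgue_integrable (F i)) ->
  lebesgue_integrable (fun y => \sum_(i <- s) F i y).
Proof.
move=> iF; have := @integrable_sum _ _ _ (lebesgue R d) setT measurableT _ s xpredT
  (fun i y => (F i y)%:E) (fun i _ => iF i).
by under eq_fun do rewrite sumEFin.
Qed.

Lemma Rintegral_lebesgue_sum I (s : seq I) (F : I -> 'rV[R]_d -> R) :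
  (forall i, lebesgue_integrable (F i)) ->
  \int[lebesgue R d]_y (\sum_(i <- s) F i y) = \sum_(i <- s) \int[lebesgue R d]_y F i y.
Proof.
move=> iF; elim: s => [|i s IH].
  under eq_Rintegral do rewrite big_nil.
  by rewrite /Rintegral integral0 big_nil.
under eq_Rintegral do rewrite big_cons.
rewrite RintegralD//; first by rewrite IH big_cons.
  exact: iF.
exact: lebesgue_integrable_sum.
Qed.

(** Dominated convergence along integer radii; the integrand decreases in the
radius, so a single good radius is all that later estimates need. *)
Lemma tail_integral_small g (v : 'rV[R]_d -> R) : lebesgue_integrable g ->
  (forall y, 0 <= g y) -> lebesgue_measurable v -> (forall y, 0 <= v y) ->
  forall eps : R, 0 < eps -> exists2 r : R, 0 < r &
    \int[lebesgue R d]_y (g y * Num.min 1 (v y / r)) <= eps.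
Proof.
move=> ig g0 mv v0 eps eps0.
pose h (n : nat) (y : lebesgue_space R d) : \bar R := (g y * Num.min 1 (v y / n.+1%:R))%:E.
have mh n : measurable_fun setT (h n).
  apply/measurable_EFinP; apply: measurable_funM.
    exact: lebesgue_integrable_measurable.
  apply: measurable_minr; first exact: measurable_cst.
  by apply: measurable_funM => //; exact: measurable_cst.
have cvgh y : h ^~ y @ \oo --> (0%E : \bar R).
  apply: cvg_EFin; first by apply: nearW.
  have -> : fine \o h^~ y = (fun n : nat => g y * Num.min 1 (v y * n.+1%:R^-1)) by [].
  rewrite -(mulr0 (g y)); apply: cvgM; first exact: cvg_cst.
  have hv : (v y * n.+1%:R^-1) @[n --> \oo] --> (0 : R).
    rewrite -(mulr0 (v y)); apply: cvgM; first exact: cvg_cst.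
    exact: cvg_harmonic.
  apply: (@squeeze_cvgr _ _ _ _ (fun=> 0) (fun n : nat => v y * n.+1%:R^-1)) => //.
    apply: nearW => n; rewrite le_min ler01 ge_min lexx orbT andbT/=.
    by rewrite mulr_ge0.
  exact: cvg_cst.
have ae_cvg : {ae lebesgue R d, forall y, setT y -> h ^~ y @ \oo --> cst 0%E y}.
  by apply: aeW => y _; exact: cvgh.
have ae_le : {ae lebesgue R d, forall y n, setT y -> (`|h n y| <= (EFin \o g) y)%E}.
  apply: aeW => y n _; rewrite lee_fin normrM ger0_norm// ler_piMr//.
  by rewrite ger0_norm ?ge_min ?lexx// le_min ler01 divr_ge0.
have [_ _] := dominated_convergence measurableT mh (measurable_cst _) ae_cvg ig ae_le.
rewrite integral0 => H.
have /fine_cvgP[_ /cvgrPdist_le /(_ _ eps0)] := H.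
move=> [n _ /(_ n (leqnn n))]; rewrite sub0r normrN => hn.
by exists n.+1%:R => //; rewrite (le_trans (ler_norm _)).
Qed.

End lebesgue_measurability.

(** * The remainder integral and the order relation *)

Section remainder_expansion.
Context {R : realType} {d : nat}.
Implicit Types (f : 'rV[R]_d -> R) (x xi : 'rV[R]_d.+1) (y : 'rV[R]_d) (e M m : nat).

(** The factor [|y| ^ m] clears the denominators of the cosine: the moments are
polynomials in [y], which gives their measurability and continuity. *)
Lemma gegenbauer_moment l m x y : 0 < l -> x != 0 ->
  enorm y ^+ m * gegenbauer m l (Theta x y) =
  gegenbauer_form l m (dot (bproj x) y / enorm x) (enorm y ^+ 2).
Proof.
move=> l0 x0; rewrite gegenbauerE ?Theta_le1// /gegenbauer_poly /gegenbauer_form.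
have nx : enorm x != 0 by rewrite enorm_eq0.
rewrite mulr_sumr; apply: eq_bigr => k _; rewrite expr1n mulr1.
have [mk|km] := ltnP m k.*2; first by rewrite gegenbauer_coef_small// !mul0r mulr0.
rewrite -exprM mulrCA -mulrA; congr (_ * _).
have key : enorm y * Theta x y = dot (bproj x) y / enorm x.
  rewrite ThetaE//; have [->|y0] := eqVneq y 0; first by rewrite dotC dot0l !mul0r mulr0.
  by rewrite -enorm_eq0 in y0; field; rewrite nx y0.
by rewrite -{1}(subnK km) -mul2n exprD mulrAC -exprMn key.
Qed.

Lemma lebesgue_measurable_moment l m x : 0 < l -> x != 0 ->
  lebesgue_measurable (fun y => enorm y ^+ m * gegenbauer m l (Theta x y)).
Proof.
move=> l0 x0; rewrite (funext (fun y => gegenbauer_moment m y l0 x0)).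
rewrite /lebesgue_measurable /gegenbauer_form; apply: measurable_sum => k.
apply: measurable_funM; last by apply: measurable_funX; exact: lebesgue_measurable_enormX.
apply: measurable_funM; first exact: measurable_cst.
apply: measurable_funX; apply: measurable_funM; last exact: measurable_cst.
exact: lebesgue_measurable_dot.
Qed.

Lemma moment_le l m M x y : 0 < l -> (m < M)%N ->
  `|enorm y ^+ m * gegenbauer m l (Theta x y)| <= (4 * (l + 1)) ^+ m * weight M y.
Proof.
move=> l0 mM; rewrite normrM ger0_norm ?exprn_ge0 ?enorm_ge0// mulrC.
rewrite ler_pM ?exprn_ge0 ?enorm_ge0 ?enormX_le_weight//.
by rewrite gegenbauerE ?Theta_le1// gegenbauer_poly_le ?Theta_le1.
Qed.

Lemma lebesgue_measurable_poisson_kernel l x :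
  lebesgue_measurable (poisson_kernel l x).
Proof.
have -> : poisson_kernel l x = fun y => (enorm y ^+ 2 - 2 * dot (bproj x) y
    + enorm (bproj x) ^+ 2 + height x ^+ 2) `^ (- l).
  by apply/funext => y; rewrite /poisson_kernel enormB_sqr.
rewrite /lebesgue_measurable.
apply: (@measurableT_comp _ _ _ _ _ _ (fun a : R => a `^ (- l))).
  exact: measurable_powR.
apply: measurable_funD; last exact: measurable_cst.
apply: measurable_funD; last exact: measurable_cst.
apply: measurable_funB; first exact: lebesgue_measurable_enormX.
by apply: measurable_funM; [exact: measurable_cst|exact: lebesgue_measurable_dot].
Qed.

Lemma poisson_kernel_le e M x y : half_space x ->
  `|poisson_kernel (e%:R / 2) x y| <= height x ^- e * weight M y.
Proof.
move=> hx; rewrite ger0_norm ?powR_ge0// (le_trans (powRN_half_le e hx _))//.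
  by rewrite lerDr sqr_ge0.
rewrite ler_peMr ?invr_ge0 ?exprn_ge0 ?(ltW hx)//.
by rewrite lerDr exprn_ge0// enorm_ge0.
Qed.

Definition kernel_rem_integral e M f x : R :=
  \int[lebesgue R d]_y (f y * kernel_rem e M x y).

Lemma lebesgue_measurable_kernel_rem e M x : (0 < e)%N -> half_space x ->
  lebesgue_measurable (kernel_rem e M x).
Proof.
move=> e0 hx; apply: measurable_funB; first exact: lebesgue_measurable_poisson_kernel.
apply: measurable_sum => m; apply: measurable_funM; first exact: measurable_cst.
by apply: lebesgue_measurable_moment; rewrite ?divr_gt0 ?ltr0n ?half_space_neq0.
Qed.

Lemma kernel_rem_integralE e M f x : (0 < e)%N -> admissible M f -> half_space x ->
  kernel_rem_integral e M f x =
  \int[lebesgue R d]_y (f y * poisson_kernel (e%:R / 2) x y) -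
  \sum_(m < M) enorm x ^- (m + e) *
    \int[lebesgue R d]_y (f y * enorm y ^+ m * gegenbauer m (e%:R / 2) (Theta x y)).
Proof.
move=> e0 fM hx; have x0 := half_space_neq0 hx.
have l0 : 0 < e%:R / 2 :> R by rewrite divr_gt0 ?ltr0n.
have im (m : 'I_M) : lebesgue_integrable (fun y => f y * enorm y ^+ m *
    gegenbauer m (e%:R / 2) (Theta x y)).
  under eq_fun do rewrite -mulrA.
  apply: (admissible_integrable fM); first exact: lebesgue_measurable_moment.
  by move=> y; exact: moment_le.
have im' (m : 'I_M) : lebesgue_integrable (fun y => enorm x ^- (m + e) *
    (f y * enorm y ^+ m * gegenbauer m (e%:R / 2) (Theta x y))).
  exact: lebesgue_integrableZ.
have ip : lebesgue_integrable (fun y => f y * poisson_kernel (e%:R / 2) x y).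
  apply: (admissible_integrable fM); first exact: lebesgue_measurable_poisson_kernel.
  by move=> y; exact: poisson_kernel_le.
rewrite (eq_bigr _ (fun (m : 'I_M) _ => esym (Rintegral_lebesgueZ (enorm x ^- (m + e)) (im m)))).
rewrite -Rintegral_lebesgue_sum// -Rintegral_lebesgueB//; last first.
  exact: lebesgue_integrable_sum.
apply: eq_Rintegral => y _; rewrite /kernel_rem mulrBr; congr (_ - _).
by rewrite mulr_sumr; apply: eq_bigr => m _; ring.
Qed.

(** Past the radius supplied by [tail_integral_small] the factor
[min 1 (|y| / |x|)] of the kernel bound is dominated by the one at
that radius, whatever the direction of [x]. *)
Lemma kernel_rem_integral_littleo e N f (eps : R) : (0 < e)%N -> admissible N.+1 f ->
  0 < eps -> exists2 r0 : R, 0 < r0 & forall x, half_space x -> r0 <= enorm x ->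
  `|kernel_rem_integral e N.+1 f x| <= eps * kernel_gauge e N.+1 x.
Proof.
move=> e0 fM eps0; have [C C0 HC] := @kernel_rem_le R d e N e0.
pose g y : R := `|f y * enorm y ^+ N|.
have ig0 : lebesgue_integrable (fun y => f y * enorm y ^+ N).
  apply: (@admissible_integrable _ _ _ _ _ 1 fM).
    exact: lebesgue_measurable_enormX.
  by move=> y; rewrite mul1r ger0_norm ?exprn_ge0 ?enorm_ge0// enormX_le_weight.
have ig : lebesgue_integrable g by exact: lebesgue_integrable_norm.
have [r r0 Hr] := tail_integral_small ig (fun y => normr_ge0 _)
  lebesgue_measurable_enorm (@enorm_ge0 _ _) (divr_gt0 eps0 (ltr_wpDl C0 ltr01)).
exists r => // x hx rx; have nx := lt_le_trans r0 rx.
have wx := kernel_gauge_gt0 e N.+1 hx.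
have ik : lebesgue_integrable (fun y => f y * kernel_rem e N.+1 x y).
  apply: (@admissible_integrable _ _ _ _ _ (C * kernel_gauge e N.+1 x) fM).
    exact: lebesgue_measurable_kernel_rem.
  move=> y; rewrite (le_trans (HC x y hx))// ler_wpM2l ?(mulr_ge0 C0 (ltW wx))//.
  rewrite (le_trans _ (enormX_le_weight y (ltnSn N)))//.
  by rewrite ler_piMr ?exprn_ge0 ?enorm_ge0// ge_min lexx.
have igm : lebesgue_integrable (fun y => g y * Num.min 1 (enorm y / r)).
  apply: (lebesgue_integrable_le _ _ ig).
    apply: measurable_funM; first exact: lebesgue_integrable_measurable.
    apply: measurable_minr; first exact: measurable_cst.
    by apply: measurable_funM; [exact: lebesgue_measurable_enorm|exact: measurable_cst].
  move=> y; rewrite normrM ler_piMr// ger0_norm ?ge_min ?lexx//.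
  by rewrite le_min ler01 divr_ge0 ?enorm_ge0// ltW.
rewrite /kernel_rem_integral (le_trans (le_normr_Rintegral _ ik))//.
apply: (@le_trans _ _ (\int[lebesgue R d]_y (C * kernel_gauge e N.+1 x *
    (g y * Num.min 1 (enorm y / r))))).
  apply: le_Rintegral => //; first exact: lebesgue_integrable_norm.
    exact: lebesgue_integrableZ.
  move=> y _; rewrite /g !normrM [`|_ ^+ _|]ger0_norm ?exprn_ge0 ?enorm_ge0//.
  rewrite -[_ * _ * Num.min _ _]mulrA [leRHS]mulrCA ler_wpM2l//.
  rewrite (le_trans (HC x y hx))// ler_wpM2l ?(mulr_ge0 C0 (ltW wx))//.
  rewrite ler_wpM2l ?exprn_ge0 ?enorm_ge0//.
  rewrite le_min ge_min lexx/= ge_min orbC ler_wpM2l ?enorm_ge0//.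
  by rewrite lef_pV2 ?posrE.
rewrite Rintegral_lebesgueZ// mulrAC ler_wpM2r ?(ltW wx)//.
rewrite (le_trans (ler_wpM2l C0 Hr))// mulrA ler_pdivrMr ?ltr_wpDl// mulrC.
by rewrite ler_wpM2l ?(ltW eps0)// lerDl.
Qed.

(** The supremum over a hemisphere is converted to a uniform estimate beyond
some radius. Each hemisphere of positive radius is nonempty, so the
supremum is never [-oo]. *)
Lemma little_oP (g w : 'rV[R]_d.+1 -> R) : (forall x, half_space x -> 0 < w x) ->
  little_o g w <-> (forall eps : R, 0 < eps -> exists2 r0 : R, 0 < r0 &
    forall x, half_space x -> r0 <= enorm x -> `|g x| <= eps * w x).
Proof.
move=> w0; split=> [/fine_cvgP[fin /cvgrPdist_le h] eps eps0|h].
  have [A [rA HA]] := fin; have [B [rB HB]] := h eps eps0.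
  pose r0 := Num.max 1 (Num.max (A + 1) (B + 1)).
  exists r0; first by rewrite lt_max ltr01.
  move=> x hx; rewrite /r0 !ge_max => /and3P[x1 xA xB].
  have Ax : A < enorm x by rewrite (lt_le_trans _ xA)// ltrDl.
  have Bx : B < enorm x by rewrite (lt_le_trans _ xB)// ltrDl.
  have := HB _ Bx; have := HA _ Ax; rewrite /= sub0r normrN.
  set S := ereal_sup _ => Sfin Sle.
  have : ((`|g x| / w x)%:E <= S)%E by apply: ereal_sup_ubound; exists x.
  rewrite -(fineK Sfin) lee_fin => gS.
  by rewrite -ler_pdivrMr ?w0// (le_trans gS)// (le_trans (ler_norm _)).
have bnd eps : 0 < eps -> exists2 r0 : R, 0 < r0 & forall r, r0 <= r ->
    (0 <= ereal_sup [set (`|g x| / w x)%:E | x in half_space `&` [set x | enorm x = r]]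
      <= eps%:E)%E.
  move=> eps0; have [r0 r00 Hr0] := h eps eps0; exists r0 => // r r0r.
  apply/andP; split.
    have [x hx xr] := @half_space_exists R d r (lt_le_trans r00 r0r).
    apply: (@le_trans _ _ (`|g x| / w x)%:E).
      by rewrite lee_fin divr_ge0// ltW// w0.
    by apply: ereal_sup_ubound; exists x.
  apply: ge_ereal_sup => _ [x [hx /= xr] <-]; rewrite lee_fin ler_pdivrMr ?w0//.
  by apply: Hr0; rewrite // xr.
apply/fine_cvgP; split.
  have [r0 r00 H] := bnd 1 ltr01; near=> r.
  have /andP[h0 h1] : (0 <= ereal_sup [set (`|g x| / w x)%:E |
    x in half_space `&` [set x | enorm x = r]] <= 1%:E)%E.
    by apply: H; near: r; apply: nbhs_pinfty_ge; rewrite num_real.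
  by rewrite ge0_fin_numE// (le_lt_trans h1)// ltry.
apply/cvgrPdist_le => eps eps0; have [r0 r00 H] := bnd eps eps0; near=> r.
have /andP[h0 h1] : (0 <= ereal_sup [set (`|g x| / w x)%:E |
    x in half_space `&` [set x | enorm x = r]] <= eps%:E)%E.
  by apply: H; near: r; apply: nbhs_pinfty_ge; rewrite num_real.
rewrite sub0r normrN /= ger0_norm ?fine_ge0// -lee_fin fineK//.
by rewrite ge0_fin_numE// (le_lt_trans h1)// ltry.
Unshelve. all: by end_near. Qed.

End remainder_expansion.

(** * Laplacians of solid Gegenbauer polynomials *)

Section laplacian.
Context {R : realType} {n : nat}.
Implicit Types (p r : mpoly n R) (i : 'I_n) (l : R) (k m : nat).

Definition mvar i : mpoly n R := mpolyX R (mnm1 i).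

Definition laplacian p : mpoly n R := \sum_i mderiv i (mderiv i p).

Definition msqnorm : mpoly n R := \sum_i mvar i ^+ 2.

Lemma mderiv_mvar i j : mderiv i (mvar j) = (i == j)%:R.
Proof.
rewrite /mvar mderivX mnm1E eq_sym; case: eqVneq => [->|_]; last by rewrite scale0r.
rewrite scale1r (_ : mnm_sub _ _ = mnm0) ?mpolyX0//.
by apply/mnmP => k; rewrite mnmBE mnm0E subnn.
Qed.

Lemma mderiv_nat i k : mderiv i (k%:R : mpoly n R) = 0.
Proof. by rewrite -(rmorph_nat (mpolyC n (R:=R))) mderivC. Qed.

Lemma mderivCM i (a : R) p : mderiv i (mpolyC n a * p) = mpolyC n a * mderiv i p.
Proof. by rewrite !mul_mpolyC mderivZ. Qed.

Lemma mderiv_natM i k p : mderiv i (k%:R * p) = k%:R * mderiv i p.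
Proof. by rewrite mderivM mderiv_nat mul0r add0r. Qed.

Lemma mderiv_exp i p k : mderiv i (p ^+ k) = k%:R * p ^+ k.-1 * mderiv i p.
Proof.
elim: k => [|k IH]; first by rewrite expr0 (mderiv_nat i 1) !mul0r.
rewrite exprS mderivM IH -natr1; case: k {IH} => [|k] /=; first by rewrite expr0; ring.
by rewrite [p ^+ k.+1]exprS; ring.
Qed.

Lemma laplacianM p r : laplacian (p * r) =
  laplacian p * r + p * laplacian r + 2 * \sum_i mderiv i p * mderiv i r.
Proof.
rewrite /laplacian mulr_suml !mulr_sumr -!big_split; apply: eq_bigr => i _ /=.
by rewrite mderivM mderivD !mderivM; ring.
Qed.

Lemma mderiv_sum i I (s : seq I) (F : I -> mpoly n R) :
  mderiv i (\sum_(j <- s) F j) = \sum_(j <- s) mderiv i (F j).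
Proof.
elim: s => [|j s IH]; first by rewrite !big_nil (mderiv_nat i 0).
by rewrite !big_cons mderivD IH.
Qed.

Lemma laplacian_sum I (s : seq I) (F : I -> mpoly n R) :
  laplacian (\sum_(j <- s) F j) = \sum_(j <- s) laplacian (F j).
Proof.
rewrite /laplacian exchange_big; apply: eq_bigr => i _ /=.
by rewrite (mderiv_sum i s F) mderiv_sum.
Qed.

Lemma laplacianCM (a : R) p : laplacian (mpolyC n a * p) = mpolyC n a * laplacian p.
Proof. by rewrite /laplacian mulr_sumr; apply: eq_bigr => i _; rewrite !mderivCM. Qed.

Lemma mderiv_msqnorm i : mderiv i msqnorm = 2 * mvar i.
Proof.
rewrite mderiv_sum (bigD1 i)//= big1 ?addr0.
  by rewrite mderiv_exp mderiv_mvar eqxx mulr1 expr1.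
by move=> j /negbTE ji; rewrite mderiv_exp mderiv_mvar eq_sym ji mulr0.
Qed.

Lemma laplacian_msqnorm_exp k : laplacian (msqnorm ^+ k) =
  (2 * k * (n + 2 * k.-1))%:R * msqnorm ^+ k.-1.
Proof.
rewrite /laplacian.
transitivity (\sum_i ((4 * k * k.-1)%:R * msqnorm ^+ k.-2 * mvar i ^+ 2
    + (2 * k)%:R * msqnorm ^+ k.-1)).
  apply: eq_bigr => i _.
  rewrite mderiv_exp mderiv_msqnorm -!mulrA mderiv_natM mderivM mderiv_exp.
  by rewrite mderiv_msqnorm mderiv_natM mderiv_mvar eqxx /=; ring.
rewrite big_split/= -mulr_sumr -/msqnorm sumr_const card_ord -mulr_natr.
by case: k => [|[|k]] //=; rewrite ?exprS ?expr0; ring.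
Qed.

Variable c : 'I_n -> R.

Definition mlinear : mpoly n R := \sum_i mpolyC n (c i) * mvar i.

Let q : R := \sum_i c i ^+ 2.

Lemma mderiv_mlinear i : mderiv i mlinear = mpolyC n (c i).
Proof.
rewrite mderiv_sum (bigD1 i)//= big1 ?addr0.
  by rewrite mderivCM mderiv_mvar eqxx mulr1.
by move=> j /negbTE ji; rewrite mderivCM mderiv_mvar eq_sym ji mulr0.
Qed.

Lemma laplacian_mlinear_exp k : laplacian (mlinear ^+ k) =
  (k * k.-1)%:R * mpolyC n q * mlinear ^+ k.-2.
Proof.
rewrite /laplacian /q rmorph_sum mulr_sumr mulr_suml; apply: eq_bigr => i _ /=.
rewrite mderiv_exp mderiv_mlinear mulrC mderivCM mderiv_natM mderiv_exp.
by rewrite mderiv_mlinear rmorphXn/=; ring.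
Qed.

Lemma laplacian_mlinear_msqnorm (j k : nat) : laplacian (mlinear ^+ j * msqnorm ^+ k) =
  (j * j.-1)%:R * mpolyC n q * (mlinear ^+ j.-2 * msqnorm ^+ k) +
  (2 * k * (n + 2 * k.-1 + 2 * j))%:R * (mlinear ^+ j * msqnorm ^+ k.-1).
Proof.
rewrite laplacianM laplacian_mlinear_exp laplacian_msqnorm_exp.
have -> : \sum_i mderiv i (mlinear ^+ j) * mderiv i (msqnorm ^+ k) =
    (2 * k * j)%:R * mlinear ^+ j * msqnorm ^+ k.-1.
  transitivity (\sum_i (2 * k * j)%:R * mlinear ^+ j.-1 * msqnorm ^+ k.-1 *
      (mpolyC n (c i) * mvar i)).
    apply: eq_bigr => i _; rewrite !mderiv_exp mderiv_mlinear mderiv_msqnorm; ring.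
  rewrite -mulr_sumr -/mlinear; case: (j) => [|j'] /=; first by rewrite muln0; ring.
  by rewrite [mlinear ^+ j'.+1]exprS; ring.
by ring.
Qed.

(** The polynomial in [x] whose value is the homogeneous Gegenbauer form
at [(c . x, |c| ^ 2 |x| ^ 2)]. *)
Definition gegenbauer_solid l m : mpoly n R :=
  \sum_(k < m.+1) mpolyC n (gegenbauer_coef l m k * q ^+ k) *
    (mlinear ^+ (m - k.*2) * msqnorm ^+ k).

(** The two contributions to one monomial of the Laplacian of a solid Gegenbauer
polynomial: the linear form of the [k]-th term differentiated twice, and the
squared norm of the next term differentiated. *)
Lemma gegenbauer_coef_harmonic l m k :
  gegenbauer_coef l m k * ((m - k.*2) * (m - k.*2).-1)%:R +
  4 * k.+1%:R * (l + (m - k.+1)%:R) * gegenbauer_coef l m k.+1 = 0.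
Proof.
have [km|mk] := leqP k.+1.*2 m; last first.
  rewrite (gegenbauer_coef_small l mk) mulr0 addr0.
  have [km|mk'] := leqP k.*2 m; last by rewrite gegenbauer_coef_small// mul0r.
  have : (m - k.*2 <= 1)%N by rewrite leq_subLR addn1; move: mk; rewrite doubleS.
  by case: (m - k.*2)%N => [|[|]]// _; rewrite ?mul0n ?muln0 mulr0.
rewrite -(subnK km); set j := (m - _)%N; clearbody j; clear km.
rewrite (_ : (j + k.+1.*2 - k.*2)%N = j.+2); last by rewrite doubleS; lia.
rewrite (_ : (j + k.+1.*2 - k.+1)%N = (j + k.+1)%N); last by rewrite -addnn; lia.
have -> : gegenbauer_coef l (j + k.+1.*2) k = gegenbauer_coef l (j.+2 + k.*2) k.
  by congr gegenbauer_coef; rewrite doubleS; lia.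
rewrite !gegenbauer_coefE addSn addSn -addnS risingS /= !exprS !factS !natrM.
by field; rewrite -?natrD ?nat1r !pnatr_eq0 -?lt0n ?fact_gt0.
Qed.

Let level m k : mpoly n R := mlinear ^+ (m - k.*2).-2 * msqnorm ^+ k.

(** Each term of the solid polynomial contributes to two neighbouring levels [k];
shifting the second contribution by one collects them. *)
Lemma laplacian_gegenbauer_solid l m : laplacian (gegenbauer_solid l m) =
  \sum_(k < m.+1) mpolyC n (q ^+ k.+1 *
    (gegenbauer_coef l m k * ((m - k.*2) * (m - k.*2).-1)%:R +
     (2 * k.+1 * (n + 2 * k + 2 * (m - k.*2).-2))%:R * gegenbauer_coef l m k.+1)) * level m k.
Proof.
rewrite laplacian_sum.
under eq_bigr => k _ do rewrite laplacianCM.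
under eq_bigr => k _ do rewrite laplacian_mlinear_msqnorm mulrDr.
rewrite big_split/= [X in _ + X]big_ord_recl/= muln0 mul0n mul0r mulr0 add0r.
under [RHS]eq_bigr => k _ do rewrite mulrDr rmorphD mulrDl.
rewrite big_split/=; congr (_ + _).
  apply: eq_bigr => k _; rewrite /level !rmorphM/= !rmorphXn/= rmorph_nat exprS; ring.
rewrite [RHS]big_ord_recr/= gegenbauer_coef_small ?mulr0 ?rmorph0 ?mul0r ?addr0; last first.
  by rewrite doubleS; lia.
apply: eq_bigr => k _; rewrite /bump/= add1n /level.
have -> : (m - k.+1.*2 = (m - k.*2).-2)%N by rewrite doubleS; lia.
by rewrite !rmorphM/= !rmorphXn/= !rmorph_nat; ring.
Qed.

Lemma mderiv_gegenbauer_solid l m i : c i = 0 -> mderiv i (gegenbauer_solid l m) =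
  mvar i * \sum_(k < m.+1) mpolyC n (q ^+ k.+1 * ((2 * k.+1)%:R * gegenbauer_coef l m k.+1))
     * level m k.
Proof.
move=> ci; rewrite mderiv_sum big_ord_recl/= double0 expr0 mulr1.
rewrite mderivCM [msqnorm ^+ 0]expr0 mulr1 mderiv_exp mderiv_mlinear ci rmorph0 !mulr0 add0r.
rewrite [in RHS]big_ord_recr/= gegenbauer_coef_small ?mulr0 ?rmorph0 ?mul0r ?addr0; last first.
  by rewrite doubleS; lia.
rewrite mulr_sumr; apply: eq_bigr => k _; rewrite /bump/= add1n mderivCM mderivM !mderiv_exp.
rewrite mderiv_mlinear ci rmorph0 mderiv_msqnorm /level /=.
have -> : (m - k.+1.*2 = (m - k.*2).-2)%N by rewrite doubleS; lia.
by rewrite !rmorphM/= !rmorphXn/= !rmorph_nat; ring.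
Qed.

Lemma gegenbauer_solid_harmonic l m : n%:R = 2 * l + 2 :> R ->
  laplacian (gegenbauer_solid l m) = 0.
Proof.
move=> nl; rewrite laplacian_gegenbauer_solid big1// => k _.
rewrite [_ + _](_ : _ = 0) ?mulr0 ?rmorph0 ?mul0r//.
rewrite -(gegenbauer_coef_harmonic l m k); congr (_ + _).
have [km|mk] := leqP k.+1.*2 m; last by rewrite (gegenbauer_coef_small l mk) !mulr0.
have -> : (m - k.+1 = (m - k.*2).-2 + k.+1)%N by move: km; rewrite doubleS; lia.
by rewrite !natrM !natrD nl; ring.
Qed.

(** When the linear form does not involve the variable [i], the cross term
[2 * mderiv i] of the product rule raises the
dimension in the coefficient at level [k] by two. *)
Lemma mvar_gegenbauer_solid_harmonic l m i : n%:R = 2 * l :> R -> c i = 0 ->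
  laplacian (mvar i * gegenbauer_solid l m) = 0.
Proof.
move=> nl ci; rewrite laplacianM.
have -> : laplacian (mvar i) = 0.
  by apply: big1 => j _; rewrite mderiv_mvar mderiv_nat.
rewrite mul0r add0r (bigD1 i)//= big1 ?addr0 => [|j /negbTE ji]; last first.
  by rewrite mderiv_mvar ji mul0r.
rewrite mderiv_mvar eqxx mul1r mderiv_gegenbauer_solid// laplacian_gegenbauer_solid.
rewrite mulrCA -mulrDr; apply/eqP; rewrite mulf_eq0; apply/orP; right; apply/eqP.
rewrite mulr_sumr -big_split big1//= => k _.
rewrite (_ : (2 : mpoly n R) = mpolyC n (2 : R)); last by rewrite rmorph_nat.
rewrite [mpolyC n 2 * _]mulrA -(rmorphM (mpolyC n (R:=R))) -mulrDl.
rewrite -(rmorphD (mpolyC n (R:=R)))/= [_ + _](_ : _ = 0) ?rmorph0 ?mul0r//.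
rewrite mulrCA -mulrDr -[RHS](mulr0 (q ^+ k.+1)); congr (_ * _).
rewrite -(gegenbauer_coef_harmonic l m k) -addrA; congr (_ + _).
have [km|mk] := leqP k.+1.*2 m; last by rewrite (gegenbauer_coef_small l mk) !mulr0 addr0.
have -> : (m - k.+1 = (m - k.*2).-2 + k.+1)%N by move: km; rewrite doubleS; lia.
by rewrite !natrM !natrD nl; ring.
Qed.

End laplacian.

(** * Integrating families of polynomials *)

Section polynomial_growth.
Context {R : realType} {d : nat}.
Implicit Types (phi psi : 'rV[R]_d -> R) (j k : nat).

(** The coefficients of the solid Gegenbauer polynomials as functions of the
boundary point: measurable and of controlled size, hence integrable
against admissible data as long as [j] is less than [M]. *)
Definition growth j phi : Prop :=
  lebesgue_measurable phi /\ exists C : R, forall y, `|phi y| <= C * enorm y ^+ j.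

Lemma growth_cst (a : R) : growth 0 (fun=> a).
Proof.
by split; [exact: measurable_cst|exists `|a| => y; rewrite expr0 mulr1].
Qed.

Lemma growth0 j : growth j (fun=> 0).
Proof. by split; [exact: measurable_cst|exists 0 => y; rewrite mul0r normr0]. Qed.

Lemma growthD j phi psi : growth j phi -> growth j psi ->
  growth j (fun y => phi y + psi y).
Proof.
move=> [m1 [C1 h1]] [m2 [C2 h2]]; split; first by apply: measurable_funD; [exact: m1|exact: m2].
by exists (C1 + C2) => y; rewrite mulrDl (le_trans (ler_normD _ _))// lerD.
Qed.

Lemma growthM j k phi psi : growth j phi -> growth k psi ->
  growth (j + k) (fun y => phi y * psi y).
Proof.
move=> [m1 [C1 h1]] [m2 [C2 h2]]; split; first by apply: measurable_funM; [exact: m1|exact: m2].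
by exists (C1 * C2) => y; rewrite normrM exprD mulrACA ler_pM.
Qed.

Lemma growth_sum j I (s : seq I) (F : I -> 'rV[R]_d -> R) :
  (forall i, growth j (F i)) -> growth j (fun y => \sum_(i <- s) F i y).
Proof.
move=> gF; elim: s => [|i s IH].
  by under eq_fun do rewrite big_nil; exact: growth0.
by under eq_fun do rewrite big_cons; exact: growthD.
Qed.

Lemma growth_coord i : growth 1 (fun y => y ord0 i).
Proof.
split; first exact: lebesgue_measurable_coord.
by exists 1 => y; rewrite mul1r expr1 coord_le_enorm.
Qed.

Lemma growth_enormX j : growth j (fun y => enorm y ^+ j).
Proof.
split; first exact: lebesgue_measurable_enormX.
by exists 1 => y; rewrite mul1r ger0_norm ?exprn_ge0 ?enorm_ge0.
Qed.

Lemma growth_integrable M m f phi : admissible M f -> (m < M)%N -> growth m phi ->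
  lebesgue_integrable (fun y => f y * phi y).
Proof.
move=> fM mM [mphi [C hC]]; apply: (admissible_integrable (C := `|C|) fM mphi) => y.
rewrite (le_trans (hC y))// (@le_trans _ _ (`|C| * enorm y ^+ m))//.
  by rewrite ler_wpM2r ?exprn_ge0 ?enorm_ge0// ler_norm.
by rewrite ler_wpM2l// enormX_le_weight.
Qed.

Context {n : nat}.
Implicit Types (H G : 'rV[R]_d -> mpoly n R).

Definition mgrowth j H : Prop := forall nu, growth j (fun y => mcoeff nu (H y)).

Lemma mgrowth_cst (p : mpoly n R) : mgrowth 0 (fun=> p).
Proof. by move=> nu; exact: growth_cst. Qed.

Lemma mgrowth_mpolyC j phi : growth j phi -> mgrowth j (fun y => mpolyC n (phi y)).
Proof.
move=> gphi nu; under eq_fun do rewrite mcoeffC.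
by rewrite -[j]addn0; apply: growthM => //; exact: growth_cst.
Qed.

Lemma mgrowthM j k H G : mgrowth j H -> mgrowth k G ->
  mgrowth (j + k) (fun y => H y * G y).
Proof.
move=> gH gG nu; under eq_fun do rewrite mcoeffM big_mkcond/=.
apply: growth_sum => i; case: (nu == mnm_add i.1 i.2); last exact: growth0.
by apply: growthM; [exact: gH|exact: gG].
Qed.

Lemma mgrowth_exp j k H : mgrowth j H -> mgrowth (j * k) (fun y => H y ^+ k).
Proof.
move=> gH; elim: k => [|k IH].
  by rewrite muln0; under eq_fun do rewrite expr0; exact: mgrowth_cst.
by rewrite mulnS; under eq_fun do rewrite exprS; exact: mgrowthM.
Qed.

Lemma mgrowth_sum j I (s : seq I) (F : I -> 'rV[R]_d -> mpoly n R) :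
  (forall i, mgrowth j (F i)) -> mgrowth j (fun y => \sum_(i <- s) F i y).
Proof.
move=> gF nu; under eq_fun do rewrite (raddf_sum (mcoeff nu)).
by apply: growth_sum => i; exact: gF.
Qed.

(** The integral of [f y *: H y], taken coefficient by coefficient. For a
family that is homogeneous of degree [m] the monomials of degree at most [m]
exhaust the support. *)
Definition integrated_form f m H : mpoly n R :=
  \sum_(nu : bmultinom n m.+1) (\int[lebesgue R d]_y (f y * mcoeff nu (H y))) *: mpolyX R nu.

Definition linear_form (L : mpoly n R -> R) : Prop :=
  (forall p q, L (p + q) = L p + L q) /\ (forall a p, L (a *: p) = a * L p).

Lemma linear_form_sum L (J : finType) (a : J -> R) (P : J -> mpoly n R) :
  linear_form L -> L (\sum_j a j *: P j) = \sum_j a j * L (P j).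
Proof.
move=> [LD LZ]; have L0 : L 0 = 0 by rewrite -(scale0r (0 : mpoly n R)) LZ mul0r.
by apply: (big_ind2 (fun p u => L p = u)) => // p u q v <- <-; exact: LD.
Qed.

(** Every property wanted of the integrated polynomial is the value of a linear
form (evaluation, a coefficient of the polynomial or of its Laplacian,
evaluation of a derivative), and these commute with the integral because they
only see the finitely many coefficients. *)
Lemma linear_form_integrated L M f m H : linear_form L -> admissible M f -> (m < M)%N ->
  mgrowth m H -> (forall y, H y \is ishomog1 m mdeg) ->
  L (integrated_form f m H) = \int[lebesgue R d]_y (f y * L (H y)).
Proof.
move=> hL fM mM gH homH; rewrite linear_form_sum//.
have iH (nu : bmultinom n m.+1) : lebesgue_integrable (fun y => f y * mcoeff nu (H y)).
  exact: growth_integrable fM mM (gH nu).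
transitivity (\sum_(nu : bmultinom n m.+1)
    \int[lebesgue R d]_y (L (mpolyX R nu) * (f y * mcoeff nu (H y)))).
  by apply: eq_bigr => nu _; rewrite Rintegral_lebesgueZ// mulrC.
rewrite -Rintegral_lebesgue_sum; last by move=> nu; exact: lebesgue_integrableZ.
apply: eq_Rintegral => y _; rewrite [in RHS](@mpolywE _ _ m.+1 (H y)); last first.
  rewrite msizeE; apply/bigmax_leqP_seq => nu nus _.
  by rewrite (dhomog_mf (homH y) nus).
rewrite linear_form_sum// mulr_sumr; apply: eq_bigr => nu _; ring.
Qed.

Lemma integrated_form_homog M f m H : admissible M f -> (m < M)%N ->
  mgrowth m H -> (forall y, H y \is ishomog1 m mdeg) ->
  integrated_form f m H \is ishomog1 m mdeg.
Proof.
move=> fM mM gH homH; apply/dhomogP => nu.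
rewrite mcoeff_msupp; apply: contraNeq => num; apply/eqP.
have lin : linear_form (mcoeff nu) by split=> [p q|a p]; rewrite ?mcoeffD ?mcoeffZ.
rewrite (linear_form_integrated lin fM mM gH homH) /Rintegral.
rewrite (eq_integral (fun=> 0%E)) ?integral0// => y _.
by rewrite (dhomog_nemf_coeff (homH y) num) mulr0.
Qed.

End polynomial_growth.

(** * The coefficients as spherical harmonics *)

Section spherical_harmonics.
Context {R : realType} {d : nat}.
Local Notation n := d.+1.
Implicit Types (f : 'rV[R]_d -> R) (x : 'rV[R]_n) (y : 'rV[R]_d) (l : R) (M m e : nat).

(** A boundary point seen in the ambient space, with last coordinate zero. *)
Definition boundary_coord y (i : 'I_n) : R :=
  if unlift ord_max i is Some j then y ord0 j else 0.

Lemma boundary_coord_max y : boundary_coord y ord_max = 0.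
Proof. by rewrite /boundary_coord unlift_none. Qed.

Lemma boundary_coord_widen y (i : 'I_d) :
  boundary_coord y (widen_ord (leqnSn d) i) = y ord0 i.
Proof.
have -> : widen_ord (leqnSn d) i = lift ord_max i.
  by apply: val_inj; rewrite /= /bump leqNgt ltn_ord.
by rewrite /boundary_coord liftK.
Qed.

Lemma sum_boundary_coord_sqr y : \sum_i boundary_coord y i ^+ 2 = enorm y ^+ 2.
Proof.
rewrite big_ord_recr/= boundary_coord_max expr0n/= addr0 enorm_sqr.
by apply: eq_bigr => i _; rewrite boundary_coord_widen expr2.
Qed.

Lemma linear_form_peval x : linear_form (fun p : mpoly n R => peval p x).
Proof. by split=> [p q|a p]; rewrite /peval ?mevalD ?mevalZ. Qed.

Lemma pevalM (p q : mpoly n R) x : peval (p * q) x = peval p x * peval q x.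
Proof. exact: mevalM. Qed.

Lemma peval_sum I (s : seq I) (F : I -> mpoly n R) x :
  peval (\sum_(i <- s) F i) x = \sum_(i <- s) peval (F i) x.
Proof. by rewrite /peval (raddf_sum (meval _)). Qed.

Lemma peval_exp (p : mpoly n R) x k : peval (p ^+ k) x = peval p x ^+ k.
Proof.
elim: k => [|k IH]; first by rewrite !expr0 /peval meval1.
by rewrite !exprS pevalM IH.
Qed.

Lemma peval_mvar i x : peval (mvar i) x = x ord0 i.
Proof. exact: mevalXU. Qed.

Lemma peval_mpolyC (a : R) x : peval (mpolyC n a) x = a.
Proof. exact: mevalC. Qed.

Lemma peval_mlinear x y : peval (mlinear (boundary_coord y)) x = dot (bproj x) y.
Proof.
rewrite peval_sum big_ord_recr/= boundary_coord_max pevalM peval_mpolyC mul0r addr0.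
apply: eq_bigr => i _.
by rewrite pevalM peval_mpolyC peval_mvar boundary_coord_widen mxE mulrC.
Qed.

Lemma peval_msqnorm x : peval (msqnorm : mpoly n R) x = enorm x ^+ 2.
Proof.
rewrite peval_sum enorm_sqr; apply: eq_bigr => i _.
by rewrite peval_exp peval_mvar expr2.
Qed.

Local Notation solid y l m := (gegenbauer_solid (boundary_coord y) l m).

Lemma peval_gegenbauer_solid l m x y : peval (solid y l m) x =
  gegenbauer_form l m (dot (bproj x) y) (enorm x ^+ 2 * enorm y ^+ 2).
Proof.
rewrite peval_sum; apply: eq_bigr => k _.
rewrite !pevalM !peval_exp peval_mpolyC peval_mlinear peval_msqnorm.
rewrite sum_boundary_coord_sqr; move: (enorm x ^+ 2) (enorm y ^+ 2) => a b.
by rewrite exprMn; ring.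
Qed.

Lemma gegenbauer_moment_solid l m x y : 0 < l -> enorm x = 1 ->
  enorm y ^+ m * gegenbauer m l (Theta x y) = peval (solid y l m) x.
Proof.
move=> l0 x1; have x0 : x != 0 by rewrite -enorm_eq0 x1 oner_eq0.
by rewrite gegenbauer_moment// peval_gegenbauer_solid x1 divr1 expr1n mul1r.
Qed.

Lemma mvar_homog i : (mvar i : mpoly n R) \is ishomog1 1 mdeg.
Proof. by rewrite dhomogX /= mdeg1. Qed.

Lemma gegenbauer_solid_homog l m y : solid y l m \is ishomog1 m mdeg.
Proof.
have homC (a : R) : mpolyC n a \is ishomog1 0 mdeg.
  by rewrite -[mpolyC n a]mulr1 mul_mpolyC dhomogZ// dhomog1.
have homU : mlinear (boundary_coord y) \is ishomog1 1 mdeg.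
  apply: rpred_sum => i _; rewrite -[1%N]add0n.
  by apply: dhomogM; [exact: homC|exact: mvar_homog].
have homQ : (msqnorm : mpoly n R) \is ishomog1 2 mdeg.
  by apply: rpred_sum => i _; exact: (dhomogMn 2 (mvar_homog i)).
apply: rpred_sum => k _; have [km|mk] := leqP k.*2 m; last first.
  by rewrite gegenbauer_coef_small// mul0r mpolyC0 mul0r rpred0.
have := dhomogM (homC (gegenbauer_coef l m k * (\sum_i boundary_coord y i ^+ 2) ^+ k))
  (dhomogM (dhomogMn (m - k.*2) homU) (dhomogMn k homQ)).
by rewrite mul1n mul2n add0n subnK.
Qed.

Lemma gegenbauer_solid_growth l m : mgrowth m (fun y => solid y l m).
Proof.
have gU : mgrowth 1 (fun y => mlinear (boundary_coord y) : mpoly n R).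
  apply: mgrowth_sum => i; apply: (@mgrowthM _ _ _ 1 0); last exact: mgrowth_cst.
  apply: mgrowth_mpolyC; rewrite /boundary_coord.
  by case: (unlift ord_max i) => [j|]; [exact: growth_coord|exact: growth0].
apply: mgrowth_sum => k; have [km|mk] := leqP k.*2 m; last first.
  under eq_fun do rewrite gegenbauer_coef_small// mul0r mpolyC0 mul0r.
  by move=> nu; under eq_fun do rewrite mcoeff0; exact: growth0.
have gC : mgrowth (0 + k.*2) (fun y =>
    mpolyC n (gegenbauer_coef l m k * (\sum_i boundary_coord y i ^+ 2) ^+ k)).
  apply: mgrowth_mpolyC; apply: growthM; first exact: growth_cst.
  under eq_fun do rewrite sum_boundary_coord_sqr -exprM mul2n.
  exact: growth_enormX.
have := mgrowthM gC (mgrowthM (mgrowth_exp (m - k.*2) gU) (mgrowth_cst (msqnorm ^+ k))).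
by rewrite add0n mul1n addn0 subnKC.
Qed.

Definition moment_form l m f : mpoly n R := integrated_form f m (fun y => solid y l m).

Lemma peval_moment_form l M m f x : 0 < l -> enorm x = 1 -> admissible M f -> (m < M)%N ->
  peval (moment_form l m f) x =
  \int[lebesgue R d]_y (f y * enorm y ^+ m * gegenbauer m l (Theta x y)).
Proof.
move=> l0 x1 fM mM.
rewrite (linear_form_integrated (linear_form_peval x) fM mM
  (gegenbauer_solid_growth l m) (fun y => gegenbauer_solid_homog l m y)).
by apply: eq_Rintegral => y _; rewrite -mulrA gegenbauer_moment_solid.
Qed.

Lemma laplacianD (p q : mpoly n R) : laplacian (p + q) = laplacian p + laplacian q.
Proof. by rewrite -big_split; apply: eq_bigr => i _; rewrite !mderivD. Qed.

Lemma laplacianZ (a : R) (p : mpoly n R) : laplacian (a *: p) = a *: laplacian p.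
Proof. by rewrite -!mul_mpolyC laplacianCM. Qed.

Lemma linear_form_integral0 (L : mpoly n R -> R) l M m f : linear_form L ->
  admissible M f -> (m < M)%N -> (forall y, L (solid y l m) = 0) ->
  L (moment_form l m f) = 0.
Proof.
move=> hL fM mM L0; rewrite (linear_form_integrated hL fM mM
  (gegenbauer_solid_growth l m) (fun y => gegenbauer_solid_homog l m y)).
rewrite /Rintegral (eq_integral (fun=> 0%E)) ?integral0// => y _.
by rewrite L0 mulr0.
Qed.

Lemma moment_form_homog l M m f : admissible M f -> (m < M)%N ->
  moment_form l m f \is ishomog1 m mdeg.
Proof.
move=> fM mM; apply: (integrated_form_homog fM mM (gegenbauer_solid_growth l m)) => y.
exact: gegenbauer_solid_homog.
Qed.

Lemma Y0_spherical_harmonic M m f : admissible M f -> (m < M)%N ->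
  spherical_harmonic_dirichlet m.+1 (Y0 f m).
Proof.
move=> fM mM; set l : R := n%:R / 2.
have l0 : 0 < l by rewrite divr_gt0.
have nl : n%:R = 2 * l by rewrite /l; field.
exists (alpha n *: (mvar ord_max * moment_form l m f)); split.
- split.
    rewrite dhomogZ//; exact: (dhomogM (mvar_homog ord_max) (moment_form_homog l fM mM)).
  rewrite -/(laplacian _) laplacianZ; apply/mpolyP => nu; rewrite mcoeffZ mcoeff0.
  rewrite (@linear_form_integral0 (fun p => mcoeff nu (laplacian (mvar ord_max * p))) l M)
    ?mulr0//.
    split=> [p q|a p]; first by rewrite mulrDr laplacianD mcoeffD.
    by rewrite -scalerAr laplacianZ mcoeffZ.
  move=> y; rewrite mvar_gegenbauer_solid_harmonic ?mcoeff0//.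
  exact: boundary_coord_max.
- move=> x x1; have x0 : x != 0 by rewrite -enorm_eq0 x1 oner_eq0.
  rewrite (linear_form_peval x).2 pevalM peval_mvar (peval_moment_form l0 x1 fM mM).
  by rewrite /Y0 cos_theta// x1 divr1 /height mulrA.
- move=> x hx; rewrite (linear_form_peval x).2 pevalM peval_mvar.
  by rewrite -/(height x) hx mul0r mulr0.
Qed.

Lemma Y1_spherical_harmonic M m f : (2 <= d)%N -> admissible M f -> (m < M)%N ->
  spherical_harmonic_neumann m (Y1 f m).
Proof.
move=> d2 fM mM; set l : R := (n%:R - 2) / 2.
have l0 : 0 < l by rewrite divr_gt0// subr_gt0 ltr_nat.
have nl : n%:R = 2 * l + 2 by rewrite /l; field.
exists ((alpha n / (n%:R - 2)) *: moment_form l m f); split.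
- split; first by rewrite dhomogZ// (moment_form_homog _ fM mM).
  rewrite -/(laplacian _) laplacianZ; apply/mpolyP => nu; rewrite mcoeffZ mcoeff0.
  rewrite (@linear_form_integral0 (fun p => mcoeff nu (laplacian p)) l M) ?mulr0//.
    by split=> [p q|a p]; rewrite ?laplacianD ?mcoeffD ?laplacianZ ?mcoeffZ.
  by move=> y; rewrite gegenbauer_solid_harmonic ?mcoeff0.
- move=> x x1.
  by rewrite (linear_form_peval x).2 (peval_moment_form l0 x1 fM mM).
- move=> x hx; rewrite mderivZ (linear_form_peval x).2.
  rewrite (@linear_form_integral0 (fun p => peval (mderiv ord_max p) x) l M) ?mulr0//.
    by split=> [p q|a p]; rewrite ?mderivD ?mderivZ /peval ?mevalD ?mevalZ.
  move=> y; rewrite mderiv_gegenbauer_solid ?boundary_coord_max// pevalM peval_mvar.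
  by rewrite -/(height x) hx mul0r.
Qed.

End spherical_harmonics.

(** * Points where the remainder kernel is large *)

Section finite_differences.
Context {R : realType}.

Lemma size_shift_exp_sub (a : R) i : (size (('X + a%:P) ^+ i - 'X^i)%R <= i)%N.
Proof.
elim: i => [|i IH]; first by rewrite !expr0 subrr size_poly0.
have -> : ('X + a%:P) ^+ i.+1 - 'X^(i.+1) =
    ('X + a%:P) * (('X + a%:P) ^+ i - 'X^i) + a *: 'X^i.
  by rewrite !exprS -mul_polyC; ring.
rewrite (leq_trans (size_polyD _ _))// geq_max; apply/andP; split.
  rewrite (leq_trans (size_polyMleq _ _))//.
  by rewrite size_XaddC /= ltnS.
by rewrite (leq_trans (size_scale_leq _ _))// size_polyXn.
Qed.

Lemma size_shift_sub (p : {poly R}) (a : R) k : (size p <= k.+1)%N ->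
  (size (p \Po ('X + a%:P) - p)%R <= k)%N.
Proof.
move=> pk; rewrite comp_polyE -[X in _ - X]coefK poly_def -sumrB.
apply: (leq_trans (size_sum _ _ _)); apply/bigmax_leqP => i _.
rewrite -scalerBr (leq_trans (size_scale_leq _ _))//.
rewrite (leq_trans (size_shift_exp_sub a i))// -ltnS.
exact: leq_trans (ltn_ord i) pk.
Qed.

(** Induction on the degree: the difference [p (X + a) - p] has lower degree, and it is at
most [2 * eps] on a progression that is shorter by one. *)
Lemma horner0_le_progression k (p : {poly R}) (a eps : R) : (size p <= k)%N ->
  (forall j, (1 <= j <= k)%N -> `|p.[j%:R * a]| <= eps) ->
  `|p.[0]| <= (2 ^+ k - 1) * eps.
Proof.
elim: k p eps => [|k IH] p eps pk pj.
  by move: pk; rewrite leqn0 size_poly_eq0 => /eqP ->; rewrite horner0 normr0 expr0 subrr mul0r.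
pose q := p \Po ('X + a%:P) - p.
have qE z : q.[z] = p.[z + a] - p.[z].
  by rewrite hornerD hornerN horner_comp !hornerE.
have := IH q (2 * eps) (size_shift_sub a pk).
have -> : p.[0] = p.[a] - q.[0] by rewrite qE add0r; ring.
move=> /(_ _) h; apply: (le_trans (ler_normB _ _)).
have pa : `|p.[a]| <= eps by have := pj 1%N isT; rewrite mul1r.
apply: (@le_trans _ _ (eps + (2 ^+ k - 1) * (2 * eps))); last first.
  by rewrite exprS; lra.
apply: lerD => //; apply: h => j /andP[j1 jk].
rewrite qE (le_trans (ler_normB _ _))// [leRHS]mulr_natl mulr2n lerD//.
  have -> : j%:R * a + a = j.+1%:R * a by rewrite -natr1 mulrDl mul1r.
  exact: pj.
by apply: pj; rewrite j1 (leq_trans jk).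
Qed.

End finite_differences.

Section kernel_lower_bound.
Context {R : realType}.

Lemma size_gegenbauer_partial (l t : R) N : (size (gegenbauer_partial l t N) <= N.+1)%N.
Proof. exact: size_poly. Qed.

(** The subtracted polynomial is [1] at the origin, so by
[horner0_le_progression] it cannot be small at all of [L, 2 L, ..., (N + 1) L];
for [L] large the closed form is negligible at these points. *)
Lemma gegenbauer_rem_far e N : (0 < e)%N -> exists2 L : R, 1 <= L &
  forall t : R, `|t| <= 1 -> exists2 j, (1 <= j <= N.+1)%N &
    2^-1 ^+ N.+2 <= `|gegenbauer_rem (e%:R / 2) N.+1 t (j%:R * L)|.
Proof.
move=> e0.
(* At points beyond L the closed form is at most 2 ^- (N + 2), half of what the
   polynomial is known to reach. *)
pose L : R := 2 ^+ N.+2 + 1.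
have p2 : 1 <= 2 ^+ N.+2 :> R by rewrite exprn_ege1// ler1n.
exists L; first by rewrite /L lerDr (le_trans ler01).
move=> t t1; set l := e%:R / 2.
have [j jN pj] : exists2 j, (1 <= j <= N.+1)%N &
    2^-1 ^+ N.+1 < `|(gegenbauer_partial l t N).[j%:R * L]|.
  apply: contrapT => hn.
  have := @horner0_le_progression R N.+1 (gegenbauer_partial l t N) L (2^-1 ^+ N.+1)
    (size_gegenbauer_partial _ _ _).
  have -> : (gegenbauer_partial l t N).[0] = 1.
    by rewrite horner_coef0 coef_poly/= gegenbauer_poly0.
  rewrite normr1 exprVn mulrBl mul1r mulfV ?expf_neq0// => h.
  have {h} : 1 <= 1 - (2 ^+ N.+1)^-1 :> R.
    apply: h => j jN; rewrite leNgt; apply/negP => pj; apply: hn; exists j => //.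
    by rewrite exprVn.
  by rewrite lerBrDr gerDl leNgt invr_gt0 exprn_gt0.
exists j => //.
set s := j%:R * L in pj *.
have Ls : L <= s.
  by rewrite ler_peMl ?ler1n//; [rewrite /L; lra|case/andP: jN].
have sm1 : 0 < s - 1 by rewrite subr_gt0 (lt_le_trans _ Ls)// /L; lra.
have q1 : (s - 1) ^+ 2 <= 1 - 2 * t * s + s ^+ 2.
  have -> : (s - 1) ^+ 2 = 1 - 2 * s + s ^+ 2 by ring.
  rewrite lerD2r lerD2l lerN2 -mulrA ler_wpM2l//.
  have s0 : 0 <= s by lra.
  by rewrite ler_piMl// (le_trans (ler_norm t)).
have kb : (1 - 2 * t * s + s ^+ 2) `^ (- l) <= 2^-1 ^+ N.+2.
  apply: (le_trans (powRN_half_le e sm1 q1)).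
  have s2 : 2 ^+ N.+2 <= s - 1 by rewrite lerBrDr.
  rewrite exprVn lef_pV2 ?posrE ?exprn_gt0// (le_trans s2)//.
  rewrite ler_eXnr// (le_trans p2)//.
rewrite /gegenbauer_rem -gegenbauer_partialE distrC.
rewrite (le_trans _ (lerB_dist _ _))// [X in _ - X]ger0_norm ?powR_ge0//.
have : 2^-1 ^+ N.+1 = 2^-1 ^+ N.+2 + 2^-1 ^+ N.+2 :> R by rewrite [in RHS]exprS; lra.
by move: pj kb; lra.
Qed.

End kernel_lower_bound.

Section kernel_lower_bound_half_space.
Context {R : realType} {d : nat}.
Implicit Types (x : 'rV[R]_d.+2) (y : 'rV[R]_d.+1).

(** Two regimes. If [cos (theta x)] is small, the kernel at the point below [x] is
exactly the gauge [|x| ^- e * sec (theta x) ^ e] and dwarfs the polynomial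
part, which is bounded there. Otherwise the secant is bounded and a point from
[gegenbauer_rem_far] on any ray will do. *)
Lemma kernel_rem_ge e N : (0 < e)%N -> exists c : R * R, [/\ 0 < c.1, 1 <= c.2 &
  forall x, half_space x -> exists y, [/\
    enorm x / 2 <= enorm y, enorm y <= c.2 * enorm x &
    c.1 * (enorm x ^- e * sec (theta x) ^+ e) <= `|kernel_rem e N.+1 x y|]].
Proof.
move=> e0; set l : R := e%:R / 2.
have l0 : 0 < l by rewrite divr_gt0 ?ltr0n.
have [L L1 HL] := @gegenbauer_rem_far R e N e0.
pose S : R := \sum_(m < N.+1) (4 * (l + 1)) ^+ m.
have S1 : 1 <= S.
  rewrite /S big_ord_recl expr0 lerDl; apply: sumr_ge0 => i _.
  by rewrite exprn_ge0//; lra.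
pose c0 : R := (2 * S)^-1.
have c00 : 0 < c0 by rewrite invr_gt0; lra.
exists (Num.min 2^-1 (2^-1 ^+ N.+2 * c0 ^+ e), N.+1%:R * L); split => /=.
- by rewrite lt_min invr_gt0 ltr0n/= mulr_gt0 ?exprn_gt0.
- by rewrite mulr_ege1// ler1n.
move=> x hx; have x0 := half_space_neq0 hx; have nx := enorm_gt0 x0.
have cx := cos_theta_gt0 hx.
have xe : 0 < enorm x ^- e by rewrite invr_gt0 exprn_gt0.
have se : 0 < sec (theta x) ^+ e by rewrite exprn_gt0// invr_gt0.
(* S bounds the polynomial part for s <= 1, and below c0 the inverse of the cosine
   is at least 2 S. *)
have [cc0|c0c] := lerP (cos (theta x)) c0.
  have c02 : cos (theta x) <= 2^-1.
    by rewrite (le_trans cc0)// lef_pV2 ?posrE; lra.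
  set s := enorm (bproj x) / enorm x.
  have s0 : 0 <= s by rewrite divr_ge0 ?enorm_ge0.
  have cs : cos (theta x) ^+ 2 = 1 - s ^+ 2.
    by rewrite /s -sin_theta// -(cos2Dsin2 (theta x)) addrK.
  have s1 : s <= 1 by rewrite ler_pdivrMr// mul1r enorm_bproj_le.
  have s2 : 2^-1 <= s.
    have c2 : cos (theta x) ^+ 2 <= 2^-1 ^+ 2 by rewrite lerXn2r ?nnegrE// ltW.
    rewrite -(@ler_pXn2r _ 2)// ?nnegrE//; move: c2; rewrite cs !expr2; lra.
  have b0 : enorm (bproj x) != 0.
    by apply: contraTneq s2 => h; rewrite /s h mul0r -ltNge.
  have Ts : Theta x (bproj x) = s.
    rewrite ThetaE// -enorm_sqr /s; field.
    by rewrite b0 gt_eqF.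
  exists (bproj x); split.
  - by rewrite -ler_pdivlMl// [_^-1 * _]mulrC -/s.
  - by rewrite (le_trans (enorm_bproj_le x))// ler_peMl ?enorm_ge0// mulr_ege1// ler1n.
  rewrite kernel_remE// normrM [`|enorm x ^- e|]gtr0_norm// mulrCA ler_wpM2l ?(ltW xe)//.
  rewrite Ts -/s /gegenbauer_rem.
  have -> : 1 - 2 * s * s + s ^+ 2 = cos (theta x) ^+ 2 by rewrite cs; ring.
  rewrite powR_sqr_half//.
  apply: le_trans (lerB_dist _ _).
  rewrite [X in _ <= X - _]gtr0_norm ?invr_gt0 ?exprn_gt0//.
  have SB : `|\sum_(m < N.+1) gegenbauer_poly l m s * s ^+ m| <= S.
    apply: (le_trans (ler_norm_sum _ _ _)); apply: ler_sum => m _.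
    rewrite normrM (le_trans (ler_piMr _ _))//.
      by rewrite normrX ger0_norm// exprn_ile1.
    by rewrite gegenbauer_poly_le// ger0_norm.
  have ce : 2 * S <= cos (theta x) ^- e.
    apply: (@le_trans _ _ (cos (theta x))^-1).
      by rewrite -[2 * S]invrK lef_pV2 ?posrE.
    rewrite -exprVn ler_eXnr//; rewrite invf_ge1//; lra.
  have -> : sec (theta x) ^+ e = cos (theta x) ^- e by rewrite /sec exprVn.
  apply: (@le_trans _ _ (2^-1 * cos (theta x) ^- e)).
    by rewrite ler_wpM2r ?invr_ge0 ?exprn_ge0 ?(ltW cx)// ge_min lexx.
  move: SB ce; rewrite -/l; lra.
pose u : 'rV[R]_d.+1 := delta_mx ord0 ord0.
have u1 : enorm u = 1.
  rewrite /enorm /dot (bigD1 ord0)//= big1 ?addr0.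
    by rewrite mxE !eqxx/= mulr1 sqrtr1.
  by move=> i /negbTE h; rewrite mxE h andbF mul0r.
have [j jN Hj] := HL _ (Theta_le1 x u).
have jL : 0 < j%:R * L by rewrite mulr_gt0 ?ltr0n//; [case/andP: jN|lra].
pose y := (j%:R * L * enorm x) *: u.
have ny : enorm y = j%:R * L * enorm x.
  by rewrite enormZ u1 mulr1 gtr0_norm// mulr_gt0.
have Ty : Theta x y = Theta x u.
  rewrite !ThetaE// ny u1 dotC dotZl dotC; field; rewrite gt_eqF//=.
  by move: (gt_eqF jL) => /negbT; rewrite mulf_eq0 negb_or andbC.
have j1 : 1 <= j%:R :> R by rewrite ler1n; case/andP: jN.
exists y; split.
- rewrite ny mulrC ler_wpM2r ?(ltW nx)//.
  by rewrite (@le_trans _ _ 1)// ?mulr_ege1// invf_le1// ler1n.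
- rewrite ny ler_wpM2r ?(ltW nx)// ler_wpM2r//; first lra.
  by rewrite ler_nat; case/andP: jN.
rewrite kernel_remE// normrM [`|enorm x ^- e|]gtr0_norm// mulrCA ler_wpM2l ?(ltW xe)//.
rewrite Ty ny mulfK ?gt_eqF// (le_trans _ Hj)//.
apply: (@le_trans _ _ (2^-1 ^+ N.+2 * c0 ^+ e * sec (theta x) ^+ e)).
  by rewrite ler_wpM2r ?(ltW se)// ge_min lexx orbT.
rewrite -mulrA ler_piMr ?exprn_ge0// -exprMn exprn_ile1//.
  by apply: mulr_ge0; [exact: ltW|rewrite /sec invr_ge0 ltW].
by rewrite /sec ler_pdivrMr// mul1r ltW.
Qed.

End kernel_lower_bound_half_space.

(** * Continuous test functions *)

Section continuity.
Context {R : realType}.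

Variable T : topologicalType.
Implicit Types (F G : T -> R).

Lemma continuous_RD F G : continuous F -> continuous G ->
  continuous (fun y => F y + G y).
Proof. by move=> cF cG y; apply: continuousD; [exact: cF|exact: cG]. Qed.

Lemma continuous_RB F G : continuous F -> continuous G ->
  continuous (fun y => F y - G y).
Proof. by move=> cF cG y; apply: continuousB; [exact: cF|exact: cG]. Qed.

Lemma continuous_RM F G : continuous F -> continuous G ->
  continuous (fun y => F y * G y).
Proof. by move=> cF cG y; apply: continuousM; [exact: cF|exact: cG]. Qed.

Lemma continuous_RX F k : continuous F -> continuous (fun y => F y ^+ k).
Proof.
move=> cF y; apply: (@continuous_comp _ _ _ F (fun a : R => a ^+ k)); first exact: cF.
exact: exprn_continuous.
Qed.

Lemma continuous_Rsum I (s : seq I) (H : I -> T -> R) :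
  (forall i, continuous (H i)) -> continuous (fun y => \sum_(i <- s) H i y).
Proof.
move=> cH; elim: s => [|i s IH].
  by under eq_fun do rewrite big_nil; exact: cst_continuous.
by under eq_fun do rewrite big_cons; exact: continuous_RD.
Qed.

End continuity.

Section continuity_half_space.
Context {R : realType} {d : nat}.
Implicit Types (x : 'rV[R]_d.+1) (y b : 'rV[R]_d).

Lemma continuous_coordR (i : 'I_d) : continuous (fun y : 'rV[R]_d => y ord0 i : R).
Proof. exact: coord_continuous. Qed.

Lemma continuous_dot b : continuous (dot b).
Proof.
apply: continuous_Rsum => i; apply: continuous_RM; first exact: cst_continuous.
exact: continuous_coordR.
Qed.

Lemma continuous_enorm : continuous (@enorm R d).
Proof.
move=> y; apply: continuous_comp; last exact: sqrt_continuous.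
by apply: continuous_Rsum => i; apply: continuous_RM; exact: continuous_coordR.
Qed.

Lemma continuous_moment l m x : 0 < l -> x != 0 ->
  continuous (fun y => enorm y ^+ m * gegenbauer m l (Theta x y)).
Proof.
move=> l0 x0; rewrite (funext (fun y => gegenbauer_moment m y l0 x0)).
rewrite /gegenbauer_form; apply: continuous_Rsum => k.
apply: continuous_RM; last by do 2 apply: continuous_RX; exact: continuous_enorm.
apply: continuous_RM; first exact: cst_continuous.
apply: continuous_RX; apply: continuous_RM; last exact: cst_continuous.
exact: continuous_dot.
Qed.

Lemma continuous_poisson_kernel (l : R) x : half_space x ->
  continuous (poisson_kernel l x).
Proof.
move=> hx y; rewrite /poisson_kernel.
apply: (@continuous_comp _ _ _ (fun z : 'rV[R]_d => enorm (z - bproj x) ^+ 2 + height x ^+ 2 : R)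
  (fun a : R => a `^ (- l))).
  apply: continuous_RD; last exact: cst_continuous.
  under eq_fun do rewrite enormB_sqr.
  apply: continuous_RD; last exact: cst_continuous.
  apply: continuous_RB; first by apply: continuous_RX; exact: continuous_enorm.
  by apply: continuous_RM; [exact: cst_continuous|exact: continuous_dot].
apply/differentiable_continuous/derivable1_diffP/derivable_powR.
by rewrite in_itv/= andbT ltr_wpDl ?sqr_ge0// exprn_gt0.
Qed.

Lemma continuous_kernel_rem e M x : (0 < e)%N -> half_space x ->
  continuous (kernel_rem e M x).
Proof.
move=> e0 hx; apply: continuous_RB; first exact: continuous_poisson_kernel.
apply: continuous_Rsum => m; apply: continuous_RM; first exact: cst_continuous.
by apply: continuous_moment; rewrite ?divr_gt0 ?ltr0n ?half_space_neq0.
Qed.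

End continuity_half_space.

Section tent_functions.
Context {R : realType} {d : nat}.
Implicit Types (y : 'rV[R]_d) (k g : 'rV[R]_d -> R) (M : nat).

Lemma enorm_le_sup y (h : R) : 0 <= h -> (forall i, `|y ord0 i| <= h) ->
  enorm y <= d%:R * h.
Proof.
move=> h0 yh; rewrite -(@ler_pXn2r _ 2)// ?nnegrE ?mulr_ge0 ?enorm_ge0//.
rewrite enorm_sqr exprMn /dot.
apply: (@le_trans _ _ (\sum_(i < d) h ^+ 2)).
  apply: ler_sum => i _; rewrite -expr2 -[leLHS]ger0_norm ?sqr_ge0// normrX.
  by rewrite lerXn2r ?nnegrE.
rewrite sumr_const card_ord -[leLHS]mulr_natl ler_wpM2r ?sqr_ge0//.
by rewrite -natrX ler_nat; case: (d) => // d'; rewrite leq_pmull.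
Qed.

Lemma enormD_le y z : enorm (y + z) <= enorm y + enorm z.
Proof.
rewrite -(@ler_pXn2r _ 2)// ?nnegrE ?addr_ge0 ?enorm_ge0//.
have := enormB_sqr y (- z); rewrite opprK => ->.
rewrite -[- z]scaleN1r dotZl enormZ normrN1 mul1r sqrrD lerD2r lerD2l.
have := le_trans (ler_norm _) (dot_le y z); rewrite dotC mulr2n; lra.
Qed.

Definition box y (h : R) : set 'rV[R]_d :=
  [set v | forall i, `[y ord0 i - h, y ord0 i + h]%classic (v ord0 i)].

Lemma measurable_box y h : measurable (box y h).
Proof.
rewrite (_ : box y h = \big[setI/setT]_(j < d)
    ((fun v : 'rV[R]_d => v ord0 j) @^-1` `[y ord0 j - h, y ord0 j + h]%classic)).
  apply: bigsetI_measurable => j _; rewrite -[X in measurable X]setTI.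
  exact: measurable_coord.
apply/seteqP; split=> v /=.
  by move=> Av; elim/big_ind : _ => [//|B C Bv Cv|j _]; [by split|exact: Av].
by move=> Av j; move: Av; rewrite (bigD1 j)//= => -[].
Qed.

Lemma measurable_lebesgue_box y h : measurable (box y h : set (lebesgue_space R d)).
Proof. by apply: sub_caratheodory; apply: sub_sigma_algebra; exact: measurable_box. Qed.

Lemma lebesgue_box y (h : R) : 0 < h -> lebesgue R d (box y h) = ((2 * h) ^+ d)%:E.
Proof.
move=> h0; transitivity (borel_lebesgue R d (box y h)).
  exact: (measurable_mu_extE (borel_lebesgue R d) (measurable_box y h)).
rewrite /box (borel_lebesgue_box (A := fun i => `[y ord0 i - h, y ord0 i + h]%classic))//.
transitivity (\prod_(i < d) (2 * h)%:E)%E.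
  apply: eq_bigr => i _; rewrite lebesgue_measure_itv/= lte_fin ifT; last lra.
  by rewrite -EFinB; congr _%:E; ring.
by rewrite prodEFin prodr_const card_ord.
Qed.

Lemma lebesgue_integrable_indic y (h : R) : 0 < h ->
  lebesgue_integrable (\1_(box y h) : 'rV[R]_d -> R).
Proof.
move=> h0; have mb := measurable_lebesgue_box y h; apply/integrableP; split.
  by apply/measurable_EFinP; exact: measurable_indic.
rewrite (_ : (fun _ => _) = (fun v : lebesgue_space R d => (\1_(box y h) v)%:E)).
  by rewrite integral_indic// setIT lebesgue_box// ltry.
by apply/funext => v /=; rewrite ger0_norm.
Qed.

Lemma Rintegral_indic_box y (h : R) : 0 < h ->
  \int[lebesgue R d]_v (\1_(box y h) v) = (2 * h) ^+ d.
Proof.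
move=> h0; have mb := measurable_lebesgue_box y h.
by rewrite /Rintegral integral_indic// setIT lebesgue_box.
Qed.

Definition tent y0 (h : R) y : R := Num.max 0 (h - enorm (y - y0)).

Lemma tent_ge0 y0 h y : 0 <= tent y0 h y.
Proof. by rewrite le_max lexx. Qed.

Lemma tent_far y0 h y : h <= enorm (y - y0) -> tent y0 h y = 0.
Proof. by move=> hy; apply/max_l; rewrite subr_le0. Qed.

Lemma continuous_tent y0 h : continuous (tent y0 h).
Proof.
move=> y; rewrite /tent.
apply: (@continuous_max R 'rV[R]_d (fun=> 0) (fun z => h - enorm (z - y0))).
  exact: cst_continuous.
apply: continuous_RB; first exact: cst_continuous.
move=> z; apply: (@continuous_comp _ _ _ (fun z : 'rV[R]_d => z - y0) (@enorm R d)).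
  by apply: continuousB; [exact: cvg_id|exact: cst_continuous].
exact: continuous_enorm.
Qed.

Lemma lebesgue_measurable_tent y0 h : lebesgue_measurable (tent y0 h).
Proof.
apply: measurable_maxr; first exact: measurable_cst.
apply: measurable_funB; first exact: measurable_cst.
have -> : (fun z : 'rV[R]_d => enorm (z - y0)) =
    (fun z => Num.sqrt (enorm z ^+ 2 - 2 * dot y0 z + enorm y0 ^+ 2)).
  by apply/funext => z; rewrite -enormB_sqr sqrtr_sqr ger0_norm ?enorm_ge0.
apply: (@measurableT_comp _ _ _ _ _ _ (@Num.sqrt R)).
  by apply: continuous_measurable_fun; exact: sqrt_continuous.
apply: measurable_funD; last exact: measurable_cst.
apply: measurable_funB; first exact: lebesgue_measurable_enormX.
by apply: measurable_funM; [exact: measurable_cst|exact: lebesgue_measurable_dot].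
Qed.

Lemma lebesgue_integrable_tent y0 (h : R) : 0 < h -> lebesgue_integrable (tent y0 h).
Proof.
move=> h0; apply: (lebesgue_integrable_le (lebesgue_measurable_tent y0 h) _
  (lebesgue_integrableZ h (lebesgue_integrable_indic y0 h0))) => y.
rewrite ger0_norm ?tent_ge0// normrM (gtr0_norm h0).
have [hy|yh] := lerP h (enorm (y - y0)); first by rewrite tent_far// mulr_ge0// ltW.
rewrite indicE mem_set ?normr1 ?mulr1.
  by rewrite ge_max (ltW h0)/= gerBl enorm_ge0.
move=> i /=; rewrite in_itv/=.
have := coord_le_enorm (y - y0) i; rewrite !mxE ler_norml => /andP[h1 h2].
by apply/andP; split; lra.
Qed.

Lemma Rintegral_tent_gt0 y0 (h : R) : 0 < h ->
  0 < \int[lebesgue R d]_y (tent y0 h y).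
Proof.
move=> h0.
(* The cube of half-side eta lies in the ball of radius h / 2, where the tent is
   at least h / 2. *)
pose eta : R := h / (2 * d.+1%:R).
have d1 : 0 < d.+1%:R :> R by rewrite ltr0n.
have eta0 : 0 < eta by rewrite divr_gt0// mulr_gt0.
have := le_Rintegral measurableT
  (lebesgue_integrableZ (h / 2) (lebesgue_integrable_indic y0 eta0))
  (lebesgue_integrable_tent y0 h0).
move=> H; apply: (lt_le_trans _ (H _)).
  rewrite Rintegral_lebesgueZ ?Rintegral_indic_box//; last exact: lebesgue_integrable_indic.
  by rewrite mulr_gt0 ?exprn_gt0 ?mulr_gt0 ?divr_gt0.
move=> y _ /=; rewrite indicE; case: (boolP (y \in box y0 eta)) => yb; last first.
  by rewrite mulr0 tent_ge0.
rewrite mulr1 le_max; apply/orP; right.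
have : enorm (y - y0) <= d%:R * eta.
  apply: enorm_le_sup; first exact: ltW.
  move=> i; move/set_mem : yb => /(_ i)/=; rewrite in_itv/= => /andP[h1 h2].
  by rewrite !mxE ler_norml; apply/andP; split; lra.
have : d%:R * eta <= h / 2.
  have -> : h / 2 = d.+1%:R * eta.
    by rewrite /eta; field; rewrite nat1r gt_eqF.
  by rewrite ler_wpM2r ?(ltW eta0)// ler_nat.
lra.
Qed.

(** A narrow tent around [y0], normalised so that its weighted norm is at most
[1]; on its support [k] keeps its sign and at least half of its size. *)
Lemma concentrated_test_function k M y0 (rho : R) : 0 < rho <= 1 ->
  {for y0, continuous k} -> lebesgue_measurable k -> k y0 != 0 ->
  exists g, [/\ continuous g, lebesgue_measurable g,
    forall y, rho <= enorm (y - y0) -> g y = 0,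
    (\int[lebesgue R d]_y (`|g y| * weight M y)%:E <= 1%:E)%E &
    `|k y0| / (2 * ((enorm y0 + 1) ^+ (M - 1) + 1)) <=
    `|\int[lebesgue R d]_y (g y * k y)| ].
Proof.
move=> /andP[rho0 rho1] ck mk k0; have nk : 0 < `|k y0| by rewrite normr_gt0.
have [h h0 [hr hk]] : exists2 h : R, 0 < h & h <= rho /\
    forall y, enorm (y - y0) < h -> `|k y0 - k y| <= `|k y0| / 2.
  have /cvgrPdist_le /(_ (`|k y0| / 2)) := ck.
  rewrite divr_gt0// => /(_ isT) /nbhs_ballP [h /= h0 hb].
  exists (Num.min h rho); first by rewrite lt_min h0.
  split; first by rewrite ge_min lexx orbT.
  move=> y; rewrite lt_min => /andP[yh _]; apply: hb.
  split=> // i j; rewrite ord1 /ball/= distrC.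
  by have := coord_le_enorm (y - y0) j; rewrite !mxE => /le_lt_trans; apply.
pose W : R := (enorm y0 + 1) ^+ (M - 1) + 1.
have W0 : 0 < W by rewrite ltr_wpDl// exprn_ge0// addr_ge0// enorm_ge0.
pose I := \int[lebesgue R d]_y (tent y0 h y).
have I0 : 0 < I := Rintegral_tent_gt0 y0 h0.
have ib := lebesgue_integrable_tent y0 h0.
pose c := (I * W)^-1; have c0 : 0 < c by rewrite invr_gt0 mulr_gt0.
have near y : tent y0 h y != 0 -> enorm (y - y0) < h.
  by apply: contra_neqT; rewrite -leNgt; exact: tent_far.
exists (fun y => c * tent y0 h y); split.
- by apply: continuous_RM; [exact: cst_continuous|exact: continuous_tent].
- by apply: measurable_funM; [exact: measurable_cst|exact: lebesgue_measurable_tent].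
- by move=> y yr; rewrite tent_far ?mulr0// (le_trans hr).
- have icb : lebesgue_integrable (fun y => (c * W) * tent y0 h y).
    exact: lebesgue_integrableZ.
  apply: (@le_trans _ _ (\int[lebesgue R d]_y ((c * W) * tent y0 h y)%:E)%E).
    apply: ge0_le_integral => //.
    + by move=> y _; rewrite lee_fin mulr_ge0// ltW// weight_gt0.
    + apply/measurable_EFinP; apply: measurable_funM; last exact: lebesgue_measurable_weight.
      apply: (@measurableT_comp _ _ _ _ _ _ (@Num.norm R R)); first exact: normr_measurable.
      by apply: measurable_funM; [exact: measurable_cst|exact: lebesgue_measurable_tent].
    + by apply/measurable_EFinP; exact: lebesgue_integrable_measurable icb.
    move=> y _; rewrite lee_fin ger0_norm ?mulr_ge0 ?tent_ge0 ?(ltW c0)//.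
    rewrite mulrAC; have [->|/near yh] := eqVneq (tent y0 h y) 0; first by rewrite !mulr0.
    rewrite ler_wpM2r ?tent_ge0// ler_wpM2l ?(ltW c0)// /weight /W lerD2r.
    rewrite lerXn2r ?nnegrE ?addr_ge0 ?enorm_ge0//.
    rewrite -[y in leLHS](subrK y0) addrC (le_trans (enormD_le _ _))// lerD2l.
    by rewrite (le_trans (ltW yh))// (le_trans hr).
  rewrite -[leLHS]fineK; last exact: (integrable_fin_num _ icb).
  rewrite lee_fin -/(Rintegral _ _ _) Rintegral_lebesgueZ// -/I /c.
  by rewrite le_eqVlt; apply/orP; left; apply/eqP; field; rewrite !gt_eqF.
(* Multiplying by the sign of k at the centre makes the integrand nonnegative. *)
pose sg := Num.sg (k y0).
have sgk y : enorm (y - y0) < h -> `|k y0| / 2 <= sg * k y.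
  move=> /hk; have : sg * k y0 = `|k y0| by rewrite normrEsg.
  have : `|sg * k y0 - sg * k y| <= `|k y0 - k y|.
    by rewrite -mulrBr normrM ler_piMl// /sg normr_sg lern1 leq_b1.
  rewrite ler_norml => /andP[_ h1] h2 h3; lra.
have kbnd y : enorm (y - y0) < h -> `|k y| <= 2 * `|k y0|.
  move=> /hk hy; have := ler_normD (k y0) (k y - k y0).
  by rewrite addrCA subrr addr0 distrC; lra.
have isk : lebesgue_integrable (fun y => c * tent y0 h y * k y).
  apply: (lebesgue_integrable_le _ _ (lebesgue_integrableZ (c * (2 * `|k y0|)) ib)).
    apply: measurable_funM; last exact: mk.
    by apply: measurable_funM; [exact: measurable_cst|exact: lebesgue_measurable_tent].
  move=> y; rewrite !normrM !normr_id (gtr0_norm c0) ger0_norm ?tent_ge0//.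
  have [->|/near yh] := eqVneq (tent y0 h y) 0; first by rewrite !mulr0 mul0r.
  rewrite mulrAC ler_wpM2r ?tent_ge0// ler_wpM2l ?(ltW c0)//.
  by rewrite (ger0_norm (_ : 0 <= 2))// kbnd.
have sg1 : `|sg| = 1 by rewrite /sg normr_sg k0.
rewrite -[leRHS]mul1r -[X in _ <= X * _]sg1 -normrM -Rintegral_lebesgueZ//.
rewrite (le_trans _ (ler_norm _))//.
apply: (@le_trans _ _ (\int[lebesgue R d]_y (c * (`|k y0| / 2) * tent y0 h y))).
  rewrite Rintegral_lebesgueZ// -/I -/W /c.
  by rewrite le_eqVlt; apply/orP; left; apply/eqP; field; rewrite !gt_eqF.
apply: le_Rintegral => //; first exact: (lebesgue_integrableZ _ ib).
  exact: (lebesgue_integrableZ _ isk).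
move=> y _; have [->|/near yh] := eqVneq (tent y0 h y) 0; first by rewrite !(mulr0, mul0r).
have -> : sg * (c * tent y0 h y * k y) = c * tent y0 h y * (sg * k y) by ring.
by rewrite mulrAC ler_wpM2l ?sgk// mulr_ge0 ?tent_ge0 ?(ltW c0).
Qed.

End tent_functions.

(** * The gliding hump *)

Section weighted_norm.
Context {R : realType} {d : nat}.
Implicit Types (f g h : 'rV[R]_d -> R) (M : nat).

Definition wnorm M f : \bar R :=
  (\int[lebesgue R d]_y (`|f y| * weight M y)%:E)%E.

Lemma measurable_wnorm M f : lebesgue_measurable f ->
  measurable_fun [set: lebesgue_space R d]
    (fun y : lebesgue_space R d => (`|f y| * weight M y)%:E).
Proof.
move=> mf; apply/measurable_EFinP; apply: measurable_funM.
  by apply: (@measurableT_comp _ _ _ _ _ _ (@Num.norm R R)); [exact: normr_measurable|exact: mf].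
exact: lebesgue_measurable_weight.
Qed.

Lemma admissibleP M f : admissible M f <-> lebesgue_measurable f /\ (wnorm M f < +oo)%E.
Proof. by []. Qed.

Lemma wnorm_integrand_ge0 M (r : R) (y : 'rV[R]_d) : 0 <= `|r| * weight M y.
Proof. by rewrite mulr_ge0// ltW// weight_gt0. Qed.

Lemma wnorm0 M : wnorm M (fun=> 0) = 0%E.
Proof.
by rewrite /wnorm; under eq_integral do rewrite normr0 mul0r; rewrite integral0.
Qed.

Lemma wnormD_le M f g (a b : R) : lebesgue_measurable f -> lebesgue_measurable g ->
  (wnorm M f <= a%:E)%E -> (wnorm M g <= b%:E)%E ->
  (wnorm M (fun y => f y + g y)%R <= (a + b)%R%:E)%E.
Proof.
move=> mf mg fa gb; rewrite EFinD; apply: le_trans (leeD fa gb).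
rewrite /wnorm -ge0_integralD//.
- apply: ge0_le_integral => //.
  + by move=> y _; rewrite lee_fin wnorm_integrand_ge0.
  + apply: measurable_wnorm; apply: measurable_funD; [exact: mf|exact: mg].
  + by apply: emeasurable_funD; exact: measurable_wnorm.
  + move=> y _; rewrite -EFinD lee_fin -mulrDl ler_wpM2r ?ler_normD//.
    by rewrite ltW// weight_gt0.
- by move=> y _; rewrite lee_fin wnorm_integrand_ge0.
- exact: measurable_wnorm.
- by move=> y _; rewrite lee_fin wnorm_integrand_ge0.
- exact: measurable_wnorm.
Qed.

Lemma wnormZ_le M f (c a : R) : lebesgue_measurable f ->
  (wnorm M f <= a%:E)%E -> (wnorm M (fun y => c * f y)%R <= (`|c| * a)%R%:E)%E.
Proof.
move=> mf fa; rewrite /wnorm.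
have -> : (\int[lebesgue R d]_y (`|c * f y| * weight M y)%R%:E)%E = (`|c|%R%:E * wnorm M f)%E.
  transitivity (\int[lebesgue R d]_y (`|c|%R%:E * (`|f y| * weight M y)%R%:E))%E.
    by apply: eq_integral => y _; rewrite normrM -EFinM mulrA.
  apply: (@ge0_integralZl_EFin _ _ _ (lebesgue R d) setT measurableT
    (fun y => (`|f y| * weight M y)%:E)).
  - by move=> y _; rewrite lee_fin wnorm_integrand_ge0.
  - exact: measurable_wnorm.
  - exact: normr_ge0.
by rewrite EFinM lee_wpmul2l.
Qed.

Lemma admissible_le M f (a : R) : lebesgue_measurable f -> (wnorm M f <= a%:E)%E ->
  admissible M f.
Proof. by move=> mf fa; split=> //; rewrite (le_lt_trans fa)// ltry. Qed.

Lemma Rintegral_kernel_le M f (K : 'rV[R]_d -> R) (A a : R) : lebesgue_measurable f ->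
  (wnorm M f <= a%:E)%E -> lebesgue_measurable K ->
  (forall y, `|K y| <= A * weight M y) -> 0 <= A ->
  `|\int[lebesgue R d]_y (f y * K y)| <= A * a.
Proof.
move=> mf fa mK KA A0; have fM := admissible_le mf fa.
have iw := lebesgue_integrable_norm (admissible_weight fM).
have iK := admissible_integrable fM mK KA.
rewrite (le_trans (le_normr_Rintegral _ iK))//.
apply: (@le_trans _ _ (\int[lebesgue R d]_y (A * `|f y * weight M y|))).
  apply: le_Rintegral => //; first exact: (lebesgue_integrable_norm iK).
    exact: (lebesgue_integrableZ _ iw).
  move=> y _; rewrite !normrM mulrCA ler_wpM2l// (le_trans (KA y))//.
  by rewrite ler_wpM2l// ler_norm.
rewrite Rintegral_lebesgueZ// ler_wpM2l// -lee_fin.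
apply: le_trans fa; rewrite /Rintegral fineK; last exact: (integrable_fin_num _ iw).
rewrite le_eqVlt; apply/orP; left; apply/eqP; apply: eq_integral => y _.
by rewrite normrM (gtr0_norm (weight_gt0 M y)).
Qed.

End weighted_norm.

Section gliding_hump.
Context {R : realType} {d : nat} (M : nat).
Variables (K g : nat -> 'rV[R]_d -> R) (A rho : nat -> R).
Hypothesis mK : forall i, lebesgue_measurable (K i).
Hypothesis KA : forall i y, `|K i y| <= A i * weight M y.
Hypothesis A0 : forall i, 0 <= A i.
Hypothesis cg : forall i, continuous (g i).
Hypothesis mg : forall i, lebesgue_measurable (g i).
Hypothesis g1 : forall i, (wnorm M (g i) <= 1%:E)%E.
Hypothesis g0 : forall i y, enorm y <= rho i -> g i y = 0.
Hypothesis rhoy : rho i @[i --> \oo] --> +oo.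

Let pair i f : R := \int[lebesgue R d]_y (f y * K i y).

Hypothesis gK : `|pair i (g i)| @[i --> \oo] --> +oo.

(** An index at which the next hump can be placed: the humps chosen so far are
no longer seen, the new one is, and it lives outside the ball of radius [k]. *)
Let good (s : 'rV[R]_d -> R) (eps : R) (k i : nat) : Prop :=
  [/\ (k <= i)%N, `|pair i s| <= 1, 3 <= eps * `|pair i (g i)| & k%:R <= rho i].

Let pick s eps k : nat := xget 0%N [set i | good s eps k i].

Let step (k : nat) (se : ('rV[R]_d -> R) * R) : ('rV[R]_d -> R) * R :=
  let i := pick se.1 se.2 k in
  (fun y => se.1 y + se.2 * g i y, se.2 / (2 * (1 + A i))).

(** The sum of the humps chosen so far, with the height allowed to the next
one. Dividing by [2 * (1 + A i)] makes the total of all later humps too small to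
be felt at index [i]. *)
Fixpoint hump_state k : ('rV[R]_d -> R) * R :=
  if k is k'.+1 then step k' (hump_state k') else (fun=> 0, 1).

Let s k := (hump_state k).1.
Let eps k := (hump_state k).2.
Let idx k := pick (s k) (eps k) k.

Let sS k y : s k.+1 y = s k y + eps k * g (idx k) y.
Proof. by []. Qed.

Let epsS k : eps k.+1 = eps k / (2 * (1 + A (idx k))).
Proof. by []. Qed.

Let A2 i : 0 < 2 * (1 + A i). Proof. by rewrite mulr_gt0// ltr_wpDr. Qed.

Let eps_gt0 k : 0 < eps k.
Proof. by elim: k => [|k IH]; [exact: ltr01|rewrite epsS divr_gt0]. Qed.

Let eps_half k : eps k.+1 <= eps k / 2.
Proof.
rewrite epsS ler_wpM2l ?(ltW (eps_gt0 k))// lef_pV2 ?posrE//.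
by rewrite ler_peMr// lerDl.
Qed.

Let eps_le1 k : eps k <= 1.
Proof. by elim: k => [//|k IH]; have := eps_half k; have := eps_gt0 k; lra. Qed.

Let cs k : continuous (s k).
Proof.
elim: k => [|k IH]; first exact: cst_continuous.
apply: continuous_RD; first exact: IH.
by apply: continuous_RM; [exact: cst_continuous|exact: cg].
Qed.

Let ms k : lebesgue_measurable (s k).
Proof.
elim: k => [|k IH]; first exact: measurable_cst.
apply: measurable_funD; first exact: IH.
by apply: measurable_funM; [exact: measurable_cst|exact: mg].
Qed.

(** The heights at least halve at each step, so the remaining humps together
have norm at most twice the next height. *)
Let diff_norm k m : (wnorm M (fun y => s (k + m)%N y - s k y)%R <= (2 * eps k - 2 * eps (k + m)%N)%R%:E)%E.
Proof.
elim: m => [|m IH].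
  rewrite addn0 subrr (_ : (fun y => _) = (fun=> 0)) ?wnorm0//.
  by apply/funext => y; rewrite subrr.
have h := wnormZ_le (eps (k + m)) (mg (idx (k + m))) (g1 (idx (k + m))).
have md : lebesgue_measurable (fun y => s (k + m) y - s k y).
  by apply: measurable_funB; exact: ms.
have mh : lebesgue_measurable (fun y => eps (k + m) * g (idx (k + m)) y).
  by apply: measurable_funM; [exact: measurable_cst|exact: mg].
have := wnormD_le md mh IH h.
rewrite (_ : (fun y => _) = (fun y => s (k + m.+1) y - s k y)); last first.
  by apply/funext => y; rewrite addnS sS addrAC.
move=> /le_trans; apply; rewrite lee_fin mulr1 gtr0_norm// addnS.
by have := eps_half (k + m); lra.
Qed.

Section all_pairings_vanish.
Hypothesis vanish : forall f, continuous f -> admissible M f ->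
  pair i f @[i --> \oo] --> (0 : R).

Let s_admissible k : admissible M (s k).
Proof.
apply: (@admissible_le _ _ _ _ 2) => //.
have := diff_norm 0 k; rewrite add0n (_ : (fun y => _) = s k); last first.
  by apply/funext => y; rewrite subr0.
move=> /le_trans; apply; rewrite lee_fin; have := eps_gt0 k.
by rewrite (_ : eps 0%N = 1)//; lra.
Qed.

Let idx_good k : good (s k) (eps k) k (idx k).
Proof.
have h1 : \forall i \near \oo, `|pair i (s k)| <= 1.
  have /cvgrPdist_le /(_ 1 ltr01) := vanish (@cs k) (s_admissible k).
  by apply: filterS => i; rewrite sub0r normrN.
have h2 : \forall i \near \oo, 3 / eps k <= `|pair i (g i)|.
  by have /cvgryPge := gK; apply.
have h3 : \forall i \near \oo, k%:R <= rho i.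
  by have /cvgryPge := rhoy; apply.
have [i Pi] : exists i, good (s k) (eps k) k i.
  near \oo => i; exists i; split.
  - by near: i; exact: nbhs_infty_ge.
  - by near: i.
  - by rewrite mulrC -ler_pdivrMr//; near: i.
  - by near: i.
exact: (xgetI 0%N Pi).
Unshelve. all: by end_near. Qed.

Let s_stable k m y : enorm y <= k%:R -> s (k + m) y = s k y.
Proof.
move=> yk; elim: m => [|m IH]; first by rewrite addn0.
rewrite addnS sS IH g0 ?mulr0 ?addr0//.
have [_ _ _ h] := idx_good (k + m); rewrite (le_trans yk)// (le_trans _ h)//.
by rewrite ler_nat leq_addr.
Qed.

(** Later humps vanish on larger and larger balls, so near each point the
infinite sum is one of the partial sums; this makes it continuous. *)
Let f y := s (Num.truncn (enorm y)).+1 y.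

Let fE k y : enorm y <= k%:R -> f y = s k y.
Proof.
move=> yk; rewrite /f; set n := _.+1.
have yn : enorm y <= n%:R by rewrite ltW// truncnS_gt.
have [nk|kn] := leqP n k.
  by rewrite -(subnKC nk) s_stable.
by rewrite -(subnKC (ltnW kn)) s_stable.
Qed.

Let cvg_s y : s k y @[k --> \oo] --> f y.
Proof.
apply: cvg_near_cst; near=> k; apply/esym/fE.
near: k; have := @nbhs_infty_ger R (enorm y); exact.
Unshelve. all: by end_near. Qed.

Let cf : continuous f.
Proof.
move=> y; set k := (Num.truncn (enorm y)).+1.
have yk : enorm y < k%:R by rewrite truncnS_gt.
have near_eq : \forall z \near y, s k z = f z.
  have := @continuous_enorm R d y.
  move=> /cvgr_lt /(_ _ yk); apply: filterS => z zk; apply/esym/fE; exact: ltW.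
rewrite /continuous_at (fE (ltW yk)).
apply: cvg_trans (@cs k y); exact: near_eq_cvg near_eq.
Qed.

Let mf : lebesgue_measurable f.
Proof.
apply: (@measurable_fun_cvg _ (lebesgue_space R d) R setT s f); first exact: ms.
by move=> y _; exact: cvg_s.
Qed.

(** Fatou, for the pointwise limit of [diff_norm]. *)
Let tail_norm k : (wnorm M (fun y => f y - s k y)%R <= (2 * eps k)%R%:E)%E.
Proof.
pose u (m : nat) (y : lebesgue_space R d) : \bar R := (`|s (k + m) y - s k y| * weight M y)%:E.
have mu m : measurable_fun setT (u m).
  by apply: measurable_wnorm; apply: measurable_funB; exact: ms.
have u0 m y : setT y -> (0 <= u m y)%E.
  by move=> _; rewrite lee_fin wnorm_integrand_ge0.
have uE y : limn_einf (u ^~ y) = (`|f y - s k y| * weight M y)%:E.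
  apply: (cvg_limn_einf_sup _).1; apply: cvg_near_cst; near=> m.
  congr (`|_ - _| * _)%:E; apply/esym/fE.
  have h : enorm y <= m%:R by near: m; exact: nbhs_infty_ger.
  by rewrite (le_trans h)// ler_nat leq_addl.
rewrite /wnorm; under eq_integral do rewrite -uE.
apply: (le_trans (fatou _ measurableT mu u0)).
rewrite limn_einf_lim; apply: lime_le; first exact: is_cvg_einfs.
apply: nearW => m; apply: (@le_trans _ _ (\int[lebesgue R d]_y u m y)%E).
  by apply: ereal_inf_lbound; exists m => /=.
apply: (le_trans (diff_norm k m)); rewrite lee_fin; have := eps_gt0 (k + m); lra.
Unshelve. all: by end_near. Qed.

Let f_admissible : admissible M f.
Proof.
apply: (@admissible_le _ _ _ _ 2) => //.
have := tail_norm 0; rewrite (_ : (fun y => _) = f); last first.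
  by apply/funext => y; rewrite subr0.
by rewrite (_ : eps 0%N = 1)// mulr1.
Qed.

(** At the index of the [k]-th hump the earlier humps contribute at most [1], the
hump itself at least [3] and the later ones at most [1]. *)
Let pair_idx k : 1 <= `|pair (idx k) f|.
Proof.
have [_ p1 p2 _] := idx_good k; set i := idx k in p1 p2 *.
have mh : lebesgue_measurable (fun y => f y - s k.+1 y).
  by apply: measurable_funB; [exact: mf|exact: ms].
have h := Rintegral_kernel_le mh (tail_norm k.+1) (@mK i) (@KA i) (A0 i).
have h1 : A i * (2 * eps k.+1) <= 1.
  rewrite epsS -/i mulrCA mulrA.
  have -> : 2 * A i * (eps k / (2 * (1 + A i))) = eps k * (A i / (1 + A i)).
    by field; rewrite gt_eqF// ltr_wpDr.
  rewrite (le_trans _ (eps_le1 k))// ler_piMr ?(ltW (eps_gt0 k))//.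
  by rewrite ler_pdivrMr ?ltr_wpDr// mul1r lerDr.
have iE : pair i f = pair i (s k) + eps k * pair i (g i) +
    \int[lebesgue R d]_y ((f y - s k.+1 y) * K i y).
  have is1 := admissible_integrable (s_admissible k) (@mK i) (@KA i).
  have is2 := admissible_integrable (admissible_le (@mg i) (g1 i)) (@mK i) (@KA i).
  have is3 := admissible_integrable (admissible_le mh (tail_norm k.+1)) (@mK i) (@KA i).
  rewrite /pair -Rintegral_lebesgueZ// -Rintegral_lebesgueD//; last first.
    exact: lebesgue_integrableZ.
  rewrite -Rintegral_lebesgueD//; last first.
    by apply: lebesgue_integrableD => //; exact: lebesgue_integrableZ.
  by apply: eq_Rintegral => y _; rewrite sS; ring.
rewrite iE.
set a := pair i (s k) in p1 *; set b := pair i (g i) in p2 *.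
set c := \int[_]_y _ in h *.
have c1 : `|c| <= 1 by rewrite (le_trans h).
have b3 : 3 <= `|eps k * b| by rewrite normrM gtr0_norm.
have := lerB_dist (eps k * b) (- (a + c)); rewrite opprK normrN.
have := ler_normD a c.
have -> : eps k * b + (a + c) = a + eps k * b + c by ring.
lra.
Qed.

Lemma pairings_not_all_vanishing : False.
Proof.
have /cvgrPdist_lt /(_ 1 ltr01) [n _ /= hn] := vanish cf f_admissible.
have [ni _ _ _] := idx_good n.
have := hn _ ni; rewrite sub0r normrN ltNge => /negP; apply; exact: pair_idx.
Qed.

End all_pairings_vanish.

(** The uniform boundedness principle for the weighted norm, in a form that keeps
the limit function continuous: the unit functions [g i] on which the functionals
blow up escape to infinity, so a series of them is locally finite. *)
Lemma gliding_hump : exists f, [/\ continuous f, admissible M f &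
  ~ (\int[lebesgue R d]_y (f y * K i y) @[i --> \oo] --> (0 : R))].
Proof.
apply: contrapT => nof; apply: pairings_not_all_vanishing => f cf fM.
by apply: contrapT => nf; apply: nof; exists f.
Qed.

End gliding_hump.

(** * Sharpness *)

Section sharpness.
Context {R : realType} {d : nat}.
Implicit Types (f : 'rV[R]_d.+1 -> R) (x : 'rV[R]_d.+2) (y : 'rV[R]_d.+1).

Lemma kernel_rem_le_weight e N : (0 < e)%N -> exists2 C : R, 0 <= C &
  forall x y, half_space x ->
  `|kernel_rem e N.+1 x y| <= C * kernel_gauge e N.+1 x * weight N.+1 y.
Proof.
move=> e0; have [C C0 HC] := @kernel_rem_le R d.+1 e N e0; exists C => // x y hx.
rewrite (le_trans (HC x y hx))// ler_wpM2l ?(mulr_ge0 C0 (ltW (kernel_gauge_gt0 _ _ hx)))//.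
rewrite (le_trans _ (enormX_le_weight y (ltnSn N)))//.
by rewrite ler_piMr ?exprn_ge0 ?enorm_ge0// ge_min lexx.
Qed.

(** The ball carrying the test function is taken inside the shell
[|x| / 4 < |y|], so that these functions escape to infinity with [x]; for
[|x| >= 1] the weight at its centre is comparable to [|x| ^ N], which turns the
kernel bound into the gauge. *)
Lemma kernel_test_function e N : (0 < e)%N -> exists2 c : R, 0 < c &
  forall x, half_space x -> exists g, [/\ continuous g, lebesgue_measurable g,
    forall y, enorm y <= enorm x / 4 -> g y = 0,
    (wnorm N.+1 g <= 1%:E)%E &
    1 <= enorm x -> c * kernel_gauge e N.+1 x <= `|kernel_rem_integral e N.+1 g x| ].
Proof.
move=> e0; have [[c1 c2] /= [c10 c21 Hc]] := @kernel_rem_ge R d e N e0.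
have c20 : 0 < c2 + 1 by lra.
have [c cE] : exists c, c = c1 / (4 * (c2 + 1) ^+ N) by exists (c1 / (4 * (c2 + 1) ^+ N)).
have c0 : 0 < c by rewrite cE divr_gt0// mulr_gt0// exprn_gt0.
exists c => // x hx; have x0 := half_space_neq0 hx; have nx := enorm_gt0 x0.
have [y0 [y1 y2 Hy]] := Hc x hx.
have k1 : 0 < c1 * (enorm x ^- e * sec (theta x) ^+ e).
  by rewrite mulr_gt0// mulr_gt0 ?invr_gt0 ?exprn_gt0// invr_gt0 cos_theta_gt0.
pose r := Num.min 1 (enorm x / 4).
have r01 : 0 < r <= 1 by rewrite lt_min ltr01 divr_gt0//= ge_min lexx.
have ky0 : kernel_rem e N.+1 x y0 != 0.
  by rewrite -normr_gt0 (lt_le_trans k1).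
have [g [cg mg gr g1 gk]] := @concentrated_test_function R d.+1 _ N.+1 y0 r r01
  (@continuous_kernel_rem R d.+1 e N.+1 x e0 hx y0)
  (lebesgue_measurable_kernel_rem N.+1 e0 hx) ky0.
exists g; split => // [y yx|x1].
  apply: gr; rewrite (@le_trans _ _ (enorm x / 4))//; first by rewrite ge_min lexx orbT.
  have := enormD_le (y0 - y) y; rewrite subrK.
  have -> : enorm (y0 - y) = enorm (y - y0).
    by rewrite -opprB -scaleN1r enormZ normrN1 mul1r.
  lra.
apply: le_trans gk.
rewrite subn1/=; set W := _ ^+ N + 1.
have W0 : 0 < W by rewrite ltr_wpDl// exprn_ge0// addr_ge0// enorm_ge0.
have WN : W <= 2 * (c2 + 1) ^+ N * enorm x ^+ N.
  have xN : 1 <= (c2 + 1) ^+ N * enorm x ^+ N.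
    by rewrite mulr_ege1// exprn_ege1//; lra.
  have : (enorm y0 + 1) ^+ N <= (c2 + 1) ^+ N * enorm x ^+ N.
    rewrite -exprMn lerXn2r ?nnegrE ?addr_ge0 ?mulr_ge0 ?enorm_ge0 ?(ltW c20)//.
    by rewrite mulrDl mul1r lerD.
  by rewrite /W -mulrA; lra.
apply: (@le_trans _ _ (c1 * (enorm x ^- e * sec (theta x) ^+ e) / (2 * W))); last first.
  by rewrite ler_wpM2r// invr_ge0 mulr_ge0// ltW.
rewrite ler_pdivlMr ?mulr_gt0// /kernel_gauge addSn subn1/= exprD invfM.
have xN0 : 0 < enorm x ^+ N by rewrite exprn_gt0.
have xe0 : 0 < enorm x ^+ e by rewrite exprn_gt0.
have se : 0 < sec (theta x) ^+ e by rewrite exprn_gt0// invr_gt0 cos_theta_gt0.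
have cN0 : 0 < (c2 + 1) ^+ N by rewrite exprn_gt0.
apply: (@le_trans _ _ (c * (enorm x ^- N / enorm x ^+ e * sec (theta x) ^+ e) *
   (2 * (2 * (c2 + 1) ^+ N * enorm x ^+ N)))).
  rewrite ler_wpM2l//; last by rewrite ler_wpM2l.
  by rewrite !mulr_ge0 ?invr_ge0 ?(ltW c0) ?(ltW xN0) ?(ltW xe0) ?(ltW se).
rewrite le_eqVlt; apply/orP; left; apply/eqP; rewrite cE; field.
by rewrite !gt_eqF.
Qed.

(** If the claim failed, every continuous admissible [f] of nonzero integral would
have remainder [o(psi)] along the sequence. Adding a fixed tent removes the
condition on the integral, since the remainder is linear in [f], and the
gliding hump contradicts the result. *)
Lemma sharp_remainder (e N : nat) (a : R) (b c : 'rV[R]_d.+2 -> R)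
    (rem lead : ('rV[R]_d.+1 -> R) -> 'rV[R]_d.+2 -> R) (w : 'rV[R]_d.+2 -> R) :
  (0 < e)%N -> a != 0 -> (forall x, half_space x -> 0 < b x) ->
  (forall x, half_space x -> c x != 0) ->
  (forall f x, admissible N.+1 f -> half_space x ->
    rem f x = a * b x * kernel_rem_integral e N.+1 f x) ->
  (forall f x, admissible N.+1 f -> half_space x ->
    lead f x = c x * \int[lebesgue R d.+1]_y f y) ->
  (forall x, half_space x -> w x = b x * kernel_gauge e N.+1 x) ->
  sharp N.+1 rem lead w.
Proof.
move=> e0 a0 b0 c0 remE leadE wE psi psi0 psiw xs hxs xsy.
have w0 x : half_space x -> 0 < w x.
  by move=> hx; rewrite wE// mulr_gt0 ?b0 ?kernel_gauge_gt0.
pose M := N.+1.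
have integrable_adm f : admissible M f -> lebesgue_integrable f.
  move=> fM; have := @admissible_integrable _ _ M f (fun=> 1) 1 fM (measurable_cst _) _.
  under eq_fun do rewrite mulr1; apply => y.
  by rewrite normr1 mul1r lerDr exprn_ge0// enorm_ge0.
have remD f g x : admissible M f -> admissible M g -> admissible M (fun y => f y + g y) ->
    half_space x -> rem (fun y => f y + g y) x = rem f x + rem g x.
  move=> fM gM fgM hx; rewrite !remE// -mulrDr; congr (_ * _).
  have [C C0 HC] := @kernel_rem_le_weight e N e0.
  have mk := lebesgue_measurable_kernel_rem N.+1 e0 hx.
  rewrite /kernel_rem_integral -Rintegral_lebesgueD.
  - by apply: eq_Rintegral => y _; rewrite mulrDl.
  - exact: (admissible_integrable fM mk (fun y => HC x y hx)).
  - exact: (admissible_integrable gM mk (fun y => HC x y hx)).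
apply: contrapT => nof.
have van1 f : continuous f -> admissible M f -> \int[lebesgue R d.+1]_y f y != 0 ->
    rem f (xs i) / psi (xs i) @[i --> \oo] --> (0 : R).
  move=> cf fM f0; apply: contrapT => nf; apply: nof; exists f; split => //.
  by move=> x hx; rewrite leadE// mulf_neq0// c0.
have [g [cg gM gn0]] : exists g : 'rV[R]_d.+1 -> R, [/\ continuous g, admissible M g &
    \int[lebesgue R d.+1]_y g y != 0].

  exists (tent 0 1); split; first exact: continuous_tent.
    split; first exact: lebesgue_measurable_tent.
    have ib : lebesgue_integrable (fun y => 2 * tent (0 : 'rV[R]_d.+1) 1 y).
      exact: (lebesgue_integrableZ 2 (lebesgue_integrable_tent 0 ltr01)).
    have := integrable_fin_num measurableT ib; rewrite ge0_fin_numE; last first.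
      by apply: integral_ge0 => y _; rewrite lee_fin mulr_ge0// tent_ge0.
    apply: le_lt_trans; apply: ge0_le_integral => //.
    + by move=> y _; rewrite lee_fin wnorm_integrand_ge0.
    + by apply: measurable_wnorm; exact: lebesgue_measurable_tent.
    + by apply/measurable_EFinP; exact: (lebesgue_integrable_measurable ib).
    + move=> y _; rewrite lee_fin ger0_norm ?tent_ge0// mulrC.
      have [h|h] := lerP 1 (enorm (y - 0)); first by rewrite tent_far// !mulr0.
      rewrite ler_wpM2r ?tent_ge0// /weight -[leRHS]/(1 + 1) lerD2r.
      by rewrite subr0 in h; rewrite exprn_ile1 ?enorm_ge0// ltW.
  by rewrite gt_eqF// Rintegral_tent_gt0.
(* A function of zero integral is a difference of two of nonzero integral. *)
have van f : continuous f -> admissible M f ->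
    rem f (xs i) / psi (xs i) @[i --> \oo] --> (0 : R).
  move=> cf fM; have [f0|] := eqVneq (\int[lebesgue R d.+1]_y f y) 0; last exact: van1.
  have fgM : admissible M (fun y => f y + g y).
    have [mf ff] := (admissibleP M f).1 fM; have [mg fg] := (admissibleP M g).1 gM.
    have mfg : lebesgue_measurable (fun y => f y + g y).
      by apply: measurable_funD; [exact: mf|exact: mg].
    have ffin (h : 'rV[R]_d.+1 -> R) : (wnorm M h < +oo)%E -> (wnorm M h <= (fine (wnorm M h))%:E)%E.
      move=> hfin; rewrite fineK// ge0_fin_numE//.
      by apply: integral_ge0 => y _; rewrite lee_fin wnorm_integrand_ge0.
    have hw := wnormD_le mf mg (ffin _ ff) (ffin _ fg).
    exact: (admissible_le mfg hw).
  have h1 : rem (fun y => f y + g y) (xs i) / psi (xs i) @[i --> \oo] --> (0 : R).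
    apply: van1 => //; first exact: continuous_RD.
    by rewrite Rintegral_lebesgueD ?f0 ?add0r//; exact: integrable_adm.
  have h2 := van1 _ cg gM gn0.
  have -> : (fun i => rem f (xs i) / psi (xs i)) = (fun i =>
      rem (fun y => f y + g y) (xs i) / psi (xs i) - rem g (xs i) / psi (xs i)).
    by apply/funext => i; rewrite remD// mulrDl addrK.
  by rewrite -[X in _ --> X](subrr (0 : R)); exact: cvgB h1 h2.
have [C C0 HC] := @kernel_rem_le_weight e N e0.
have [c1 c10 Hc1] := @kernel_test_function e N e0.
have [G HG] := choice (fun i => Hc1 (xs i) (hxs i)).
pose t i := a * b (xs i) / psi (xs i).
have t0 i : 0 < `|t i|.
  by rewrite normr_gt0 mulf_neq0// ?mulf_neq0// ?invr_eq0 gt_eqF// ?b0 ?psi0.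
pose K i y := t i * kernel_rem e M (xs i) y.
pose A i := `|t i| * (C * kernel_gauge e M (xs i)).
have pairE i f : admissible M f -> \int[lebesgue R d.+1]_y (f y * K i y) =
    rem f (xs i) / psi (xs i).
  move=> fM; rewrite remE// /K.
  have ik := admissible_integrable fM (lebesgue_measurable_kernel_rem N.+1 e0 (hxs i))
    (fun y => HC (xs i) y (hxs i)).
  transitivity (\int[lebesgue R d.+1]_y (t i * (f y * kernel_rem e M (xs i) y))).
    by apply: eq_Rintegral => y _; ring.
  by rewrite Rintegral_lebesgueZ// /t /kernel_rem_integral mulrAC.
have [|||||||||f [cf fM nf]] := @gliding_hump R d.+1 M K G A (fun i => enorm (xs i) / 4).
- move=> i; apply: measurable_funM; first exact: measurable_cst.
  exact: (lebesgue_measurable_kernel_rem N.+1 e0 (hxs i)).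
- move=> i y; rewrite normrM /A -mulrA ler_wpM2l//.
  exact: HC.
- move=> i; apply: mulr_ge0 (normr_ge0 _) _; apply: mulr_ge0 C0 _.
  by rewrite ltW// kernel_gauge_gt0.
- by move=> i; have [] := HG i.
- by move=> i; have [] := HG i.
- by move=> i; have [] := HG i.
- by move=> i; have [] := HG i.
- apply/cvgryPge => B; have /cvgryPge /(_ (B * 4)) := xsy.
  by apply: filterS => i; rewrite ler_pdivlMr.
- apply/cvgryPge => B.
  (* Beyond the radius where psi is at most eps * w the pairing exceeds B. *)
  pose eps := `|a| * c1 / (Num.max B 1).
  have B1 : 0 < Num.max B 1 by rewrite lt_max ltr01 orbT.
  have ac0 : 0 < `|a| * c1 by rewrite mulr_gt0// normr_gt0.
  have [r0 r00 Hr0] := (little_oP psi w0).1 psiw eps (divr_gt0 ac0 B1).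
  near=> i.
  have xi1 : 1 <= enorm (xs i) by near: i; have /cvgryPge := xsy; apply.
  have xir : r0 <= enorm (xs i) by near: i; have /cvgryPge := xsy; apply.
  have [_ mGi _ G1 /(_ xi1) Gi] := HG i.
  rewrite pairE; last exact: (admissible_le mGi G1).
  rewrite remE//; last exact: (admissible_le mGi G1).
  have := Hr0 _ (hxs i) xir; rewrite gtr0_norm ?psi0// => psile.
  rewrite !normrM normfV (gtr0_norm (psi0 _ (hxs i))) (gtr0_norm (b0 _ (hxs i))).
  rewrite ler_pdivlMr ?psi0//.
  apply: (@le_trans _ _ (Num.max B 1 * psi (xs i))).
    by rewrite ler_wpM2r ?(ltW (psi0 _ _))// le_max lexx.
  rewrite (le_trans (ler_wpM2l (ltW B1) psile))//.
  rewrite /eps mulrA [Num.max B 1 * _]mulrC divfK ?gt_eqF// wE//.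
  rewrite [leLHS](_ : _ = `|a| * b (xs i) * (c1 * kernel_gauge e N.+1 (xs i))); last by ring.
  by rewrite ler_wpM2l// mulr_ge0// ltW// b0.
- apply: nf; rewrite (_ : (fun i => _) = (fun i => rem f (xs i) / psi (xs i))).
    exact: van.
  by apply/funext => i; exact: pairE.
Unshelve. all: by end_near. Qed.

End sharpness.

(** * The Gamma function and the constant of the Poisson kernel *)

Section gamma_function.
Context {R : realType}.

Lemma powR_le_expR (a t : R) : 0 < a -> 0 < t ->
  t `^ a <= (2 * a) `^ a * expR (t / 2).
Proof.
move=> a0 t0; have a2 : 0 < 2 * a by rewrite mulr_gt0.
(* This is 1 + u <= exp u at u = t / (2 a). *)
have ta : t <= 2 * a * expR (t / (2 * a)).
  by rewrite mulrC -ler_pdivrMr// (le_trans _ (expR_ge1Dx _))// lerDr.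
have := ge0_ler_powR (ltW a0) _ _ ta; rewrite !nnegrE (ltW t0).
rewrite mulr_ge0 ?(ltW a2) ?expR_ge0// => /(_ isT isT) /le_trans; apply.
rewrite powRM ?(ltW a2) ?expR_ge0// -expRM.
by rewrite (_ : t / (2 * a) * a = t / 2)//; field; rewrite gt_eqF.
Qed.

(** The real-valued integral would be zero if the integrand were not integrable, so both
bounds matter: [t ^ a * exp (- t)] is below a multiple of [exp (- t / 2)], and it
is bounded away from zero on [[1, 2]]. *)
Lemma Gamma_gt0 (a : R) : 0 < a -> 0 < Gamma (1 + a).
Proof.
move=> a0; rewrite /Gamma [1 + a]addrC addrK.
pose F (t : R) : R := t `^ a * expR (- t).
have F0 t : 0 <= F t by rewrite mulr_ge0 ?powR_ge0 ?expR_ge0.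
have mF D : measurable_fun D (F : R -> R).
  apply: measurable_funTS; apply: measurable_funM; first exact: measurable_powR.
  apply: (@measurableT_comp _ _ _ _ _ _ (@expR R)); first exact: measurable_expR.
  by apply: continuous_measurable_fun; exact: opp_continuous.
have mE : measurable (`]0%R, +oo[%classic : set (measurableTypeR R)).
  exact: measurable_itv.
pose C : R := 2 * (2 * a) `^ a.
have iF : lebesgue_measure.-integrable `]0%R, +oo[ (EFin \o F).
  have h2 : 0 < 2^-1 :> R by rewrite invr_gt0.
  have ipdf := integrableS measurableT mE (@subsetT _ _) (integrable_exponential_pdf h2).
  apply: (le_integrable mE _ _ (integrableZl mE C ipdf)).
    by apply/measurable_EFinP; exact: mF.
  move=> t /=; rewrite in_itv/= andbT => t0.
  rewrite lee_fin ger0_norm// exponential_pdfE ?(ltW t0)// ger0_norm; last first.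
    by rewrite !mulr_ge0 ?powR_ge0 ?expR_ge0.
  rewrite /C.
  have -> : 2 * (2 * a) `^ a * (2^-1 * expR (- 2^-1 * t)) =
    ((2 * a) `^ a * expR (t / 2)) * expR (- t).
    rewrite -[in RHS]mulrA -expRD (_ : t / 2 - t = - 2^-1 * t); first by field.
    by field.
  by rewrite ler_wpM2r ?expR_ge0 ?powR_le_expR.
rewrite /Rintegral fine_gt0//; apply/andP; split; last first.
  have := integrable_fin_num mE iF; rewrite ge0_fin_numE//.
  by apply: integral_ge0 => t _; rewrite lee_fin.
have s12 : `[1%R, 2%R]%classic `<=` (`]0%R, +oo[%classic : set R).
  by move=> t /=; rewrite !in_itv/= andbT => /andP[t1 _]; rewrite (lt_le_trans _ t1).
apply: (@lt_le_trans _ _ (\int[lebesgue_measure]_(t in `[1%R, 2%R]) (F t)%:E)%E); last first.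
  apply: ge0_subset_integral => //; last by move=> t _; rewrite lee_fin.
  by apply/measurable_EFinP; exact: mF.
apply: (@lt_le_trans _ _ (\int[lebesgue_measure]_(t in `[1%R, 2%R]) (expR (- 2%R))%:E)%E).
  have m12 : lebesgue_measure (`[1%R, 2%R]%classic : set R) = 1%:E.
    by rewrite lebesgue_measure_itv/= lte_fin ltr1n -EFinB; congr _%:E; ring.
  rewrite integral_cst; last exact: measurable_itv.
  apply: (@lt_le_trans _ _ ((expR (- 2%R))%:E * 1%:E)%E); last by rewrite -m12.
  by rewrite mule1 lte_fin expR_gt0.
apply: ge0_le_integral => //.
- by apply/measurable_EFinP; exact: mF.
- move=> t /=; rewrite in_itv/= => /andP[t1 t2]; rewrite lee_fin /F.
  rewrite (@le_trans _ _ (1 * expR (- t)))//.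
    by rewrite mul1r ler_expR lerN2.
  rewrite ler_wpM2r ?expR_ge0//.
  have p1 : 1 `^ a = 1 :> R by rewrite powR1.
  by rewrite -[leLHS]p1 ge0_ler_powR ?nnegrE ?(ltW a0) ?(le_trans ler01 t1).
Qed.

Lemma alpha_gt0 n : (0 < n)%N -> 0 < alpha n :> R.
Proof.
move=> n0; have nR : 0 < n%:R :> R by rewrite ltr0n.
rewrite /alpha divr_gt0// mulr_gt0// /ball_volume divr_gt0 ?powR_gt0 ?pi_gt0//.
by rewrite Gamma_gt0// divr_gt0.
Qed.

End gamma_function.

(** * Dirichlet and Neumann integrals *)

Section poisson_integrals.
Context {R : realType} {d : nat}.
Local Notation n := d.+1.
Implicit Types (f : 'rV[R]_d -> R) (x : 'rV[R]_n) (M m : nat).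

Definition moment_integral e f m x : R :=
  \int[lebesgue R d]_y (f y * enorm y ^+ m * gegenbauer m (e%:R / 2) (Theta x y)).

Lemma moment_integral0 e f x : (0 < e)%N ->
  moment_integral e f 0 x = \int[lebesgue R d]_y f y.
Proof.
move=> e0; apply: eq_Rintegral => y _.
by rewrite gegenbauerE ?divr_gt0 ?ltr0n ?Theta_le1// gegenbauer_poly0 expr0 !mulr1.
Qed.

Lemma DtermE f m x : half_space x ->
  Dterm f m x = alpha n * height x * (enorm x ^- (m + n) * moment_integral n f m x).
Proof.
move=> hx; have x0 := half_space_neq0 hx; have nx := enorm_gt0 x0.
rewrite /Dterm /Y0 (cos_theta_hat x0).
have -> : \int[lebesgue R d]_y
    (f y * enorm y ^+ m * gegenbauer m (n%:R / 2) (Theta (hat x) y)) =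
    moment_integral n f m x.
  by apply: eq_Rintegral => y _; rewrite (Theta_hat y x0).
have -> : (m + n - 1 = m + d)%N by lia.
rewrite addnS [enorm x ^+ (m + d).+1]exprS invfM.
move: (alpha n) (moment_integral n f m x) => a I.
by field; rewrite expf_neq0 gt_eqF.
Qed.

Lemma DremE M f x : admissible M f -> half_space x ->
  Drem M f x = alpha n * height x * kernel_rem_integral n M f x.
Proof.
move=> fM hx; rewrite /Drem kernel_rem_integralE// mulrBr; congr (_ - _).
by rewrite mulr_sumr; apply: eq_bigr => m _; rewrite DtermE.
Qed.

Lemma DgaugeE M x : (0 < M)%N -> half_space x ->
  Dgauge M x = height x * kernel_gauge n M x.
Proof.
move=> M0 hx; have x0 := half_space_neq0 hx; have nx := enorm_gt0 x0.
rewrite /Dgauge /kernel_gauge subn1/= /sec cos_theta//.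
have -> : (M + n - 1 = (M + n - 2).+1)%N by lia.
rewrite !exprS; field; by rewrite ?expf_neq0 ?gt_eqF// ?invr_gt0 ?divr_gt0.
Qed.

End poisson_integrals.

Section neumann_integrals.
Context {R : realType} {d : nat}.
Local Notation n := d.+3.
Implicit Types (f : 'rV[R]_d.+2 -> R) (x : 'rV[R]_n) (M m : nat).

Let half_dim : (n%:R - 2) / 2 = d.+1%:R / 2 :> R.
Proof. by congr (_ / _); rewrite -[n]addn2 natrD addrK. Qed.

Lemma NtermE f m x : half_space x ->
  Nterm f m x = alpha n / (n%:R - 2) *
    (enorm x ^- (m + d.+1) * moment_integral d.+1 f m x).
Proof.
move=> hx; have x0 := half_space_neq0 hx.
rewrite /Nterm /Y1 half_dim.
have -> : \int[lebesgue R d.+2]_y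
    (f y * enorm y ^+ m * gegenbauer m (d.+1%:R / 2) (Theta (hat x) y)) =
    moment_integral d.+1 f m x.
  by apply: eq_Rintegral => y _; rewrite (Theta_hat y x0).
have -> : (m + n - 2 = m + d.+1)%N by lia.
by rewrite mulrCA.
Qed.

Lemma NremE M f x : admissible M f -> half_space x ->
  Nrem M f x = alpha n / (n%:R - 2) * kernel_rem_integral d.+1 M f x.
Proof.
move=> fM hx; rewrite /Nrem /Nint half_dim kernel_rem_integralE// mulrBr; congr (_ - _).
by rewrite mulr_sumr; apply: eq_bigr => m _; rewrite NtermE.
Qed.

Lemma NgaugeE M x : Ngauge M x = kernel_gauge d.+1 M x.
Proof. by rewrite /Ngauge /kernel_gauge; congr (_ ^- _ * _); lia. Qed.

End neumann_integrals.

Section little_o_remainder.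
Context {R : realType} {d : nat}.

Lemma little_o_remainder (e N : nat) (a : R) (b : 'rV[R]_d.+1 -> R)
    (rem w : 'rV[R]_d.+1 -> R) (f : 'rV[R]_d -> R) : (0 < e)%N ->
  (forall x, half_space x -> 0 < b x) -> admissible N.+1 f ->
  (forall x, half_space x -> rem x = a * b x * kernel_rem_integral e N.+1 f x) ->
  (forall x, half_space x -> w x = b x * kernel_gauge e N.+1 x) ->
  little_o rem w.
Proof.
move=> e0 b0 fM remE wE; apply/little_oP => [x hx|eps eps0].
  by rewrite wE// mulr_gt0 ?b0 ?kernel_gauge_gt0.
have a1 : 0 < `|a| + 1 by rewrite ltr_wpDl.
have [r0 r00 H] := kernel_rem_integral_littleo e0 fM (divr_gt0 eps0 a1).
exists r0 => // x hx xr; have bx := b0 x hx.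
rewrite remE// wE// !normrM (gtr0_norm bx).
apply: (@le_trans _ _ (`|a| * b x * (eps / (`|a| + 1) * kernel_gauge e N.+1 x))).
  by rewrite ler_wpM2l ?H// mulr_ge0// ltW.
rewrite -[leLHS]mulrA [leLHS]mulrCA [leRHS]mulrCA ler_wpM2l ?(ltW bx)//.
rewrite mulrA ler_wpM2r ?(ltW (kernel_gauge_gt0 _ _ hx))//.
by rewrite mulrA ler_pdivrMr// mulrC ler_wpM2l ?(ltW eps0)// lerDl.
Qed.

End little_o_remainder.

Theorem theorem4p2 (R : realType) (d M : nat) :
  let n := d.+1 in
  (1 <= M)%N ->
  ((2 <= n)%N ->
    (forall f : 'rV[R]_d -> R, admissible M f ->
      little_o (Drem M f) (Dgauge M) /\
      forall m, (m < M)%N -> spherical_harmonic_dirichlet m.+1 (Y0 f m)) /\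
    sharp M (Drem M) (fun f => Dterm f 0) (@Dgauge R d M)) /\
  ((3 <= n)%N ->
    (forall f : 'rV[R]_d -> R, admissible M f ->
      little_o (Nrem M f) (Ngauge M) /\
      forall m, (m < M)%N -> spherical_harmonic_neumann m (Y1 f m)) /\
    sharp M (Nrem M) (fun f => Nterm f 0) (@Ngauge R d M)).
Proof.
case: M => // N n _; rewrite /n {n}; split.
- case: d => // d _; have an : alpha d.+2 != 0 :> R by rewrite gt_eqF// alpha_gt0.
  split=> [f fM|].
    split=> [|m mN]; last exact: Y0_spherical_harmonic fM mN.
    apply: (@little_o_remainder R d.+1 d.+2 N (alpha d.+2) height _ _ f) => //.
    - by move=> x hx; rewrite DremE.
    - by move=> x hx; rewrite DgaugeE.
  apply: (@sharp_remainder R d d.+2 N (alpha d.+2) height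
    (fun x => alpha d.+2 * height x * enorm x ^- d.+2)) => //.
  - move=> x hx; have x0 := half_space_neq0 hx.
    apply: mulf_neq0; first by rewrite mulf_neq0// gt_eqF.
    by rewrite invr_eq0 expf_neq0// gt_eqF// enorm_gt0.
  - by move=> f x fM hx; rewrite DremE.
  - by move=> f x fM hx; rewrite DtermE// moment_integral0// add0n mulrA.
  - by move=> x hx; rewrite DgaugeE.
- case: d => [|[|d]]// _.
  have an : alpha d.+3 / (d.+3%:R - 2) != 0 :> R.
    by rewrite mulf_neq0 ?invr_eq0 ?subr_eq0 ?eqr_nat// gt_eqF// alpha_gt0.
  split=> [f fM|].
    split=> [|m mN]; last exact: Y1_spherical_harmonic fM mN.
    apply: (@little_o_remainder R d.+2 d.+1 N (alpha d.+3 / (d.+3%:R - 2)) (fun=> 1) _ _ f) => //.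
    - by move=> x hx; rewrite NremE// mulr1.
    - by move=> x hx; rewrite NgaugeE mul1r.
  apply: (@sharp_remainder R d.+1 d.+1 N (alpha d.+3 / (d.+3%:R - 2)) (fun=> 1)
    (fun x => alpha d.+3 / (d.+3%:R - 2) * enorm x ^- d.+1)) => //.
  - move=> x hx; apply: mulf_neq0 an _.
    by rewrite invr_eq0 expf_neq0// gt_eqF// enorm_gt0// half_space_neq0.
  - by move=> f x fM hx; rewrite NremE// mulr1.
  - by move=> f x fM hx; rewrite NtermE// moment_integral0// add0n mulrA.
  - by move=> x hx; rewrite NgaugeE mul1r.
Qed.
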